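(* Let $\zeta>0$, $\beta>1$ and $\gamma>0$. There is a constant $C_{\beta,\zeta,\gamma}>0$ such that the following holds. Let $n,p$ be integers with $2\le n<p\le n^\beta$, and let $(Y_1,Z_1),\dots,(Y_n,Z_n)$ be i.i.d. $\mathcal N_2(\mu,\Sigma)$ with $\Sigma_{11},\Sigma_{22}>0$ and $$\Big|\frac{\Sigma_{12}}{\sqrt{\Sigma_{11}\Sigma_{22}}}\Big|\le\Big(\zeta\sqrt{\frac{\log p}{n}}\Big)\wedge\frac34 .$$ Then $$\mathbb P\Big(|\hat\tau(Y_{1:n},Z_{1:n})-\tau(Y_1,Z_1)|\ge\gamma\sqrt{\tfrac{\log p}{n}}\Big)=2\Big(1-\Phi\big(\tfrac32\gamma\sqrt{\log p}\big)\Big)+R_{n,p,\beta,\zeta,\gamma},$$ where the error $R_{n,p,\beta,\zeta,\gamma}$ satisfies $$|R_{n,p,\beta,\zeta,\gamma}|\le C_{\beta,\zeta,\gamma}\,\frac{\log p}{n^{1/4}}\,p^{-\frac98\gamma^2}.$$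
   Context: $\Phi$ is the standard normal distribution function; $a\wedge b=\min(a,b)$. Kendall's tau correlation is $\tau(Y,Z)=\mathbb E\,\operatorname{sign}\big((Y-\tilde Y)(Z-\tilde Z)\big)$ with $(\tilde Y,\tilde Z)$ an independent copy of $(Y,Z)$ and $\operatorname{sign}x=\mathbf 1(x>0)-\mathbf 1(x<0)$; Kendall's tau sample correlation is $\hat\tau(Y_{1:n},Z_{1:n})=\frac1{n(n-1)}\sum_{k\ne l}\operatorname{sign}(Y_k-Y_l)\operatorname{sign}(Z_k-Z_l)$. *)

(* Defs.v *)
From HB Require Import structures.
From mathcomp Require Import all_boot all_order all_algebra.
From mathcomp Require Import all_classical all_reals all_analysis.

Set Implicit Arguments.
Unset Strict Implicit.
Unset Printing Implicit Defensive.

Import Order.TTheory GRing.Theory Num.Theory.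
Import numFieldNormedType.Exports.

Local Open Scope classical_set_scope.
Local Open Scope ring_scope.

Definition Phi {R : realType} (x : R) : R :=
  fine (normal_prob (0 : R) 1 `]-oo, x]).

Definition affine2 {R : realType} (mu : 'cV[R]_2) (A : 'M[R]_2)
    (g : R * R) : R * R :=
  let v := mu + A *m (\col_(i < 2) (if i == 0 then g.1 else g.2)) in
  (v 0 0, v 1 0).

(* N_2(mu, Sigma) is the law of mu + A G, where A A^T = Sigma and G has two
   independent N(0,1) coordinates; this law does not depend on the choice
   of A, and Sigma may be singular. *)
Definition has_normal2_law {d} {T : measurableType d} {R : realType}
    (P : probability T R) (X : T -> R * R)
    (mu : 'cV[R]_2) (Sigma : 'M[R]_2) : Prop :=
  exists2 A : 'M[R]_2, A *m A^T = Sigma &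
    forall B : set (R * R), measurable B ->
      P (X @^-1` B) =
      (normal_prob (0 : R) 1 \x normal_prob (0 : R) 1)%E (affine2 mu A @^-1` B).

Definition mutually_independent {d d'} {T : measurableType d}
    {T' : measurableType d'} {R : realType} (P : probability T R)
    {I : finType} (X : I -> T -> T') : Prop :=
  forall (J : {set I}) (B : I -> set T'), (forall i, measurable (B i)) ->
    P (\bigcap_(i in [set` J]) (X i @^-1` B i)) =
    (\prod_(i in J) P (X i @^-1` B i))%E.

(* The independent copy is realized on the product space: under P \x P,
   (Y, Z) evaluated at the first coordinate and (Y, Z) evaluated at the second
   coordinate are independent with the same law. *)
Definition kendall_tau {d} {T : measurableType d} {R : realType}
    (P : probability T R) (Y Z : T -> R) : R :=
  fine (\int[(P \x P)%E]_w
    (Num.sg ((Y w.1 - Y w.2) * (Z w.1 - Z w.2)))%:E)%E.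

Definition kendall_tau_hat {R : realType} {n : nat} (y z : 'I_n -> R) : R :=
  (n%:R * (n%:R - 1))^-1 *
  \sum_(k < n) \sum_(l < n | l != k)
    Num.sg (y k - y l) * Num.sg (z k - z l).

(* Main.v *)
Require Import Defs.
From HB Require Import structures.
From mathcomp Require Import all_boot all_order all_algebra.
From mathcomp Require Import all_classical all_reals all_analysis.
From mathcomp Require Import measurable_realfun ring lra.

(** The statistic tau-hat is the average over pairs of observations of the
    bounded kernel sign (y - y') sign (z - z'). Put L = log p,
    t = (3/2) gamma sqrt L and del = n^(-1/4). By the Hoeffding decomposition
    ([hoeffding_decomposition], [ustat_split]),

      (3/2) sqrt n (tau-hat - tau) = W + D,

    where W is 3 / sqrt n times the sum of the centred projections of the
    kernel at the n observations, and D is a completely degenerate double sum.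
    The event of the theorem is |W + D| >= t, and exp(-t^2/2) is the power
    p^(-(9/8) gamma^2) of the announced error.

    Variance of W. When the correlation rho vanishes, the projection is the
    product of two independent variables of mean 0 and variance 1/3, so W has
    variance 9 * (1/9) = 1. In general, after reduction to a Cholesky form by
    the rotation invariance of the Gaussian plane ([has_normal2_law_std]), a
    sign of the kernel depends on rho only with probability O(|rho|), and the
    variance of W is 1 + O(|rho|) ([kendall_variance]). By assumption |rho| is
    at most zeta sqrt L n^(-1/2).

    Size of D. A martingale moment inequality, applied once to each of the two
    summations, bounds the moments of order N of D by a constant times
    n^(-N/2) ([degenerate_moment]). Thus |D| >= del has probability
    O(n^(-N/4)), and since t^2 is at most a multiple of log n, this is smaller
    than del exp(-t^2/2) when N is large.

    Tail of W. The error has to be small relative to exp(-t^2/2). Let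
    u(v, x) = Phi((x - t) / sqrt v), which solves the heat equation. Then
    u(del^2, W) is a smoothed indicator of W >= t, and u(1 + del^2, 0) is the
    corresponding Gaussian tail. One passes from one to the other by replacing
    the n summands one at a time by an increase of the variance v ([lind_step]).
    Each replacement costs a Taylor remainder, dominated by
    exp(-t^2 + t x + t^2 v / 2) times powers of v; the mean of this exponential
    along the walk is at most a constant times exp(-t^2/2) ([emaj_psum]), as in
    a change of measure, and the powers of v sum to a multiple of 1/del
    ([smooth_moderate_deviation]). The smoothing and the remainder D are
    removed by moving the threshold by (K + 1) del with
    K^2 = t^2 + (log n) / 2 ([one_sided_bound]).

    All this requires L^2 del to be small ([regime]), and the relative error is
    then O(L del). When L^2 del is bounded below, n is bounded in terms of beta,
    zeta and gamma, and the constant can be taken so large that there is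
    nothing to prove ([small_sample]). *)

Set Implicit Arguments.
Unset Strict Implicit.
Unset Printing Implicit Defensive.

Import Order.TTheory GRing.Theory Num.Theory.
Import numFieldNormedType.Exports.

Local Open Scope classical_set_scope.
Local Open Scope ring_scope.

(** * Expectations of bounded measurable functions *)

Section bmfun.
Context d (T : measurableType d) (R : realType).
Implicit Types f g : T -> R.

(** Every random quantity below is bounded: the kernel takes values in [-1, 1]
    and smooth functions are applied to bounded sums. On this class the
    real-valued integral is linear, monotone and obeys Fubini without any
    integrability condition. *)
Definition bmfun f :=
  measurable_fun setT f /\ exists M : R, forall x, `|f x| <= M.

Lemma bm_cst (c : R) : bmfun (fun=> c).
Proof. by split; [exact: measurable_cst | exists `|c|]. Qed.

Lemma bm_add f g : bmfun f -> bmfun g -> bmfun (fun x => f x + g x).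
Proof.
move=> [mf [A fA]] [mg [B gB]]; split; first exact: measurable_funD.
by exists (A + B) => x; rewrite (le_trans (ler_normD _ _))// lerD.
Qed.

Lemma bm_mul f g : bmfun f -> bmfun g -> bmfun (fun x => f x * g x).
Proof.
move=> [mf [A fA]] [mg [B gB]]; split; first exact: measurable_funM.
by exists (A * B) => x; rewrite normrM ler_pM.
Qed.

Lemma bm_opp f : bmfun f -> bmfun (fun x => - f x).
Proof.
move=> [mf [A fA]]; split; first exact: measurableT_comp.
by exists A => x; rewrite normrN.
Qed.

Lemma bm_sub f g : bmfun f -> bmfun g -> bmfun (fun x => f x - g x).
Proof. by move=> hf hg; apply: bm_add => //; exact: bm_opp. Qed.

Lemma bm_norm f : bmfun f -> bmfun (fun x => `|f x|).
Proof.
move=> [mf [A fA]]; split; first exact: measurableT_comp.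
by exists A => x; rewrite normr_id.
Qed.

Lemma bm_exp f n : bmfun f -> bmfun (fun x => f x ^+ n).
Proof.
move=> hf; elim: n => [|n IH]; first exact: bm_cst.
under eq_fun do rewrite exprS.
exact: bm_mul.
Qed.

Lemma bm_sum (I : Type) (s : seq I) (F : I -> T -> R) :
  (forall i, bmfun (F i)) -> bmfun (fun x => \sum_(i <- s) F i x).
Proof.
move=> hF; elim: s => [|i s IH].
  by under eq_fun do rewrite big_nil; exact: bm_cst.
by under eq_fun do rewrite big_cons; exact: bm_add.
Qed.

Lemma bm_sum_ord n (F : nat -> T -> R) :
  (forall i, (i < n)%N -> bmfun (F i)) -> bmfun (fun x => \sum_(i < n) F i x).
Proof. by move=> hF; apply: bm_sum => i; apply: hF. Qed.

(** Only the values of phi on a segment containing the range of f matter, so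
    that phi may be unbounded, such as an exponential. *)
Lemma bm_cont f (phi : R -> R) : bmfun f -> continuous phi ->
  bmfun (fun x => phi (f x)).
Proof.
move=> [mf [A fA]] cphi; split.
  exact: (measurableT_comp (continuous_measurable_fun cphi)).
have cc : {within `[- A, A], continuous phi} by exact: continuous_subspaceT.
have := @compact_bounded _ _ _ (continuous_compact cc (@segment_compact _ _ _)).
move=> [M [_ hM]]; exists (M + 1) => x.
apply: (hM (M + 1)); first by rewrite ltrDl.
exists (f x) => //=; rewrite in_itv/=.
by have := fA x; rewrite ler_norml.
Qed.

End bmfun.

Lemma bm_comp d (T : measurableType d) d' (T' : measurableType d')
    (R : realType) (f : T' -> R) (g : T -> T') :
  bmfun f -> measurable_fun setT g -> bmfun (fun x => f (g x)).
Proof.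
move=> [mf [M fM]] mg; split; first exact: (measurableT_comp mf mg).
by exists M.
Qed.

Section expectation.
Context d (T : measurableType d) (R : realType) (mu : probability T R).
Implicit Types f g : T -> R.

Lemma bm_integrable f : bmfun f -> mu.-integrable setT (EFin \o f).
Proof.
move=> [mf [M fM]]; apply: measurable_bounded_integrable => //.
  by apply: (le_lt_trans (probability_le1 mu measurableT)); rewrite ltry.
by exists M; split; [exact: num_real | move=> y yM x _; exact: le_trans (fM x) (ltW yM)].
Qed.

Lemma Ex_cst (c : R) : \int[mu]_x c = c.
Proof.
rewrite Rintegral_cst// [X in fine X](_ : _ = 1%E) ?mulr1//.
exact: probability_setT.
Qed.

Lemma eq_Ex f g : f =1 g -> \int[mu]_x f x = \int[mu]_x g x.
Proof. by move=> fg; apply: eq_Rintegral => x _; exact: fg. Qed.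

Lemma ExD f g : bmfun f -> bmfun g ->
  \int[mu]_x (f x + g x) = \int[mu]_x f x + \int[mu]_x g x.
Proof. by move=> hf hg; rewrite RintegralD//; exact: bm_integrable. Qed.

Lemma ExB f g : bmfun f -> bmfun g ->
  \int[mu]_x (f x - g x) = \int[mu]_x f x - \int[mu]_x g x.
Proof. by move=> hf hg; rewrite RintegralB//; exact: bm_integrable. Qed.

Lemma ExZ (c : R) f : bmfun f -> \int[mu]_x (c * f x) = c * \int[mu]_x f x.
Proof. by move=> hf; rewrite RintegralZl//; exact: bm_integrable. Qed.

Lemma ExN f : bmfun f -> \int[mu]_x (- f x) = - \int[mu]_x f x.
Proof.
by move=> hf; rewrite -mulN1r -ExZ//; apply: eq_Ex => x; rewrite mulN1r.
Qed.

Lemma Ex_sum n (F : nat -> T -> R) : (forall i, (i < n)%N -> bmfun (F i)) ->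
  \int[mu]_x (\sum_(i < n) F i x) = \sum_(i < n) \int[mu]_x F i x.
Proof.
elim: n => [|n IH] hF.
  by under eq_Ex do rewrite big_ord0; rewrite Ex_cst big_ord0.
under eq_Ex do rewrite big_ord_recr/=.
rewrite ExD ?IH ?big_ord_recr//; last exact: hF.
  by move=> i lin; apply: hF; exact: leqW.
by apply: bm_sum_ord => i lin; apply: hF; exact: leqW.
Qed.

Lemma Ex_le f g : bmfun f -> bmfun g -> (forall x, f x <= g x) ->
  \int[mu]_x f x <= \int[mu]_x g x.
Proof. by move=> hf hg fg; apply: le_Rintegral => //; exact: bm_integrable. Qed.

Lemma Ex_ge0 f : (forall x, 0 <= f x) -> 0 <= \int[mu]_x f x.
Proof. by move=> f0; exact: Rintegral_ge0. Qed.

Lemma Ex_norm f : bmfun f -> `|\int[mu]_x f x| <= \int[mu]_x `|f x|.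
Proof. by move=> hf; apply: le_normr_Rintegral => //; exact: bm_integrable. Qed.

Lemma Ex_le_cst f (c : R) : bmfun f -> (forall x, f x <= c) ->
  \int[mu]_x f x <= c.
Proof.
by move=> hf fc; rewrite -[leRHS]Ex_cst; apply: Ex_le => //; exact: bm_cst.
Qed.

Lemma Ex_norm_le f g : bmfun f -> bmfun g -> (forall x, `|f x| <= g x) ->
  `|\int[mu]_x f x| <= \int[mu]_x g x.
Proof.
move=> hf hg fg; apply: (le_trans (Ex_norm hf)); apply: Ex_le => //.
exact: bm_norm.
Qed.

Lemma Ex_EFin f : bmfun f -> (\int[mu]_x (f x)%:E)%E = (\int[mu]_x f x)%R%:E.
Proof.
move=> hf; rewrite /Rintegral fineK//.
exact: (integrable_fin_num measurableT (bm_integrable hf)).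
Qed.

Lemma bm_indic (A : set T) : measurable A -> bmfun (\1_A : T -> R).
Proof.
move=> mA; split; first exact: measurable_indic.
by exists 1 => x; rewrite ger0_norm// indicE; case: (_ \in _).
Qed.

Lemma Ex_indic (A : set T) : measurable A -> mu A = (\int[mu]_x \1_A x)%R%:E.
Proof.
by move=> mA; rewrite -(Ex_EFin (bm_indic mA)) integral_indic// setIT.
Qed.

End expectation.

Lemma Ex_push d (T : measurableType d) d' (T' : measurableType d')
    (R : realType) (mu : probability T R) (nu : probability T' R)
    (phi : T -> T') (f : T' -> R) : measurable_fun setT phi ->
  (forall B, measurable B -> nu B = mu (phi @^-1` B)) -> bmfun f ->
  \int[nu]_x f x = \int[mu]_x f (phi x).
Proof.
move=> mphi hnu hf; rewrite /Rintegral; congr fine.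
transitivity (\int[pushforward mu phi]_x (f x)%:E)%E.
  by apply: eq_measure_integral => A mA _; exact: hnu.
rewrite integral_pushforward//; last exact: bm_integrable (bm_comp hf mphi).
by apply/measurable_EFinP; case: hf.
Qed.

Section fubini_bm.
Context d1 d2 (T1 : measurableType d1) (T2 : measurableType d2) (R : realType).
Variables (m1 : probability T1 R) (m2 : probability T2 R).
Implicit Type F : T1 * T2 -> R.

Lemma bm_sec1 F x : bmfun F -> bmfun (fun y => F (x, y)).
Proof.
by move=> hF; apply: (bm_comp hF); exact: measurable_pair1.
Qed.

Lemma bm_sec2 F y : bmfun F -> bmfun (fun x => F (x, y)).
Proof.
by move=> hF; apply: (bm_comp hF); exact: measurable_pair2.
Qed.

Lemma bm_Ex2 F : bmfun F -> bmfun (fun x => \int[m2]_y F (x, y)).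
Proof.
move=> hF; split.
  apply: (measurableT_comp (@fine_measurable R setT measurableT)).
  apply: (measurable_fubini_F (f := EFin \o F)).
  exact: (bm_integrable (m1 \x m2)%E).
have [M FM] := hF.2; exists M => x.
rewrite -(Ex_cst m2 M); apply: Ex_norm_le; [exact: bm_sec1|exact: bm_cst|].
by move=> y; exact: FM.
Qed.

Lemma bm_Ex1 F : bmfun F -> bmfun (fun y => \int[m1]_x F (x, y)).
Proof.
move=> hF; split.
  apply: (measurableT_comp (@fine_measurable R setT measurableT)).
  apply: (measurable_fubini_G (f := EFin \o F)).
  exact: (bm_integrable (m1 \x m2)%E).
have [M FM] := hF.2; exists M => y.
rewrite -(Ex_cst m1 M); apply: Ex_norm_le; [exact: bm_sec2|exact: bm_cst|].
by move=> x; exact: FM.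
Qed.

Lemma Ex_prod F : bmfun F ->
  \int[(m1 \x m2)%E]_z F z = \int[m1]_x \int[m2]_y F (x, y).
Proof.
move=> hF; rewrite [LHS]/Rintegral -[RHS]/(fine _); congr fine.
rewrite -(integral12_prod_meas1 (f := EFin \o F)); last first.
  exact: (bm_integrable (m1 \x m2)%E).
apply: eq_integral => x _; rewrite /fubini_F/=.
by rewrite Ex_EFin//; exact: bm_sec1.
Qed.

Lemma Ex_swap F : bmfun F ->
  \int[m1]_x \int[m2]_y F (x, y) = \int[m2]_y \int[m1]_x F (x, y).
Proof.
move=> hF; rewrite -Ex_prod// [LHS]/Rintegral [RHS]/Rintegral; congr fine.
rewrite -(integral21_prod_meas1 (f := EFin \o F)); last first.
  exact: (bm_integrable (m1 \x m2)%E).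
apply: eq_integral => y _; rewrite /fubini_G/=.
by rewrite Ex_EFin//; exact: bm_sec2.
Qed.

End fubini_bm.

Section kernel_projection.
Context d (S : measurableType d) (R : realType) (nu : probability S R).
Variable h : S -> S -> R.

(** First term of the Hoeffding expansion of a kernel h, and its mean. *)
Definition kproj x : R := \int[nu]_y h x y.
Definition kmean : R := \int[nu]_x kproj x.

Hypothesis bh : bmfun (fun z : S * S => h z.1 z.2).
Hypothesis h1 : forall x y, `|h x y| <= 1.

Lemma bm_kproj : bmfun kproj.
Proof. exact: (bm_Ex2 nu nu bh). Qed.

Lemma kproj_le1 x : `|kproj x| <= 1.
Proof.
rewrite -(Ex_cst nu (1 : R)); apply: Ex_norm_le => //.
  exact: (bm_sec1 x bh).
exact: bm_cst.
Qed.

Lemma kmean_le1 : `|kmean| <= 1.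
Proof.
rewrite -(Ex_cst nu (1 : R)); apply: Ex_norm_le; [exact: bm_kproj|exact: bm_cst|].
exact: kproj_le1.
Qed.

End kernel_projection.

(** * The standard normal distribution function *)

Section normal_calculus.
Context {R : realType}.
Implicit Types x y z t v K : R.

Definition phi z : R := normal_pdf 0 1 z.

Lemma phiE z : phi z = normal_peak 1 * expR (- (z ^+ 2 / 2)).
Proof.
rewrite /phi normal_pdfE ?oner_neq0// /normal_fun subr0 expr1n.
by rewrite mulNr.
Qed.

Lemma phi_ge0 z : 0 <= phi z. Proof. exact: normal_pdf_ge0. Qed.

Lemma normal_peak1_le1 : normal_peak 1 <= 1 :> R.
Proof.
rewrite /normal_peak expr1n mul1r invf_le1.
  rewrite -sqrtr1 ler_wsqrtr//.
  have := @pi_ge2 R; rewrite mulr2n; lra.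
by rewrite sqrtr_gt0 mulr2n addr_gt0// pi_gt0.
Qed.

Lemma phi_le_exp z : phi z <= expR (- (z ^+ 2 / 2)).
Proof.
by rewrite phiE ler_piMl ?expR_ge0// normal_peak1_le1.
Qed.

Lemma phi_le1 z : phi z <= 1.
Proof.
rewrite (le_trans (phi_le_exp z))// -[leRHS]expR0 ler_expR oppr_le0.
by rewrite divr_ge0// sqr_ge0.
Qed.

Lemma is_derive_phi z : is_derive z 1 phi (- z * phi z).
Proof.
have -> : phi = (fun z => normal_peak 1 * expR (- (z ^+ 2 / 2))).
  by apply/funext => y; exact: phiE.
by apply: is_derive_eq; rewrite /GRing.scale/=; field.
Qed.

Lemma is_derive_Phi z : is_derive z 1 (@Phi R) (phi z).
Proof.
have h : lebesgue_measure.-integrable [set` Interval -oo%O (BRight (z + 1))]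
    (EFin \o phi).
  apply: (@integrableS _ _ _ _ setT) => //.
  exact: integrable_normal_pdf.
have zz : z < z + 1 by rewrite ltrDl.
have cz : {for z, continuous phi}.
  by apply: continuous_normal_pdf; rewrite oner_neq0.
have [|d1 d2] := continuous_FTC1 zz h _ cz.
  by rewrite ltNyr.
split; first exact: d1.
by rewrite -derive1E.
Qed.

Lemma Phi_ge0 z : 0 <= Phi z.
Proof. by rewrite /Phi fine_ge0. Qed.

Lemma Phi_le1 z : Phi z <= 1.
Proof.
rewrite /Phi -lee_fin fineK; first exact: probability_le1.
exact: fin_num_measure.
Qed.

Lemma Phi_fin z : normal_prob 0 1 `]-oo, z] = (Phi z)%:E :> \bar R.
Proof. by rewrite /Phi fineK//; exact: fin_num_measure. Qed.

Lemma Phi_mono : {homo @Phi R : x y / x <= y}.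
Proof.
move=> x y xy; rewrite -lee_fin -!Phi_fin le_measure ?inE//.
by apply: subset_itvl; rewrite bnd_simp.
Qed.

Lemma normal_probN (A : set R) : measurable A ->
  normal_prob (0 : R) 1 (-%R @^-1` A) = normal_prob 0 1 A.
Proof.
move=> mA; rewrite /normal_prob.
have mN : measurable_fun [set: R] (-%R : R -> measurableTypeR R) by [].
rewrite [RHS](_ : _ = (\int[pushforward lebesgue_measure
    (-%R : R -> measurableTypeR R)]_(x in A) (normal_pdf 0 1 x)%:E)%E).
  rewrite ge0_integral_pushforward//=.
  - apply: eq_integral => x _; congr EFin.
    by rewrite -[LHS]/(phi _) -[RHS]/(phi _) !phiE sqrrN.
  - by apply/measurable_EFinP/measurable_funTS; exact: measurable_normal_pdf.
  - by move=> x _; rewrite lee_fin normal_pdf_ge0.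
apply: eq_measure_integral => B mB BA.
by rewrite /= lebesgue_measureN.
Qed.

Lemma normal_prob_set1 z : normal_prob (0 : R) 1 [set z] = 0%E.
Proof. by rewrite /normal_prob integral_set1. Qed.

Lemma PhiN z : Phi (- z) = 1 - Phi z.
Proof.
apply/EFin_inj; rewrite -Phi_fin EFinB -Phi_fin.
rewrite -(@probability_setT _ _ _ (normal_prob (0 : R) 1)).
have -> : [set: R] = `]-oo, z] `|` `]z, +oo[.
  exact: (esym (itv_setU_setT false z)).
rewrite measureU//=; last first.
  by apply/seteqP; split => // x [/=]; rewrite !in_itv/= andbT leNgt => /negP.
rewrite addeAC subee ?add0e; last exact: fin_num_measure.
rewrite -normal_probN//.
transitivity (normal_prob (0 : R) 1 `[z, +oo[).
  congr (normal_prob 0 1 _); apply/seteqP; split => x /=;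
    by rewrite !in_itv/= ?andbT; lra.
rewrite -(@setU1itv _ _ _ z false)//= measureU//=; last first.
  apply/seteqP; split => // x [/= ->]; rewrite in_itv/= andbT.
  by rewrite ltxx.
by rewrite [X in (X + _)%E](_ : _ = 0%E) ?add0e//; exact: normal_prob_set1.
Qed.

(** Below -K the density at x is at most exp(-K^2/2) times the density of
    N(-K, 1) at x, because K (-K - x) is nonnegative there. *)
Lemma Phi_tail K : 0 <= K -> Phi (- K) <= expR (- (K ^+ 2 / 2)).
Proof.
move=> K0; rewrite -lee_fin -Phi_fin /normal_prob.
apply: (@le_trans _ _ (\int[lebesgue_measure]_(x in `]-oo, (- K)%R])
   ((expR (- (K ^+ 2 / 2)))%:E * (normal_pdf (- K)%R 1 x)%:E))%E).
  apply: ge0_le_integral => //=.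
  - by move=> x _; rewrite lee_fin normal_pdf_ge0.
  - by apply/measurable_EFinP/measurable_funTS; exact: measurable_normal_pdf.
  - apply/measurable_EFinP/measurable_funTS/measurable_funM => //.
    exact: measurable_normal_pdf.
  move=> x; rewrite in_itv/= => xK.
  rewrite lee_fin -/(phi x) phiE normal_pdfE ?oner_neq0// /normal_fun.
  rewrite mulrCA ler_wpM2l ?normal_peak_ge0// -expRD ler_expR expr1n.
  have : 0 <= K * (- K - x) by rewrite mulr_ge0// subr_ge0.
  nra.
rewrite ge0_integralZl//=; first last.
- by move=> x _; rewrite lee_fin normal_pdf_ge0.
- by apply/measurable_EFinP/measurable_funTS; exact: measurable_normal_pdf.
rewrite -[leRHS]mule1 lee_wpmul2l ?lee_fin ?expR_ge0//.
exact: (@probability_le1 _ _ _ (normal_prob (- K)%R 1)).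
Qed.

Lemma continuous_Phi : continuous (@Phi R).
Proof.
move=> x; apply: differentiable_continuous; apply/derivable1_diffP.
by have [] := is_derive_Phi x.
Qed.

Lemma continuous_phi : continuous (@phi).
Proof. by apply: continuous_normal_pdf; rewrite oner_neq0. Qed.

(** Completing the square with w = z + a turns a z + a^2/2 into w^2/2 - z^2/2;
    the factor exp(w^2/2) then absorbs the polynomial 1 + z^2, up to 1 + a^2.
    With a the tilt of a moderate deviation, this bounds the derivatives of Phi
    by exponentials, which are easy to average along a random walk. *)
Lemma phi_tangent1 z a :
  (1 + z ^+ 2) * phi z <= 4 * (1 + a ^+ 2) * expR (a * z + a ^+ 2 / 2).
Proof.
pose w := z + a.
have h1 : 1 + z ^+ 2 <= 4 * (1 + a ^+ 2) * (1 + w ^+ 2 / 2).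
  rewrite /w; have := sqr_ge0 (z + a + a); have := sqr_ge0 (a * (z + a)).
  by have := sqr_ge0 a; have := sqr_ge0 (z + a); nra.
have h2 : 1 + w ^+ 2 / 2 <= expR (w ^+ 2 / 2).
  exact: expR_ge1Dx.
have -> : a * z + a ^+ 2 / 2 = w ^+ 2 / 2 + - (z ^+ 2 / 2).
  by rewrite /w; field.
rewrite expRD mulrA ler_pM ?phi_ge0 ?phi_le_exp//.
  by rewrite addr_ge0// sqr_ge0.
by rewrite (le_trans h1)// ler_wpM2l// mulr_ge0// addr_ge0// sqr_ge0.
Qed.

(** Same square, with half of the exponent w^2/2 spent on each factor 1 + z^2. *)
Lemma phi_tangent2 z a :
  (1 + z ^+ 2) ^+ 2 * phi z <=
  64 * (1 + a ^+ 2) ^+ 2 * expR (a * z + a ^+ 2 / 2).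
Proof.
pose w := z + a.
have h1 : 1 + z ^+ 2 <= 8 * (1 + a ^+ 2) * (1 + w ^+ 2 / 4).
  rewrite /w; have := sqr_ge0 (z + a + a); have := sqr_ge0 (a * (z + a)).
  by have := sqr_ge0 a; have := sqr_ge0 (z + a); nra.
have h2 : 1 + w ^+ 2 / 4 <= expR (w ^+ 2 / 4).
  exact: expR_ge1Dx.
have z0 : 0 <= 1 + z ^+ 2 by rewrite addr_ge0// sqr_ge0.
have a0 : 0 <= 1 + a ^+ 2 by rewrite addr_ge0// sqr_ge0.
have h3 : (1 + z ^+ 2) ^+ 2 <= 64 * (1 + a ^+ 2) ^+ 2 * expR (w ^+ 2 / 2).
  have -> : w ^+ 2 / 2 = w ^+ 2 / 4 + w ^+ 2 / 4 by field.
  rewrite expRD.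
  have -> : 64 * (1 + a ^+ 2) ^+ 2 * (expR (w ^+ 2 / 4) * expR (w ^+ 2 / 4)) =
    (8 * (1 + a ^+ 2) * expR (w ^+ 2 / 4)) ^+ 2 by ring.
  rewrite ler_sqr ?nnegrE//; last by rewrite !mulr_ge0// expR_ge0.
  by rewrite (le_trans h1)// ler_wpM2l// mulr_ge0.
have -> : a * z + a ^+ 2 / 2 = w ^+ 2 / 2 + - (z ^+ 2 / 2).
  by rewrite /w; field.
by rewrite expRD mulrA ler_pM ?phi_ge0 ?phi_le_exp// exprn_ge0.
Qed.

End normal_calculus.

(** * The heat flow of a half-line indicator *)

Section taylor.
Context {R : realType}.
Implicit Types (F G : R -> R) (M x y : R).

Lemma is_derive_cont F x (f : R) : is_derive x 1 F f -> {for x, continuous F}.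
Proof.
by case=> dF _; apply: differentiable_continuous; apply/derivable1_diffP.
Qed.

(** The next three bounds carry crude constants: each order of the Taylor
    formula on [0, 1] is the mean value bound applied to the previous one. *)
Lemma mvt_bound F F1 M : (forall x, 0 <= x <= 1 -> is_derive x 1 F (F1 x)) ->
  (forall x, 0 <= x <= 1 -> `|F1 x| <= M) ->
  forall x, 0 <= x <= 1 -> `|F x - F 0| <= M.
Proof.
move=> dF FM x /andP[x0 x1].
have sub y : 0 <= y <= x -> 0 <= y <= 1.
  by move=> /andP[-> yx]; exact: le_trans x1.
have [||c] := @MVT_segment R F F1 0 x x0.
- move=> c; rewrite in_itv/= => /andP[c0 cx]; apply: dF; by rewrite (ltW c0) (ltW (lt_le_trans cx x1)).
- apply: continuous_in_subspaceT => y; rewrite inE/= in_itv/= => yx.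
  by apply: (is_derive_cont (dF y _)); exact: sub.
rewrite in_itv/= subr0 => cx ->; rewrite normrM (ger0_norm x0).
have M0 : 0 <= M by exact: le_trans (FM c (sub _ cx)).
by rewrite (le_trans _ (ler_piMr M0 x1))// ler_wpM2r// FM// sub.
Qed.

Lemma taylor2 F F1 F2 M : (forall x, 0 <= x <= 1 -> is_derive x 1 F (F1 x)) ->
  (forall x, 0 <= x <= 1 -> is_derive x 1 F1 (F2 x)) ->
  (forall x, 0 <= x <= 1 -> `|F2 x| <= M) ->
  forall x, 0 <= x <= 1 -> `|F x - F 0 - x * F1 0| <= M.
Proof.
move=> dF dF1 FM x x01.
have := @mvt_bound (fun y => F y - y * F1 0) (fun y => F1 y - F1 0) M _ _ x x01.
have -> : F x - x * F1 0 - (F 0 - 0 * F1 0) = F x - F 0 - x * F1 0 by ring.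
apply; last exact: mvt_bound dF1 FM.
move=> y y01; have dFy := dF y y01.
by apply: is_derive_eq; rewrite /GRing.scale/=; ring.
Qed.

Lemma taylor3 F F1 F2 F3 M :
  (forall x, 0 <= x <= 1 -> is_derive x 1 F (F1 x)) ->
  (forall x, 0 <= x <= 1 -> is_derive x 1 F1 (F2 x)) ->
  (forall x, 0 <= x <= 1 -> is_derive x 1 F2 (F3 x)) ->
  (forall x, 0 <= x <= 1 -> `|F3 x| <= M) ->
  `|F 1 - F 0 - F1 0 - F2 0 / 2| <= M.
Proof.
move=> dF dF1 dF2 FM.
have I1 : 0 <= (1 : R) <= 1 by rewrite ler01 lexx.
have := @mvt_bound (fun y => F y - y * F1 0 - y ^+ 2 * (F2 0 / 2))
  (fun y => F1 y - F1 0 - y * F2 0) M _ _ 1 I1.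
have -> : F 1 - 1 * F1 0 - 1 ^+ 2 * (F2 0 / 2) -
  (F 0 - 0 * F1 0 - 0 ^+ 2 * (F2 0 / 2)) = F 1 - F 0 - F1 0 - F2 0 / 2 by ring.
apply; last exact: taylor2 dF1 dF2 FM.
move=> y y01; have dFy := dF y y01.
by apply: is_derive_eq; rewrite /GRing.scale/=; field.
Qed.

End taylor.

Section heat.
Context {R : realType}.
Implicit Types x y z t v h s : R.

(** The probability that x plus a centred Gaussian of variance v exceeds t.
    It solves d/dv heat = 1/2 d^2/dx^2 heat, so that adding an independent
    Gaussian increment to x is the same as increasing v. *)
Definition heat t v x : R := Phi ((x - t) / Num.sqrt v).
(* The first two derivatives in x. *)
Definition heat1 t v x : R := phi ((x - t) / Num.sqrt v) / Num.sqrt v.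
Definition heat2 t v x : R :=
  - ((x - t) / Num.sqrt v) * phi ((x - t) / Num.sqrt v) / v.
(** Majorant of the derivatives of the heat flow: exp(t x + t^2 v / 2) is the
    exponential martingale of tilt t, and the normalisation exp(-t^2) leaves
    exp(-t^2/2) at x = 0, v = 1. *)
Definition emaj t v x : R := expR (- t ^+ 2 + t * x + t ^+ 2 * v / 2).

Lemma emajE t v x : 0 < v ->
  expR (t * Num.sqrt v * ((x - t) / Num.sqrt v) + (t * Num.sqrt v) ^+ 2 / 2) =
  emaj t v x.
Proof.
move=> v0; congr expR; have s0 : Num.sqrt v != 0 by rewrite gt_eqF// sqrtr_gt0.
by rewrite exprMn sqr_sqrtr ?ltW//; field.
Qed.

Lemma phi_emaj1 t v x : 0 < v ->
  (1 + ((x - t) / Num.sqrt v) ^+ 2) * phi ((x - t) / Num.sqrt v) <=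
  4 * (1 + t ^+ 2 * v) * emaj t v x.
Proof.
move=> v0; have := phi_tangent1 ((x - t) / Num.sqrt v) (t * Num.sqrt v).
by rewrite emajE// [(t * _) ^+ 2]exprMn sqr_sqrtr; [|exact: ltW].
Qed.

Lemma phi_emaj2 t v x : 0 < v ->
  (1 + ((x - t) / Num.sqrt v) ^+ 2) ^+ 2 * phi ((x - t) / Num.sqrt v) <=
  64 * (1 + t ^+ 2 * v) ^+ 2 * emaj t v x.
Proof.
move=> v0; have := phi_tangent2 ((x - t) / Num.sqrt v) (t * Num.sqrt v).
by rewrite emajE// [(t * _) ^+ 2]exprMn sqr_sqrtr; [|exact: ltW].
Qed.

Lemma heat2_bound t v x : 0 < v ->
  `|heat2 t v x| <= 4 * (1 + t ^+ 2 * v) * emaj t v x / v.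
Proof.
move=> v0; rewrite /heat2 normrM normfV (gtr0_norm v0) ler_wpM2r ?invr_ge0 ?(ltW v0)//.
rewrite (le_trans _ (phi_emaj1 t x v0))// normrM normrN (ger0_norm (phi_ge0 _)).
rewrite ler_wpM2r ?phi_ge0//; set z := _ / _.
have := sqr_ge0 (`|z| - 1); rewrite sqrrB real_normK ?num_real// mulr1 expr1n.
have := sqr_ge0 z; lra.
Qed.

(** Third order expansion in space. The polynomial factor of the third
    derivative is absorbed by the majorant, which grows by at most a factor e
    along a step with |t xi| <= 1. *)
Lemma heat_taylor_x t v x xi : 0 < v -> `|t * xi| <= 1 ->
  `|heat t v (x + xi) - heat t v x - heat1 t v x * xi
    - heat2 t v x * xi ^+ 2 / 2|
  <= 4 * expR 1 * (`|xi| ^+ 3 / (v * Num.sqrt v)) * (1 + t ^+ 2 * v) * emaj t v x.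
Proof.
move=> v0 txi; set s := Num.sqrt v.
have s0 : 0 < s by rewrite sqrtr_gt0.
have sn0 : s != 0 by rewrite gt_eqF.
have vE : v = s ^+ 2 by rewrite sqr_sqrtr// ltW.
pose Z y := (x + y * xi - t) / s.
have dZ y : is_derive y 1 Z (xi / s).
  by rewrite /Z; apply: is_derive_eq; rewrite /GRing.scale/=; ring.
pose F y := Phi (Z y).
pose F1 y := phi (Z y) * (xi / s).
pose F2 y := - Z y * phi (Z y) * (xi / s) ^+ 2.
pose F3 y := (Z y ^+ 2 - 1) * phi (Z y) * (xi / s) ^+ 3.
have dPhi y : is_derive y 1 F (F1 y).
  have dZy := dZ y; have dP := is_derive_Phi (Z y).
  by apply: is_derive_eq; rewrite /F1.
have dphi y : is_derive y 1 (fun y => phi (Z y)) (- Z y * phi (Z y) * (xi / s)).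
  have dZy := dZ y; have dP := is_derive_phi (Z y).
  by apply: is_derive_eq.
have dF1 y : is_derive y 1 F1 (F2 y).
  have dp := dphi y.
  by apply: is_derive_eq; rewrite /F2 /GRing.scale/=; ring.
have dF2 y : is_derive y 1 F2 (F3 y).
  have dp := dphi y; have dZy := dZ y.
  by apply: is_derive_eq; rewrite /F3 /GRing.scale/=; ring.
have := @taylor3 R F F1 F2 F3
  (4 * expR 1 * (`|xi| ^+ 3 / (v * s)) * (1 + t ^+ 2 * v) * emaj t v x)
  (fun x _ => dPhi x) (fun x _ => dF1 x) (fun x _ => dF2 x).
have -> : F 1 - F 0 - F1 0 - F2 0 / 2 = heat t v (x + xi) - heat t v x -
   heat1 t v x * xi - heat2 t v x * xi ^+ 2 / 2.
  rewrite /F /F1 /F2 /Z /heat /heat1 /heat2 -/s mul0r addr0 mul1r vE.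
  by field.
apply=> y /andP[y0 y1].
rewrite /F3 normrM normrX normf_div (gtr0_norm s0) [(_ / s) ^+ 3]expr_div_n.
rewrite normrM (ger0_norm (phi_ge0 _)).
have -> : s ^+ 3 = v * s by rewrite vE; ring.
have h1 : `|Z y ^+ 2 - 1| * phi (Z y) <= 4 * (1 + t ^+ 2 * v) * emaj t v (x + y * xi).
  rewrite (le_trans _ (phi_emaj1 t _ v0))// ler_wpM2r ?phi_ge0//.
  by rewrite ler_norml /Z -/s; have := sqr_ge0 ((x + y * xi - t) / s); lra.
have h2 : emaj t v (x + y * xi) <= expR 1 * emaj t v x.
  rewrite /emaj -expRD ler_expR.
  have : y * (t * xi) <= 1.
    rewrite (le_trans (ler_norm _))// normrM ger0_norm//.
    by rewrite mulr_ile1.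
  by rewrite mulrDr [t * (y * xi)]mulrCA; lra.
rewrite [leRHS](_ : _ = (4 * (1 + t ^+ 2 * v) * (expR 1 * emaj t v x)) * (`|xi| ^+ 3 / (v * s))); last by ring.
rewrite ler_wpM2r ?divr_ge0 ?exprn_ge0// ?mulr_ge0 ?(ltW v0) ?(ltW s0)//.
rewrite (le_trans h1)// ler_wpM2l// !mulr_ge0// addr_ge0// mulr_ge0 ?sqr_ge0//.
exact: ltW.
Qed.

(** Second order expansion in time; the first order term is half the second
    space derivative by the heat equation, so it cancels the variance of one
    summand in the replacement argument. *)
Lemma heat_taylor_v t v x h : 0 < v -> 0 <= h ->
  `|heat t (v + h) x - heat t v x - h / 2 * heat2 t v x|
  <= 48 * (h / v) ^+ 2 * (1 + t ^+ 2 * (v + h)) ^+ 2 * emaj t (v + h) x.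
Proof.
move=> v0 h0.
have vp y : 0 <= y <= 1 -> 0 < v + y * h.
  by move=> /andP[y0 _]; rewrite ltr_pwDl// mulr_ge0.
pose y0 := x - t.
pose Z y := y0 / Num.sqrt (v + y * h).
have dZ y : 0 <= y <= 1 -> is_derive y 1 Z (- Z y / (2 * (v + y * h)) * h).
  move=> y01; have vy := vp y y01.
  have sn0 : Num.sqrt (v + y * h) != 0 by rewrite gt_eqF// sqrtr_gt0.
  have ds := is_derive1_sqrt vy.
  have vy0 : v + y * h != 0 by rewrite gt_eqF.
  have dl : is_derive y 1 (fun y => v + y * h) h.
    by apply: is_derive_eq; rewrite /GRing.scale/=; ring.
  have dsl : is_derive y 1 (fun y => Num.sqrt (v + y * h))
     ((2 * Num.sqrt (v + y * h))^-1 * h).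
    by apply: is_derive_eq.
  have dV := @is_deriveV _ (fun y => Num.sqrt (v + y * h)) y _ _ sn0 dsl.
  rewrite /Z; apply: is_derive_eq; rewrite /GRing.scale/=.
  have sE : v + y * h = Num.sqrt (v + y * h) ^+ 2 by rewrite sqr_sqrtr// ltW.
  set s := Num.sqrt _ in sn0 sE *.
  by rewrite [in RHS]sE; field.
pose F y := Phi (Z y).
pose F1 y := - Z y * phi (Z y) * (h / (2 * (v + y * h))).
pose F2 y := (3 * Z y - Z y ^+ 3) * phi (Z y) * (h / (2 * (v + y * h))) ^+ 2.
have dF y : 0 <= y <= 1 -> is_derive y 1 F (F1 y).
  move=> y01; have dZy := dZ y y01; have dP := is_derive_Phi (Z y).
  have vy0 : v + y * h != 0 by rewrite gt_eqF// vp.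
  by apply: is_derive_eq; rewrite /F1; field.
have dF1 y : 0 <= y <= 1 -> is_derive y 1 F1 (F2 y).
  move=> y01; have dZy := dZ y y01; have dP := is_derive_phi (Z y).
  have vy0 : v + y * h != 0 by rewrite gt_eqF// vp.
  have v20 : 2 * (v + y * h) != 0 by rewrite mulf_neq0.
  have dphi : is_derive y 1 (fun y => phi (Z y))
     ((- Z y * phi (Z y)) * (- Z y / (2 * (v + y * h)) * h)).
    by apply: is_derive_eq.
  have dl : is_derive y 1 (fun y => 2 * (v + y * h)) (2 * h).
    by apply: is_derive_eq; rewrite /GRing.scale/=; ring.
  have dV := @is_deriveV _ (fun y => 2 * (v + y * h)) y _ _ v20 dl.
  rewrite /F1; apply: is_derive_eq; rewrite /F2 /GRing.scale/=.
  by field.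
have I1 : 0 <= (1 : R) <= 1 by rewrite ler01 lexx.
have := @taylor2 R F F1 F2
  (48 * (h / v) ^+ 2 * (1 + t ^+ 2 * (v + h)) ^+ 2 * emaj t (v + h) x) dF dF1 _ 1 I1.
have -> : F 1 - F 0 - 1 * F1 0 =
    heat t (v + h) x - heat t v x - h / 2 * heat2 t v x.
  rewrite /F /F1 /Z /heat /heat2 -/y0 mul0r addr0 mul1r.
  by field; rewrite (gt_eqF v0) gt_eqF // sqrtr_gt0.
apply=> y y01; have vy := vp y y01; have /andP[y00 y1] := y01.
rewrite /F2 normrM normrX normrM (ger0_norm (phi_ge0 _)).
have yh : y * h <= h by rewrite ler_piMl.
have h1 : `|3 * Z y - Z y ^+ 3| * phi (Z y) <=
   192 * (1 + t ^+ 2 * (v + y * h)) ^+ 2 * emaj t (v + y * h) x.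
  rewrite [leRHS](_ : _ = 3 * (64 * (1 + t ^+ 2 * (v + y * h)) ^+ 2 * emaj t (v + y * h) x)); last by ring.
  apply: (le_trans _ (ler_wpM2l _ (phi_emaj2 t x vy))) => //.
  rewrite -/(Z y) [leRHS]mulrA ler_wpM2r ?phi_ge0//.
  have /andP[a1 a2] : - (1 + Z y ^+ 2) <= Z y <= 1 + Z y ^+ 2.
    by apply/andP; have := sqr_ge0 (Z y - 1); have := sqr_ge0 (Z y + 1); have := sqr_ge0 (Z y); split; nra.
  rewrite ler_norml; have := sqr_ge0 (Z y) => z2.
  have b1 : 0 <= (1 + Z y ^+ 2) * (1 + Z y ^+ 2 - Z y) by rewrite mulr_ge0//; lra.
  have b2 : 0 <= (1 + Z y ^+ 2) * (1 + Z y ^+ 2 + Z y) by rewrite mulr_ge0//; lra.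
  by apply/andP; split; nra.
have h2 : emaj t (v + y * h) x <= emaj t (v + h) x.
  rewrite /emaj ler_expR lerD2l ler_wpM2r// ler_wpM2l ?sqr_ge0//; lra.
have h3 : (1 + t ^+ 2 * (v + y * h)) ^+ 2 <= (1 + t ^+ 2 * (v + h)) ^+ 2.
  have p1 : 0 <= 1 + t ^+ 2 * (v + y * h).
    by rewrite addr_ge0// mulr_ge0 ?sqr_ge0// (ltW vy).
  have p2 : 0 <= 1 + t ^+ 2 * (v + h).
    by rewrite addr_ge0// mulr_ge0 ?sqr_ge0// addr_ge0// ltW.
  by rewrite ler_sqr ?nnegrE// lerD2l ler_wpM2l ?sqr_ge0// lerD2l.
have h4 : `|h / (2 * (v + y * h))| ^+ 2 <= (h / v) ^+ 2 / 4.
  rewrite real_normK ?num_real//.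
  have -> : (h / (2 * (v + y * h))) ^+ 2 = (h / (v + y * h)) ^+ 2 / 4.
    by field; rewrite gt_eqF.
  rewrite ler_wpM2r// ler_sqr ?nnegrE ?divr_ge0 ?(ltW v0) ?(ltW vy)//.
  rewrite ler_wpM2l// lef_pV2 ?posrE// lerDl mulr_ge0//.
rewrite [leRHS](_ : _ = (192 * (1 + t ^+ 2 * (v + h)) ^+ 2 * emaj t (v + h) x) * ((h / v) ^+ 2 / 4)); last by field; rewrite gt_eqF.
rewrite ler_pM// ?mulr_ge0 ?phi_ge0// ?exprn_ge0//.
apply: (le_trans h1); apply: ler_pM => //.
- by rewrite mulr_ge0// exprn_ge0// addr_ge0// mulr_ge0 ?sqr_ge0// (ltW vy).
- exact: expR_ge0.
- by rewrite ler_wpM2l.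
Qed.

Lemma heat_ge0 t v x : 0 <= heat t v x.
Proof. exact: Phi_ge0. Qed.

Lemma heat_le1 t v x : heat t v x <= 1.
Proof. exact: Phi_le1. Qed.

Let cZ t v : continuous (fun y : R => (y - t) / Num.sqrt v).
Proof.
move=> y; apply: cvgM; last exact: cvg_cst.
by apply: cvgB; [exact: cvg_id|exact: cvg_cst].
Qed.

Let cphiZ t v : continuous (fun y : R => phi ((y - t) / Num.sqrt v)).
Proof.
move=> y.
apply: (@continuous_comp _ _ _ (fun y : R => (y - t) / Num.sqrt v) phi).
  exact: cZ.
exact: continuous_phi.
Qed.

Lemma continuous_heat t v : continuous (heat t v).
Proof.
move=> y.
apply: (@continuous_comp _ _ _ (fun y : R => (y - t) / Num.sqrt v) (@Phi R)).
  exact: cZ.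
exact: continuous_Phi.
Qed.

Lemma continuous_heat1 t v : continuous (heat1 t v).
Proof. by move=> y; apply: cvgM; [exact: cphiZ|exact: cvg_cst]. Qed.

Lemma continuous_heat2 t v : continuous (heat2 t v).
Proof.
move=> y; apply: cvgM; last exact: cvg_cst.
by apply: cvgM; [apply: cvgN; exact: cZ|exact: cphiZ].
Qed.

End heat.

(** * Independent sequences and their past *)

Section law.
Context d (T : measurableType d) d' (T' : measurableType d') (R : realType).
Variables (P : probability T R) (f : T -> T') (mf : measurable_fun setT f).

(** The push-forward, made a probability for a measurable map that need not be
    packaged as a bundled function. *)
Definition law of measurable_fun setT f := fun A : set T' => P (f @^-1` A).

Local Notation lawf := (law mf).

Let law0 : lawf set0 = 0%E.
Proof. by rewrite /law preimage_set0 measure0. Qed.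

Let law_ge0 A : (0 <= lawf A)%E.
Proof. exact: measure_ge0. Qed.

Let law_sigma_additive : semi_sigma_additive lawf.
Proof. exact: (@measure_semi_sigma_additive _ _ _ (pushforward P f)). Qed.

HB.instance Definition _ := isMeasure.Build _ _ _ lawf
  law0 law_ge0 law_sigma_additive.

Let law_setT : lawf setT = 1%E.
Proof. by rewrite /law preimage_setT probability_setT. Qed.

HB.instance Definition _ := Measure_isProbability.Build _ _ _ lawf law_setT.

End law.

Section past.
Context d (T : measurableType d) dS (S : measurableType dS) (R : realType).
Variables (P : probability T R) (X : nat -> T -> S).

(** The finite-dimensional cylinders, a pi-system generating the sigma-algebra
    of X_0, ..., X_(k-1). *)
Definition past (k : nat) : set (set T) :=
  [set A | exists2 B : nat -> set S, (forall i, measurable (B i)) &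
           A = \bigcap_(i < k) X i @^-1` B i].

(** The same points with the sigma-algebra of X_0, ..., X_(k-1): measurability
    for this type is measurability with respect to the past. *)
Definition pastT (k : nat) := g_sigma_algebraType (past k).

Hypothesis mX : forall k, measurable_fun setT (X k).

Lemma past_sub k : past k `<=` measurable.
Proof.
move=> _ [B mB ->]; apply: bigcap_measurableType.
by move=> i _; rewrite -[X in measurable X]setTI; exact: mX.
Qed.

Lemma past_setT k : past k setT.
Proof.
exists (fun=> setT) => //; by apply/seteqP; split.
Qed.

Lemma past_setI k : setI_closed (past k).
Proof.
move=> _ _ [A mA ->] [B mB ->]; exists (fun i => A i `&` B i).
  by move=> i; exact: measurableI.
apply/seteqP; split.
  by move=> w [wA wB] i ik; split; [exact: wA|exact: wB].
by move=> w wAB; split => i ik; have [] := wAB i ik.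
Qed.

Lemma pastT_sub k (A : set T) : measurable (A : set (pastT k)) -> measurable A.
Proof. exact: (smallest_sub (@sigma_algebra_measurable _ T) (@past_sub k)). Qed.

Lemma measurable_pastT k : measurable_fun setT (id : T -> pastT k).
Proof. by move=> _ A mA; rewrite setTI; exact: pastT_sub mA. Qed.

Lemma measurable_X_past k i : (i < k)%N ->
  measurable_fun setT (X i : pastT k -> S).
Proof.
move=> ik _ A mA; rewrite setTI; apply: sub_sigma_algebra.
exists (fun j => if j == i then A else setT); first by move=> j; case: eqP.
apply/seteqP; split => w /=.
  by move=> wA j jk; case: eqP => [->|].
by move=> /(_ i ik); rewrite eqxx.
Qed.

End past.

Section independence.
Context d (T : measurableType d) dS (S : measurableType dS) (R : realType).
Variables (P : probability T R) (nu : probability S R) (X : nat -> T -> S).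
Variable (n : nat).

(** i.i.d. sequence of length n with common law nu, stated in the form in
    which it is used: X_k has law nu and is independent of the cylinders of
    its past. *)
Definition iid :=
  forall k, (k < n)%N -> forall B : nat -> set S, (forall i, measurable (B i)) ->
  P (\bigcap_(i < k.+1) X i @^-1` B i) =
  (P (\bigcap_(i < k) X i @^-1` B i) * nu (B k))%E.

Hypotheses (mX : forall k, measurable_fun setT (X k)) (hX : iid).

(** For fixed B both sides are finite measures in A which agree on the
    cylinders, a pi-system generating the past. *)
Lemma iid_past k (A : set (pastT X k)) (B : set S) : (k < n)%N -> measurable A ->
  measurable B -> P (A `&` X k @^-1` B) = (P A * nu B)%E.
Proof.
move=> kn mA mB.
have mXB : measurable (X k @^-1` B).
  by rewrite -[X in measurable X]setTI; exact: mX.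
pose r := NngNum (fine_ge0 (measure_ge0 nu B)).
have rE : (r%:num)%:E = nu B by rewrite /= fineK//; exact: fin_num_measure.
suff -> : P (A `&` X k @^-1` B) = mscale r P A.
  by rewrite /mscale rE muleC.
have H := (@g_sigma_algebra_measure_unique _ R T (past X k)
  (@past_sub _ _ _ _ X mX k) (fun=> setT) (fun=> past_setT X k) _
  (mrestr P mXB) (mscale r P)).
rewrite -[LHS]/(mrestr P mXB A); apply: H => //.
- by rewrite bigcup_const//; exists 0%N.
- exact: past_setI.
- move=> _ [C mC ->]; transitivity (P (\bigcap_(i < k) X i @^-1` C i) * nu B)%E; last first.
    by rewrite muleC -rE.
  rewrite /mrestr.
  pose D i := if i == k then B else C i.
  have := hX kn (B := D).
  have -> : D k = B by rewrite /D eqxx.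
  have -> : \bigcap_(i < k) X i @^-1` D i = \bigcap_(i < k) X i @^-1` C i.
    apply: eq_bigcapr => i /= ik; rewrite /D.
    by case: eqP ik => // ->; rewrite ltnn.
  move=> <-; last by move=> i; rewrite /D; case: eqP.
  congr (P _); apply/seteqP; split => w.
    move=> [wC wB] i /= ik; rewrite /D; case: eqP => [->//|/eqP ik'].
    by apply: wC => /=; rewrite ltn_neqAle ik' -ltnS.
  move=> wD; split; last by have := wD k (ltnSn k); rewrite /D/= eqxx.
  move=> i /= ik; have := wD i (ltnW ik); rewrite /D/=.
  by case: eqP ik => // ->; rewrite ltnn.
- move=> _; apply: (@le_lt_trans _ _ 1%E); last by rewrite ltry.
  by apply: probability_le1; exact: measurableI.
Qed.

Lemma iid_law k (B : set S) : (k < n)%N -> measurable B ->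
  nu B = P (X k @^-1` B).
Proof.
move=> kn mB; rewrite -[X in P X]setTI (iid_past kn)//.
by rewrite probability_setT mul1e.
Qed.

(** Freezing the past: as the joint law of the past and X_k is a product, the
    last variable can be integrated out first. All the conditional expectations
    of the proof are computed in this way. *)
Lemma iid_Ex k (F : pastT X k * S -> R) : (k < n)%N -> bmfun F ->
  \int[P]_w F (w, X k w) = \int[P]_w \int[nu]_x F (w, x).
Proof.
move=> kn hF.
have mid := @measurable_pastT _ _ _ _ X mX k.
pose Pk : probability (pastT X k) R := law P mid.
have mJ : measurable_fun setT (fun w : T => (w : pastT X k, X k w)).
  exact/measurable_fun_pair.
rewrite -(@Ex_push _ _ _ _ _ P (Pk \x nu)%E _ F mJ)//; last first.
  move=> B mB; rewrite -[RHS]/(law P mJ B).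
  apply: (@product_measure_unique _ _ _ _ R Pk nu (law P mJ)) => //.
  move=> A1 A2 mA1 mA2.
  exact: (iid_past kn).
rewrite Ex_prod//; apply: (@Ex_push _ _ _ _ _ P Pk id _ mid) => //.
exact: bm_Ex2.
Qed.

Lemma iid_Ex1 k (f : S -> R) : (k < n)%N -> bmfun f ->
  \int[P]_w f (X k w) = \int[nu]_x f x.
Proof.
move=> kn hf; rewrite (@Ex_push _ _ _ _ _ P nu _ _ (mX k))// => B mB.
exact: iid_law.
Qed.

End independence.

(** * Moderate deviations by replacement along the heat flow *)

Lemma expR_taylor {R : realType} (y : R) : `|y| <= 1 ->
  expR y <= 1 + y + y ^+ 2 / 2 + expR 1 * `|y| ^+ 3.
Proof.
move=> y1.
have dF (c x : R) : is_derive x 1 (fun x => expR (x * y) * c) (expR (x * y) * (c * y)).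
  by apply: is_derive_eq; rewrite /GRing.scale/=; ring.
have := @taylor3 R (fun x => expR (x * y) * 1) _ _ _ (expR 1 * `|y| ^+ 3)
  (fun x _ => dF _ x) (fun x _ => dF _ x) (fun x _ => dF _ x).
rewrite !mul1r !mul0r expR0 !mulr1 !mul1r => H.
have : `|expR y - 1 - y - y * y / 2| <= expR 1 * `|y| ^+ 3.
  apply: H => x /andP[x0 x1].
  rewrite [X in `|X|](_ : _ = expR (x * y) * y ^+ 3); last by ring.
  rewrite normrM normrX ger0_norm ?expR_ge0//.
  rewrite ler_wpM2r ?exprn_ge0// ler_expR (le_trans (ler_norm _))// normrM.
  by rewrite (ger0_norm x0) mulr_ile1.
by rewrite ler_norml expr2 => /andP[_]; lra.
Qed.

(** The replacement errors h v^(-3/2) compare with the integral of v^(-3/2),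
    hence telescope; their sum over the variances from del^2 to 1 + del^2 is
    then of order 1/del. *)
Lemma sqrt_telescope {R : realType} (v h : R) : 0 < v -> 0 <= h -> h <= v ->
  h / (v * Num.sqrt v) <= 4 * ((Num.sqrt v)^-1 - (Num.sqrt (v + h))^-1).
Proof.
move=> v0 h0 hv.
set a := Num.sqrt v; set c := Num.sqrt (v + h).
have a0 : 0 < a by rewrite sqrtr_gt0.
have c0 : 0 < c by rewrite sqrtr_gt0 ltr_pwDl.
have aE : a ^+ 2 = v by rewrite sqr_sqrtr// ltW.
have cE : c ^+ 2 = v + h by rewrite sqr_sqrtr// addr_ge0// ltW.
have hE : h = (c - a) * (c + a) by rewrite -subr_sqr cE aE addrAC subrr add0r.
have ac : a <= c by rewrite ler_wsqrtr// lerDl.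
have ca : 2 * c <= 3 * a.
  rewrite -ler_sqr ?nnegrE ?mulr_ge0 ?(ltW c0) ?(ltW a0)//.
  by rewrite !exprMn cE aE; nra.
have -> : h / (v * a) = (c - a) * (c * (c + a)) / (a * a * a * c).
  by rewrite hE -aE; field; rewrite !gt_eqF.
have -> : 4 * (a^-1 - c^-1) = (c - a) * (4 * (a * a)) / (a * a * a * c).
  by field; rewrite !gt_eqF.
rewrite ler_wpM2r ?invr_ge0 ?mulr_ge0 ?(ltW a0) ?(ltW c0)//.
rewrite ler_wpM2l ?subr_ge0//.
have := mulr_ge0 (ltW a0) (ltW a0); have : 0 <= (3 * a - 2 * c) * (3 * a + 2 * c + 2 * a).
  by rewrite mulr_ge0 ?subr_ge0// !addr_ge0// mulr_ge0// ltW.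
nra.
Qed.

(** Collects the three Taylor remainders of one replacement step: up to a
    constant, everything is a multiple of h v^(-3/2) or of h. *)
Lemma lind_algebra {R : realType} (h v s del eta t B : R) :
  0 <= h -> 0 < v -> 0 < s -> s ^+ 2 = v -> del <= s -> h <= v -> v <= 2 ->
  0 < del -> del <= 1 -> del ^+ 4 = h -> 0 <= t -> t ^+ 2 * del ^+ 2 <= 1 ->
  0 <= eta -> 0 <= B ->
  4 * expR 1 * ((B * del ^+ 2) ^+ 3 / (v * s)) * (1 + t ^+ 2 * v) +
  48 * (h / v) ^+ 2 * (1 + t ^+ 2 * (v + h)) ^+ 2 +
  2^-1 * (eta * h) * (4 * (1 + t ^+ 2 * v) / v) <=
  (4 * expR 1 * B ^+ 3 + 384) * (h / (v * s) * (eta + del ^+ 2) +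
      h * (eta * t ^+ 2 + del * t ^+ 2)).
Proof.
move=> h0 v0 s0 sE sd hv v2 del0 del1 del4 t0 t2del2 eta0 B0.
have tv0 : 0 <= t ^+ 2 * v by rewrite mulr_ge0 ?exprn_ge0// ltW.
pose K3 := 4 * expR 1 * ((B * del ^+ 2) ^+ 3 / (v * s)) * (1 + t ^+ 2 * v).
pose Kv := 48 * (h / v) ^+ 2 * (1 + t ^+ 2 * (v + h)) ^+ 2.
pose K2 := 4 * (1 + t ^+ 2 * v) / v.
have vn0 : v != 0 by rewrite gt_eqF.
have sn0 : s != 0 by rewrite gt_eqF.
have vs0 : 0 < (v * s)^-1 by rewrite invr_gt0 mulr_gt0.
have k3 : K3 <= 4 * expR 1 * B ^+ 3 * (h / (v * s) * del ^+ 2 + h * (del * t ^+ 2)).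
  rewrite /K3 (_ : (B * del ^+ 2) ^+ 3 = B ^+ 3 * (del ^+ 4 * del ^+ 2)); last by ring.
  rewrite del4.
  rewrite (_ : _ * (1 + t ^+ 2 * v) = 4 * expR 1 * B ^+ 3 * (h / (v * s) * del ^+ 2 + h * (del ^+ 2 / s * t ^+ 2))); last by field; rewrite ?vn0 ?sn0.
  rewrite ler_wpM2l ?mulr_ge0 ?expR_ge0 ?exprn_ge0// lerD2l ler_wpM2l ?h0//.
  rewrite ler_wpM2r ?exprn_ge0// expr2 -mulrA ler_piMr ?(ltW del0)//.
  by rewrite ler_pdivrMr// mul1r.
have k2 : 2^-1 * (eta * h) * K2 <= 4 * (h / (v * s) * eta + h * (eta * t ^+ 2)).
  rewrite /K2 (_ : 2^-1 * _ * _ = 2 * (h * eta * (v^-1 + t ^+ 2))); last by field; rewrite ?vn0 ?sn0.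
  have s2 : s <= 2 by rewrite -ler_sqr ?nnegrE ?(ltW s0)// sE; lra.
  have vi : v^-1 <= 2 * (v * s)^-1.
    rewrite invfM mulrCA ler_peMr ?invr_ge0 ?(ltW v0)//.
    by rewrite ler_pdivlMr// mul1r.
  have he : 0 <= h * eta by rewrite mulr_ge0// ltW.
  have := ler_wpM2l he vi; have : 0 <= h * eta * t ^+ 2 by rewrite mulr_ge0 ?exprn_ge0.
  by nra.
have kv : Kv <= 384 * (h / (v * s) * del ^+ 2 + h * (del * t ^+ 2)).
  have q1 : (1 + t ^+ 2 * (v + h)) ^+ 2 <= 2 + 8 * (t ^+ 2 * v) ^+ 2.
    have a1 : 1 + t ^+ 2 * (v + h) <= 1 + 2 * (t ^+ 2 * v).
      by rewrite lerD2l; have : t ^+ 2 * h <= t ^+ 2 * v by [rewrite ler_wpM2l ?sqr_ge0]; lra.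
    have a0 : 0 <= 1 + t ^+ 2 * (v + h).
      by rewrite addr_ge0// mulr_ge0 ?sqr_ge0// addr_ge0// ltW.
    apply: (@le_trans _ _ ((1 + 2 * (t ^+ 2 * v)) ^+ 2)).
      by rewrite lerXn2r ?nnegrE// addr_ge0// mulr_ge0.
    by have := sqr_ge0 (1 - 2 * (t ^+ 2 * v)); nra.
  apply: (@le_trans _ _ (48 * (h / v) ^+ 2 * (2 + 8 * (t ^+ 2 * v) ^+ 2))).
    by rewrite ler_wpM2l// mulr_ge0// sqr_ge0.
  rewrite (_ : _ * _ = 96 * (h * (h / v ^+ 2)) + 384 * (h * (h * t ^+ 4))); last by field; rewrite ?vn0 ?sn0.
  have r1 : h / v ^+ 2 <= (v * s)^-1 * del ^+ 2.
    rewrite -del4 (_ : v ^+ 2 = v * s * s); last by rewrite -mulrA -expr2 sE.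
    rewrite invfM mulrCA ler_wpM2l ?(ltW vs0)//.
    rewrite ler_pdivrMr// (_ : 4%N = (2 + 2)%N)// exprD ler_wpM2l ?exprn_ge0 ?(ltW del0)//.
    by rewrite (le_trans _ sd)// expr2 ler_piMl ?(ltW del0).
  have r2 : h * t ^+ 4 <= del * t ^+ 2.
    rewrite -del4 (_ : del ^+ 4 * t ^+ 4 = (del * t ^+ 2) * (del * (t ^+ 2 * del ^+ 2))); last by ring.
    rewrite ler_piMr ?mulr_ge0 ?exprn_ge0 ?(ltW del0)//.
    by rewrite mulr_ile1 ?(ltW del0)// mulr_ge0 ?exprn_ge0 ?(ltW del0).
  have p1 : 0 <= h * ((v * s)^-1 * del ^+ 2).
    by rewrite !mulr_ge0 ?h0 ?(ltW vs0) ?exprn_ge0 ?(ltW del0).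
  have := ler_wpM2l h0 r1; have := ler_wpM2l h0 r2.
  by nra.
have hd1 : 0 <= h / (v * s) * del ^+ 2.
  by rewrite !mulr_ge0 ?h0 ?(ltW vs0) ?exprn_ge0 ?(ltW del0).
have hd2 : 0 <= h / (v * s) * eta by rewrite !mulr_ge0 ?h0 ?(ltW vs0).
have hd3 : 0 <= h * (eta * t ^+ 2) by rewrite !mulr_ge0 ?h0 ?exprn_ge0.
have hd4 : 0 <= h * (del * t ^+ 2) by rewrite !mulr_ge0 ?h0 ?(ltW del0) ?exprn_ge0.
have B30 : 0 <= 4 * expR 1 * B ^+ 3 by rewrite !mulr_ge0 ?expR_ge0 ?exprn_ge0.
have alg (a1 a2 a3 cc p1 p2 q1 q2 : R) : 0 <= cc -> 0 <= p1 -> 0 <= p2 ->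
    0 <= q1 -> 0 <= q2 -> a1 <= cc * (p1 + q1) -> a2 <= 384 * (p1 + q1) ->
    a3 <= 4 * (p2 + q2) -> a1 + a2 + a3 <= (cc + 384) * (p2 + p1 + (q2 + q1)).
  clear; move=> c0 p10 p20 q10 q20 k1 k2 k3.
  by have := mulr_ge0 c0 p20; have := mulr_ge0 c0 q20; lra.
rewrite (mulrDr (h / (v * s))) (mulrDr h).
exact: (alg _ _ _ _ _ _ _ _ B30 hd1 hd2 hd4 hd3 k3 kv k2).
Qed.

(** Constant of the replacement argument for summands bounded by B n^(-1/2):
    a bound for the exponential moment, times the constant of the Taylor
    remainders. *)
Definition lindC {R : realType} (B : R) : R :=
  expR (1 + expR 1 * B ^+ 3) * (4 * expR 1 * B ^+ 3 + 384).

Lemma lindC_ge0 {R : realType} (B : R) : 0 <= B -> 0 <= lindC B.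
Proof.
move=> B0; apply: mulr_ge0; first exact: expR_ge0.
apply: addr_ge0; last exact: ler0n.
by apply: mulr_ge0; [rewrite mulr_ge0 ?expR_ge0|rewrite exprn_ge0].
Qed.

Section lindeberg.
Context d (T : measurableType d) (R : realType) (P : probability T R).
Variables (n : nat) (xi : nat -> T -> R) (del eta t B : R).

(** The summands xi are bounded by B del^2 with del^2 = n^(-1/2), and have
    variance 1/n up to a relative error eta. Independence enters only through
    the product rule between a partial sum and the next summand. *)
Definition psum (k : nat) (w : T) := \sum_(i < k) xi i w.

Hypotheses (mxi : forall k, (k < n)%N -> bmfun (xi k)).
Hypotheses (xib : forall k w, (k < n)%N -> `|xi k w| <= B * del ^+ 2).
Hypothesis indep : forall k (f g : R -> R), (k < n)%N -> continuous f ->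
  continuous g ->
  \int[P]_w (f (psum k w) * g (xi k w)) =
  (\int[P]_w f (psum k w)) * (\int[P]_w g (xi k w)).
Hypothesis xi0 : forall k, (k < n)%N -> \int[P]_w xi k w = 0.
Local Notation h := (n%:R^-1 : R).
Hypothesis xi2 : forall k, (k < n)%N -> `|\int[P]_w (xi k w ^+ 2) - h| <= eta * h.
Hypotheses (n0 : (0 < n)%N) (del0 : 0 < del) (del4 : del ^+ 4 = h).
Hypotheses (B0 : 0 <= B) (t0 : 0 <= t) (t3 : t ^+ 3 * del ^+ 2 <= 1).
Hypotheses (eta0 : 0 <= eta) (eta1 : t ^+ 2 * eta <= 1).
Hypothesis tB : t * (B * del ^+ 2) <= 1.

Let h0 : 0 < h. Proof. by rewrite invr_gt0 ltr0n. Qed.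

Let del1 : del <= 1.
Proof.
rewrite leNgt; apply/negP => d1.
have : 1 < del ^+ 4 by rewrite exprn_egt1.
by rewrite del4 ltNge invf_le1 ?ltr0n// ler1n n0.
Qed.

Let t2del2 : t ^+ 2 * del ^+ 2 <= 1.
Proof.
have [t1|t1] := leP t 1.
  by rewrite mulr_ile1 ?exprn_ge0 ?exprn_ile1// ltW.
apply: le_trans t3; rewrite ler_wpM2r ?exprn_ge0 ?(ltW del0)//.
by rewrite ler_eXn2l.
Qed.

Let bmS k : (k <= n)%N -> bmfun (psum k).
Proof.
by move=> kn; apply: bm_sum_ord => i ik; apply: mxi; exact: leq_trans ik kn.
Qed.

(** Exponential moment of one summand, from the third order expansion of the
    exponential: relative to the Gaussian value exp(h t^2/2), the excess in the
    exponent is h (t^2 eta/2 + e B^3), which sums up to a constant. *)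
Lemma mgf_step k : (k < n)%N ->
  \int[P]_w expR (t * xi k w) <=
  expR (h * (t ^+ 2 / 2 + t ^+ 2 * eta / 2 + expR 1 * B ^+ 3)).
Proof.
move=> kn; apply: le_trans (expR_ge1Dx _).
have bx := mxi kn.
have txb w : `|t * xi k w| <= t * (B * del ^+ 2).
  by rewrite normrM (ger0_norm t0) ler_wpM2l// xib.
have Bd0 : 0 <= B * del ^+ 2 by rewrite mulr_ge0// exprn_ge0// ltW.
apply: (@le_trans _ _ (\int[P]_w (1 + t * xi k w + t ^+ 2 / 2 * xi k w ^+ 2 +
   expR 1 * (t * (B * del ^+ 2)) ^+ 3))).
  apply: Ex_le.
  - apply: (@bm_cont _ _ _ (xi k) (fun y => expR (t * y))) => //.
    by move=> y; apply: continuous_comp; [exact: mulrl_continuous|exact: continuous_expR].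
  - apply: bm_add; last exact: bm_cst.
    apply: bm_add; last by apply: bm_mul; [exact: bm_cst|exact: bm_exp].
    by apply: bm_add; [exact: bm_cst|apply: bm_mul => //; exact: bm_cst].
  move=> w; have y1 : `|t * xi k w| <= 1 by exact: le_trans (txb w) tB.
  apply: (le_trans (expR_taylor y1)); rewrite exprMn.
  have : expR 1 * `|t * xi k w| ^+ 3 <= expR 1 * (t * (B * del ^+ 2)) ^+ 3.
    by rewrite ler_wpM2l ?expR_ge0// lerXn2r ?nnegrE// mulr_ge0.
  lra.
have c1 : bmfun (fun w : T => 1 : R) by exact: bm_cst.
have c2 : bmfun (fun w => t * xi k w) by apply: bm_mul => //; exact: bm_cst.
have c3 : bmfun (fun w => t ^+ 2 / 2 * xi k w ^+ 2).
  by apply: bm_mul; [exact: bm_cst|exact: bm_exp].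
rewrite ExD; [|by do 2?apply: bm_add|exact: bm_cst].
rewrite ExD//; last exact: bm_add.
rewrite ExD// ExZ// ExZ; last exact: bm_exp.
rewrite !Ex_cst xi0// mulr0 addr0.
have := xi2 kn; rewrite ler_norml => /andP[_ s2].
have e3 : (t * (B * del ^+ 2)) ^+ 3 <= h * B ^+ 3.
  rewrite (_ : _ ^+ 3 = B ^+ 3 * del ^+ 4 * (t ^+ 3 * del ^+ 2)); last by ring.
  rewrite del4 [leRHS]mulrC ler_piMr// mulr_ge0 ?exprn_ge0// ltW//.
have := ler_wpM2l (expR_ge0 (1 : R)) e3.
have : t ^+ 2 / 2 * \int[P]_w xi k w ^+ 2 <= t ^+ 2 / 2 * (h + eta * h).
  by rewrite ler_wpM2l ?divr_ge0 ?exprn_ge0//; lra.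
by nra.
Qed.

Lemma mgf_psum k : (k <= n)%N ->
  \int[P]_w expR (t * psum k w) <=
  expR (k%:R * h * (t ^+ 2 / 2 + t ^+ 2 * eta / 2 + expR 1 * B ^+ 3)).
Proof.
have ce : continuous (fun y : R => expR (t * y)).
  by move=> y; apply: continuous_comp; [exact: mulrl_continuous|exact: continuous_expR].
elim: k => [|k IH] kn.
  rewrite !mul0r expR0 -[leRHS](Ex_cst P) le_eqVlt; apply/orP; left; apply/eqP.
  by apply: eq_Ex => w; rewrite /psum big_ord0 mulr0 expR0.
under eq_Ex do rewrite /psum big_ord_recr/= mulrDr expRD.
rewrite (@indep k (fun y => expR (t * y)) (fun y => expR (t * y)) kn ce ce).
rewrite -natr1 mulrDl mul1r mulrDl expRD ler_pM//.
- by apply: Ex_ge0 => w; exact: expR_ge0.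
- by apply: Ex_ge0 => w; exact: expR_ge0.
- by apply: IH; exact: ltnW.
- exact: mgf_step.
Qed.

(** Remaining Gaussian variance after k steps. *)
Definition rvar (k : nat) : R := del ^+ 2 + (n - k)%:R * h.

Let rvarS k : (k < n)%N -> rvar k = rvar k.+1 + h.
Proof.
move=> kn; rewrite /rvar -addrA; congr (_ + _).
by rewrite -(subnSK kn) -natr1 mulrDl mul1r.
Qed.

Let rvar_ge k : del ^+ 2 <= rvar k.
Proof. by rewrite /rvar lerDl mulr_ge0// ltW. Qed.

Let rvar_gt0 k : 0 < rvar k.
Proof. by apply: lt_le_trans (rvar_ge k); rewrite exprn_gt0. Qed.

Let nh : n%:R * h = 1.
Proof. by rewrite mulfV// pnatr_eq0 -lt0n. Qed.

Let rvar_le k : rvar k <= 2.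
Proof.
rewrite /rvar (_ : 2 = 1 + 1)// lerD//; first by rewrite exprn_ile1// ltW.
by rewrite -[leRHS]nh ler_wpM2r ?(ltW h0)// ler_nat leq_subr.
Qed.

Let bm_emaj v k : (k <= n)%N -> bmfun (fun w => emaj t v (psum k w)).
Proof.
move=> kn; apply: (@bm_cont _ _ _ (psum k) (emaj t v)); first exact: bmS.
move=> y; apply: continuous_comp; last exact: continuous_expR.
apply: continuousD; last exact: cst_continuous.
by apply: continuousD; [exact: cst_continuous|exact: mulrl_continuous].
Qed.

(** Along the walk the majorant keeps, up to a constant factor, the value
    exp(-t^2/2) which it has for Gaussian summands: the tilt of the partial sum
    is compensated by the remaining variance. This is what makes the error of
    the replacement argument relative to the Gaussian tail. *)
Lemma emaj_psum k : (k <= n)%N ->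
  \int[P]_w emaj t (rvar k) (psum k w) <=
  expR (1 + expR 1 * B ^+ 3) * expR (- (t ^+ 2 / 2)).
Proof.
move=> kn.
have -> : \int[P]_w emaj t (rvar k) (psum k w) =
  expR (- t ^+ 2 + t ^+ 2 * rvar k / 2) * \int[P]_w expR (t * psum k w).
  rewrite -ExZ.
    by apply: eq_Ex => w; rewrite -expRD /emaj; congr expR; ring.
  apply: (@bm_cont _ _ _ (psum k) (fun y => expR (t * y))); first exact: bmS.
  by move=> y; apply: continuous_comp; [exact: mulrl_continuous|exact: continuous_expR].
apply: (le_trans (ler_wpM2l (expR_ge0 _) (mgf_psum kn))).
rewrite -!expRD ler_expR /rvar natrB// mulrBl nh.
have kh : 0 <= k%:R * h <= 1.
  by rewrite mulr_ge0 ?(ltW h0)//= -[leRHS]nh ler_wpM2r ?(ltW h0)// ler_nat.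
have /andP[kh0 kh1] := kh.
set u := k%:R * h in kh0 kh1 *.
have u1 : u * (expR 1 * B ^+ 3) <= expR 1 * B ^+ 3.
  by rewrite ler_piMl// mulr_ge0 ?expR_ge0 ?exprn_ge0.
have u2 : u * (t ^+ 2 * eta) <= 1.
  by rewrite (le_trans _ eta1)// ler_piMl// mulr_ge0 ?exprn_ge0.
by move: t2del2; nra.
Qed.

Let bm_heat v k : (k <= n)%N -> bmfun (fun w => heat t v (psum k w)).
Proof. by move=> kn; apply: (bm_cont (bmS kn)); exact: continuous_heat. Qed.

(** Replacing the summand xi_k by a Gaussian increment of variance h. The first
    order terms cancel as xi_k is centred and independent of the past, the
    second order ones up to the variance error eta h, and the remainders are
    bounded by the majorant. *)
Lemma lind_step k : (k < n)%N ->
  `|\int[P]_w heat t (rvar k.+1) (psum k.+1 w) -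
    \int[P]_w heat t (rvar k) (psum k w)| <=
  lindC B * expR (- (t ^+ 2 / 2)) *
  (h / (rvar k.+1 * Num.sqrt (rvar k.+1)) * (eta + del ^+ 2) +
   h * (eta * t ^+ 2 + del * t ^+ 2)).
Proof.
move=> kn; set v := rvar k.+1.
have v0 : 0 < v := rvar_gt0 k.+1.
have vS : rvar k = v + h := rvarS kn.
have bx := mxi kn; have bS := bmS (ltnW kn).
set s := Num.sqrt v.
have s0 : 0 < s by rewrite sqrtr_gt0.
have sE : s ^+ 2 = v by rewrite sqr_sqrtr// ltW.
have vd := rvar_ge k.+1; rewrite -/v in vd.
have sd : del <= s by rewrite -(ger0_norm (ltW del0)) -sqrtr_sqr ler_wsqrtr.
have hv : h <= v.
  rewrite (le_trans _ vd)// -del4 (_ : 4%N = (2 + 2)%N)// exprD ler_piMl//.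
    by rewrite exprn_ge0// ltW.
  by rewrite exprn_ile1// ltW.
have v2 : v <= 2 := rvar_le k.+1.
set E := fun w => emaj t (v + h) (psum k w).
have bE : bmfun E by apply: bm_emaj; exact: ltnW.
have EE : \int[P]_w E w <= expR (1 + expR 1 * B ^+ 3) * expR (- (t ^+ 2 / 2)).
  by rewrite /E -vS; apply: emaj_psum; exact: ltnW.
have E0 : 0 <= \int[P]_w E w by apply: Ex_ge0 => w; exact: expR_ge0.
have ev w : emaj t v (psum k w) <= E w.
  by rewrite /E /emaj ler_expR lerD2l ler_wpM2r// ler_wpM2l ?sqr_ge0// lerDl ltW.
have tv0 : 0 <= t ^+ 2 * v by rewrite mulr_ge0 ?exprn_ge0// ltW.
pose b := B * del ^+ 2.
have b0 : 0 <= b by rewrite mulr_ge0// exprn_ge0// ltW.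
pose K3 := 4 * expR 1 * (b ^+ 3 / (v * s)) * (1 + t ^+ 2 * v).
pose Kv := 48 * (h / v) ^+ 2 * (1 + t ^+ 2 * (v + h)) ^+ 2.
pose K2 := 4 * (1 + t ^+ 2 * v) / v.
have K20 : 0 <= K2 by rewrite divr_ge0 ?(ltW v0)// mulr_ge0// addr_ge0.
have b_h1x : bmfun (fun w => heat1 t v (psum k w) * xi k w).
  by apply: bm_mul => //; apply: (bm_cont bS); exact: continuous_heat1.
have b_h2 : bmfun (fun w => heat2 t v (psum k w)).
  by apply: (bm_cont bS); exact: continuous_heat2.
have b_h2x : bmfun (fun w => heat2 t v (psum k w) * xi k w ^+ 2).
  by apply: bm_mul => //; exact: bm_exp.
have b_u := bm_heat v (ltnW kn).
have bu' : bmfun (fun w => heat t v (psum k w + xi k w)).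
  have := bm_heat v kn; congr bmfun; apply/funext => w.
  by rewrite /psum big_ord_recr.
have vh0 : 0 < v + h by rewrite addr_gt0.
have b_uh := bm_heat (v + h) (ltnW kn).
pose R3 w := heat t v (psum k w + xi k w) - heat t v (psum k w)
   - heat1 t v (psum k w) * xi k w - 2^-1 * (heat2 t v (psum k w) * xi k w ^+ 2).
pose Rv w := heat t (v + h) (psum k w) - heat t v (psum k w)
   - h / 2 * heat2 t v (psum k w).
have c_half c f : bmfun f -> bmfun (fun w : T => c * f w : R).
  by move=> hf; apply: bm_mul => //; exact: bm_cst.
have bR3 : bmfun R3.
  by do 3?apply: bm_sub => //; exact: c_half.
have bRv : bmfun Rv.
  by do 2?apply: bm_sub => //; exact: c_half.
have IR3 : `|\int[P]_w R3 w| <= K3 * \int[P]_w E w.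
  rewrite -ExZ//; apply: Ex_norm_le => //; first exact: c_half.
  move=> w; have xw : `|xi k w| <= b by exact: xib.
  have tx : `|t * xi k w| <= 1.
    by rewrite normrM (ger0_norm t0) (le_trans _ tB)// ler_wpM2l.
  have := @heat_taylor_x R t v (psum k w) (xi k w) v0 tx.
  rewrite (_ : heat2 t v (psum k w) * xi k w ^+ 2 / 2 =
     2^-1 * (heat2 t v (psum k w) * xi k w ^+ 2)); last by field.
  move=> /le_trans; apply; rewrite -/s /K3.
  apply: ler_pM => //.
  - apply: mulr_ge0; last by rewrite addr_ge0.
    apply: mulr_ge0; first by rewrite mulr_ge0 ?expR_ge0.
    by rewrite divr_ge0 ?exprn_ge0// mulr_ge0 ?(ltW v0) ?(ltW s0).
  - exact: expR_ge0.
  rewrite ler_wpM2r ?addr_ge0// ler_wpM2l ?mulr_ge0 ?expR_ge0//.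
  rewrite ler_wpM2r ?invr_ge0 ?mulr_ge0 ?(ltW v0) ?(ltW s0)//.
  by rewrite lerXn2r ?nnegrE.
have IRv : `|\int[P]_w Rv w| <= Kv * \int[P]_w E w.
  rewrite -ExZ//; apply: Ex_norm_le => //; first exact: c_half.
  move=> w; exact: (@heat_taylor_v R t v (psum k w) h v0 (ltW h0)).
have Ih2 : `|\int[P]_w heat2 t v (psum k w)| <= K2 * \int[P]_w E w.
  rewrite -ExZ//; apply: Ex_norm_le => //; first exact: c_half.
  move=> w; apply: (le_trans (heat2_bound t (psum k w) v0)).
  rewrite /K2 mulrAC ler_wpM2l//.
have D1 : \int[P]_w heat t v (psum k.+1 w) - \int[P]_w heat t (v + h) (psum k w)
   = \int[P]_w R3 w - \int[P]_w Rv w +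
     2^-1 * (\int[P]_w xi k w ^+ 2 - h) * \int[P]_w heat2 t v (psum k w).
  have -> : \int[P]_w R3 w = \int[P]_w heat t v (psum k w + xi k w)
      - \int[P]_w heat t v (psum k w)
      - 2^-1 * (\int[P]_w heat2 t v (psum k w) * \int[P]_w xi k w ^+ 2).
    rewrite /R3 ExB; [|by apply: bm_sub => //; exact: bm_sub|exact: c_half].
    rewrite ExB//; last exact: bm_sub.
    rewrite ExB// ExZ//.
    rewrite (@indep k (heat1 t v) id kn (@continuous_heat1 _ t v) (fun x => @cvg_id _ (nbhs x))) xi0//.
    rewrite (@indep k (heat2 t v) (fun x => x ^+ 2) kn (@continuous_heat2 _ t v)).
      by rewrite mulr0 subr0.
    exact: exprn_continuous.
  have -> : \int[P]_w Rv w = \int[P]_w heat t (v + h) (psum k w)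
      - \int[P]_w heat t v (psum k w)
      - h / 2 * \int[P]_w heat2 t v (psum k w).
    rewrite /Rv ExB//; [|exact: bm_sub|exact: c_half].
    by rewrite ExB// ExZ.
  have -> : \int[P]_w heat t v (psum k.+1 w) = \int[P]_w heat t v (psum k w + xi k w).
    by apply: eq_Ex => w; rewrite /psum big_ord_recr.
  move: (\int[P]_w heat t v (psum k w + xi k w)) (\int[P]_w heat t v (psum k w))
    (\int[P]_w heat2 t v (psum k w)) (\int[P]_w xi k w ^+ 2)
    (\int[P]_w heat t (v + h) (psum k w)) => a1 a2 a3 a4 a5.
  by field; rewrite pnatr_eq0 -lt0n.
rewrite vS D1.
set IE := \int[P]_w E w in EE E0 IR3 IRv Ih2.
have X2 := xi2 kn.
have tot : `|\int[P]_w R3 w - \int[P]_w Rv w +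
     2^-1 * (\int[P]_w xi k w ^+ 2 - h) * \int[P]_w heat2 t v (psum k w)| <=
   (K3 + Kv + 2^-1 * (eta * h) * K2) * IE.
  apply: (le_trans (ler_normD _ _)); rewrite [leRHS]mulrDl lerD//.
    by apply: (le_trans (ler_normB _ _)); rewrite mulrDl lerD.
  have Hm := ler_pM (normr_ge0 _) (normr_ge0 _) X2 Ih2.
  rewrite -normrM in Hm.
  rewrite -[2^-1 * _ * \int[P]_w _]mulrA normrM ger0_norm//.
  rewrite [leRHS](_ : _ = 2^-1 * (eta * h * (K2 * IE))); last by rewrite !mulrA.
  exact: ler_wpM2l.
apply: (le_trans tot).
have tK := lind_algebra (ltW h0) v0 s0 sE sd hv v2 del0 del1 del4 t0 t2del2 eta0 B0.
rewrite -/b -/K3 -/Kv -/K2 in tK.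
have hd : 0 <= h / (v * s) * (eta + del ^+ 2) + h * (eta * t ^+ 2 + del * t ^+ 2).
  apply: addr_ge0; apply: mulr_ge0.
  - by rewrite divr_ge0 ?(ltW h0)// mulr_ge0 ?(ltW v0) ?(ltW s0).
  - by rewrite addr_ge0// exprn_ge0// (ltW del0).
  - exact: (ltW h0).
  - by rewrite addr_ge0// mulr_ge0 ?exprn_ge0// (ltW del0).
apply: (@le_trans _ _ (((4 * expR 1 * B ^+ 3 + 384) * (h / (v * s) * (eta + del ^+ 2) +
      h * (eta * t ^+ 2 + del * t ^+ 2))) * IE)).
  by rewrite ler_wpM2r.
rewrite /lindC [leRHS](_ : _ = ((4 * expR 1 * B ^+ 3 + 384) * (h / (v * s) * (eta + del ^+ 2) +
      h * (eta * t ^+ 2 + del * t ^+ 2))) * (expR (1 + expR 1 * B ^+ 3) * expR (- (t ^+ 2 / 2)))); last by ring.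
apply: ler_wpM2l; last exact: EE.
apply: mulr_ge0; last exact: hd.
apply: addr_ge0; last exact: ler0n.
by apply: mulr_ge0; [rewrite mulr_ge0 ?expR_ge0|rewrite exprn_ge0].
Qed.

(** Sum of the replacement errors, from the pure heat flow of total variance
    1 + del^2 to the walk smoothed by a variance del^2. The error is
    proportional to exp(-t^2/2), which a Berry-Esseen bound would not give. *)
Lemma smooth_moderate_deviation :
  `|\int[P]_w heat t (del ^+ 2) (psum n w) -
    Phi (- t / Num.sqrt (1 + del ^+ 2))| <=
  lindC B * expR (- (t ^+ 2 / 2)) *
    (4 * (eta + del ^+ 2) / del + (eta * t ^+ 2 + del * t ^+ 2)).
Proof.
set Kc := lindC B * expR (- (t ^+ 2 / 2)).
have Kc0 : 0 <= Kc by rewrite mulr_ge0 ?expR_ge0// lindC_ge0.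
have ed0 : 0 <= eta + del ^+ 2 by rewrite addr_ge0// exprn_ge0// ltW.
set Y := eta * t ^+ 2 + del * t ^+ 2.
have main k : (k <= n)%N ->
  `|\int[P]_w heat t (rvar k) (psum k w) - \int[P]_w heat t (rvar 0) (psum 0 w)|
   <= Kc * (4 * ((Num.sqrt (rvar k))^-1 - (Num.sqrt (rvar 0))^-1) * (eta + del ^+ 2)
     + k%:R * h * Y).
  elim: k => [|k IH] kn.
    by rewrite !subrr normr0 mulr0 !mul0r addr0 mulr0.
  rewrite -[X in `|X|](subrKA (\int[P]_w heat t (rvar k) (psum k w))).
  apply: (le_trans (ler_normD _ _)).
  apply: (le_trans (lerD (lind_step kn) (IH (ltnW kn)))).
  rewrite -/Kc -mulrDr ler_wpM2l// -/Y.
  have hv : h <= rvar k.+1.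
    rewrite (le_trans _ (rvar_ge _))// -del4 (_ : 4%N = (2 + 2)%N)// exprD ler_piMl//.
      by rewrite exprn_ge0// ltW.
    by rewrite exprn_ile1// ltW.
  have := sqrt_telescope (rvar_gt0 k.+1) (ltW h0) hv; rewrite -(rvarS kn).
  move=> /(ler_wpM2r ed0); rewrite -natr1.
  set A := _ / (_ * _); set C1 := (Num.sqrt (rvar k.+1))^-1.
  set C2 := (Num.sqrt (rvar k))^-1; set C3 := (Num.sqrt (rvar 0))^-1.
  by lra.
have := main n (leqnn n).
have -> : rvar n = del ^+ 2 by rewrite /rvar subnn mul0r addr0.
have -> : rvar 0 = 1 + del ^+ 2 by rewrite /rvar subn0 nh addrC.
have -> : \int[P]_w heat t (1 + del ^+ 2) (psum 0 w) = Phi (- t / Num.sqrt (1 + del ^+ 2)).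
  rewrite -[RHS](Ex_cst P); apply: eq_Ex => w.
  by rewrite /psum big_ord0 /heat add0r.
move=> /le_trans; apply; rewrite ler_wpM2l// nh mul1r lerD2r.
rewrite sqrtr_sqr (ger0_norm (ltW del0)) [leRHS]mulrAC ler_wpM2r// ler_wpM2l//.
by rewrite gerBl invr_ge0 sqrtr_ge0.
Qed.

End lindeberg.

(** * Moments of degenerate double sums *)

Section moment_algebra.
Context {R : realType}.
Implicit Types a b r : R.

Definition binC m : R := \sum_(i < (m.*2).+1) 'C((m.*2).+2, i.+2)%:R.

Lemma binC_ge0 m : 0 <= binC m.
Proof. by apply: sumr_ge0 => i _; rewrite ler0n. Qed.

(** Young's inequality with a free parameter r, proved by comparing a^2 with
    r b^2; for r = n the factor of the first term stays bounded when it is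
    compounded over n steps. *)
Lemma young_power r m a b : 1 <= r ->
  a ^+ m.*2 * b ^+ 2 <= a ^+ (m.*2).+2 / r + r ^+ m * b ^+ (m.*2).+2.
Proof.
move=> r1; have r0 : 0 < r by exact: lt_le_trans r1.
have evn x k : 0 <= x ^+ k.*2 :> R by rewrite -mul2n exprM exprn_ge0// sqr_ge0.
have [ba|ab] := leP (r * b ^+ 2) (a ^+ 2).
  have h : a ^+ m.*2 * b ^+ 2 <= a ^+ (m.*2).+2 / r.
    rewrite ler_pdivlMr// -mulrA -[(m.*2).+2]addn2 exprD ler_wpM2l//.
    by rewrite mulrC.
  rewrite (le_trans h)// lerDl mulr_ge0 ?(exprn_ge0 m (ltW r0))//.
  by rewrite -doubleS.
have h : a ^+ m.*2 * b ^+ 2 <= r ^+ m * b ^+ (m.*2).+2.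
  rewrite -[(m.*2).+2]addn2 exprD mulrA ler_wpM2r ?sqr_ge0//.
  rewrite -!mul2n !exprM -exprMn lerXn2r ?nnegrE ?sqr_ge0//; last exact: ltW.
  by rewrite mulr_ge0 ?sqr_ge0// ltW.
rewrite (le_trans h)// lerDr divr_ge0 ?(ltW r0)//.
by rewrite -doubleS.
Qed.

(** Binomial expansion in which the term linear in b is kept apart, because it
    has mean zero for orthogonal increments, and the others are bounded by the
    two extreme powers. *)
Lemma even_power_add r m a b : 1 <= r ->
  (a + b) ^+ (m.*2).+2 <= (1 + binC m / r) * a ^+ (m.*2).+2
   + (m.*2).+2%:R * (a ^+ (m.*2).+1 * b) + 2 * binC m * r ^+ m * b ^+ (m.*2).+2.
Proof.
move=> r1; have r0 : 0 < r by exact: lt_le_trans r1.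
have evn x k : 0 <= x ^+ k.*2 :> R by rewrite -mul2n exprM exprn_ge0// sqr_ge0.
rewrite exprDn big_ord_recl big_ord_recl/=.
rewrite !subn0 expr0 mulr1 bin0 mulr1n bin1 subn1 expr1/= addrA.
set Sm := \sum_(_ < _) _.
suff SmE : Sm <= binC m * (a ^+ (m.*2).+2 / r + 2 * r ^+ m * b ^+ (m.*2).+2).
  rewrite mulr_natl; move: SmE; rewrite mulrDr => SmE.
  rewrite (_ : (1 + _) * _ = a ^+ (m.*2).+2 + binC m * (a ^+ (m.*2).+2 / r)); last by ring.
  have -> : 2 * binC m * r ^+ m * b ^+ (m.*2).+2 = binC m * (2 * r ^+ m * b ^+ (m.*2).+2).
    by ring.
  lra.
rewrite /binC mulr_suml; apply: ler_sum => i _.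
rewrite /bump /= !add1n -mulr_natl ler_wpM2l ?ler0n//.
have -> : ((m.*2).+2 - i.+2 = m.*2 - i)%N by rewrite !subSS.
have im : (i <= m.*2)%N by rewrite -ltnS.
have y := young_power m a b r1.
have b2 : b ^+ (m.*2).+2 <= r ^+ m * b ^+ (m.*2).+2.
  by rewrite ler_peMl -?doubleS// exprn_ege1.
apply: (@le_trans _ _ (a ^+ m.*2 * b ^+ 2 + b ^+ (m.*2).+2)); last by lra.
apply: (@le_trans _ _ (`|a| ^+ (m.*2 - i) * `|b| ^+ i.+2)).
  by rewrite -!normrX -normrM ler_norm.
have nE k x : `|x| ^+ k.*2 = x ^+ k.*2 :> R.
  by rewrite -normrX ger0_norm.
rewrite -[(i : nat).+2]addn2 exprD mulrA (_ : `|b| ^+ 2 = b ^+ 2); last by rewrite (nE 1%N).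
have [ab|/ltW ba] := leP `|a| `|b|.
  have h : `|a| ^+ (m.*2 - i) * `|b| ^+ i * b ^+ 2 <= b ^+ (m.*2).+2.
    rewrite -[(m.*2).+2]addn2 exprD ler_wpM2r ?sqr_ge0//.
    rewrite -nE -[X in _ <= _ ^+ X](subnK im) exprD ler_wpM2r ?exprn_ge0//.
    by rewrite lerXn2r ?nnegrE.
  by rewrite (le_trans h)// lerDr mulr_ge0 ?sqr_ge0.
have h : `|a| ^+ (m.*2 - i) * `|b| ^+ i * b ^+ 2 <= a ^+ m.*2 * b ^+ 2.
  rewrite ler_wpM2r ?sqr_ge0//.
  rewrite -nE -[X in _ <= _ ^+ X](subnK im) exprD ler_wpM2l ?exprn_ge0//.
  by rewrite lerXn2r ?nnegrE.
by rewrite (le_trans h)// lerDl -doubleS.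
Qed.

(* exp (binC m) bounds (1 + binC m / n)^n. *)
Definition momC m : R := expR (binC m) * (2 * binC m).

Lemma momC_ge0 m : 0 <= momC m.
Proof. by rewrite mulr_ge0 ?expR_ge0// mulr_ge0// binC_ge0. Qed.

End moment_algebra.

Section orthogonal_moments.
Context d (T : measurableType d) (R : realType) (P : probability T R).
Variables (n m : nat) (D : nat -> T -> R) (V : R).
Local Notation S k w := (\sum_(i < k) D i w).
Hypotheses (n0 : (0 < n)%N) (bmD : forall k, (k < n)%N -> bmfun (D k)).
Hypothesis orth : forall k, (k < n)%N ->
  \int[P]_w (S k w ^+ (m.*2).+1 * D k w) = 0.
Hypothesis DV : forall k, (k < n)%N -> \int[P]_w (D k w ^+ (m.*2).+2) <= V.
Hypothesis V0 : 0 <= V.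

(** A martingale-type moment inequality. With r = n in the expansion of
    (S + D)^(2m+2), each step multiplies the moment by 1 + binC m / n and adds
    a term of order n^m V. *)
Lemma orthogonal_moment k : (k <= n)%N ->
  \int[P]_w (S k w ^+ (m.*2).+2) <= momC m * n%:R ^+ m.+1 * V.
Proof.
have r1 : (1 : R) <= n%:R by rewrite ler1n.
have r0 : (0 : R) < n%:R by rewrite ltr0n.
set c := binC m : R; have c0 : 0 <= c by exact: binC_ge0.
set q := 1 + c / n%:R; have q1 : 1 <= q by rewrite lerDl divr_ge0// ltW.
have q0 : 0 <= q by exact: le_trans q1.
set A := 2 * c * n%:R ^+ m * V.
have A0 : 0 <= A by rewrite !mulr_ge0// exprn_ge0// ltW.
suff main j : (j <= n)%N -> \int[P]_w (S j w ^+ (m.*2).+2) <= j%:R * A * q ^+ j.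
  move=> kn; apply: (le_trans (main k kn)).
  have qe : q ^+ k <= expR c.
    apply: (@le_trans _ _ (q ^+ n)); first by rewrite ler_weXn2l.
    apply: (@le_trans _ _ (expR (c / n%:R) ^+ n)).
      by rewrite lerXn2r ?nnegrE ?expR_ge0// expR_ge1Dx.
    by rewrite -expRM_natl mulrC divfK// gt_eqF.
  apply: (@le_trans _ _ (n%:R * A * expR c)).
    apply: ler_pM => //; [by rewrite mulr_ge0|by rewrite exprn_ge0|].
    by rewrite ler_wpM2r// ler_nat.
  by rewrite /A /momC -/c le_eqVlt; apply/orP; left; apply/eqP; rewrite exprS; ring.
elim: j => [|j IH] jn.
  rewrite !mul0r -[leRHS](Ex_cst P) le_eqVlt; apply/orP; left; apply/eqP.
  by apply: eq_Ex => w; rewrite big_ord0 exprS mul0r.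
have bS : bmfun (fun w => S j w).
  by apply: bm_sum_ord => i ij; apply: bmD; exact: ltn_trans ij jn.
have bD := bmD jn.
have bc (a : R) f : bmfun f -> bmfun (fun w : T => a * f w).
  by move=> hf; apply: bm_mul => //; exact: bm_cst.
have b1 : bmfun (fun w => q * S j w ^+ (m.*2).+2) by apply: bc; exact: bm_exp.
have b2 : bmfun (fun w => (m.*2).+2%:R * (S j w ^+ (m.*2).+1 * D j w)).
  by apply: bc; apply: bm_mul => //; exact: bm_exp.
have b3 : bmfun (fun w => 2 * c * n%:R ^+ m * D j w ^+ (m.*2).+2).
  by apply: bc; exact: bm_exp.
apply: (@le_trans _ _ (\int[P]_w (q * S j w ^+ (m.*2).+2 +
   (m.*2).+2%:R * (S j w ^+ (m.*2).+1 * D j w) +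
   2 * c * n%:R ^+ m * D j w ^+ (m.*2).+2))).
  apply: Ex_le.
  - by apply: bm_exp; apply: bm_sum_ord => i ij; apply: bmD; exact: leq_trans ij jn.
  - by apply: bm_add => //; exact: bm_add.
  by move=> w; rewrite big_ord_recr/=; exact: even_power_add.
rewrite ExD//; last exact: bm_add.
rewrite ExD// ExZ; last exact: bm_exp.
rewrite ExZ; last by apply: bm_mul => //; exact: bm_exp.
rewrite ExZ; last exact: bm_exp.
rewrite orth// mulr0 addr0.
have h1 := ler_wpM2l q0 (IH (ltnW jn)).
have cm0 : 0 <= 2 * c * n%:R ^+ m by rewrite !mulr_ge0// exprn_ge0// ltW.
have h2 := ler_wpM2l cm0 (DV jn).
rewrite -/A in h2.
apply: (le_trans (lerD h1 h2)).
have h3 : A <= A * q ^+ j.+1 by rewrite ler_peMr// exprn_ege1.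
have -> : j.+1%:R * A * q ^+ j.+1 = q * (j%:R * A * q ^+ j) + A * q ^+ j.+1.
  by rewrite -natr1 exprS; ring.
by rewrite lerD2l.
Qed.

End orthogonal_moments.

Section degenerate_moments.
Context d (T : measurableType d) dS (S : measurableType dS) (R : realType).
Variables (P : probability T R) (nu : probability S R) (X : nat -> T -> S).
Variables (n m : nat) (ht : S * S -> R) (M : R).
Hypotheses (n0 : (0 < n)%N) (mX : forall k, measurable_fun setT (X k))
  (hX : iid P nu X n).
Hypotheses (bht : bmfun ht) (M0 : 0 <= M) (htM : forall z, `|ht z| <= M).
Hypothesis deg1 : forall y, \int[nu]_x ht (x, y) = 0.
Hypothesis deg2 : forall x, \int[nu]_y ht (x, y) = 0.

Let bm_past k (f : pastT X k -> R) : bmfun f -> bmfun (f : T -> R).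
Proof. by move=> hf; apply: (bm_comp hf); exact: measurable_pastT. Qed.

Let bm_past2 k (F : pastT X k * S -> R) : bmfun F -> bmfun (F : T * S -> R).
Proof.
move=> hF.
have mJ : measurable_fun setT (fun z : T * S => (z.1 : pastT X k, z.2)).
  apply/measurable_fun_pair; last exact: measurable_snd.
  apply: (@measurableT_comp _ _ _ _ _ _ (id : T -> pastT X k)).
    exact: measurable_pastT.
  exact: measurable_fst.
have := bm_comp hF mJ; congr bmfun.
by apply/funext => -[].
Qed.

Let bht_past k i : (i < k)%N ->
  bmfun (fun z : pastT X k * S => ht (X i z.1, z.2)).
Proof.
move=> ik; apply: (bm_comp bht); apply/measurable_fun_pair => //.
apply: (@measurableT_comp _ _ _ _ _ _ (X i : pastT X k -> S)) => //.
exact: measurable_X_past.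
Qed.

Let bht_past2 k i j : (i < k)%N -> (j < k)%N ->
  bmfun (fun w : pastT X k => ht (X i w, X j w)).
Proof.
by move=> ik jk; apply: (bm_comp bht); apply/measurable_fun_pair => //;
  exact: measurable_X_past.
Qed.

Let bm_fst k (f : pastT X k -> R) : bmfun f ->
  bmfun (fun z : pastT X k * S => f z.1).
Proof. by move=> hf; exact: (bm_comp hf measurable_fst). Qed.

(** With one argument frozen, the summands are centred given the past, and the
    moment of a sum of n of them is of the order n^(m+1). *)
Lemma section_moment y k : (k <= n)%N ->
  \int[P]_w ((\sum_(l < k) ht (X l w, y)) ^+ (m.*2).+2) <=
  momC m * n%:R ^+ m.+1 * M ^+ (m.*2).+2.
Proof.
move=> kn.
have bl k' l : (l < k')%N -> bmfun (fun w : pastT X k' => ht (X l w, y)).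
  move=> lk; apply: (bm_comp (bm_sec2 y bht)); exact: measurable_X_past.
apply: (@orthogonal_moment _ _ _ P n m (fun l w => ht (X l w, y))) => //.
- by move=> l ln; apply: (@bm_past l.+1); exact: bl.
- move=> l ln.
  rewrite (@iid_Ex _ _ _ _ _ P nu X n mX hX l
    (fun z => (\sum_(i < l) ht (X i z.1, y)) ^+ (m.*2).+1 * ht (z.2, y)))//.
    rewrite -[RHS](Ex_cst P); apply: eq_Ex => w /=.
    by rewrite ExZ ?deg1 ?mulr0//; exact: bm_sec2.
  apply: bm_mul; last exact: (bm_comp (bm_sec2 y bht) measurable_snd).
  apply: bm_exp; apply: (@bm_sum_ord _ _ _ l (fun i (z : pastT X l * S) => ht (X i z.1, y))) => i il.
  by apply: (@bm_fst l (fun w => ht (X i w, y))); exact: bl.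
- move=> l ln; apply: Ex_le_cst.
    by apply: (@bm_past l.+1); apply: bm_exp; exact: bl.
  move=> w; apply: (le_trans (ler_norm _)).
  by rewrite normrX lerXn2r ?nnegrE.
- by rewrite exprn_ge0.
Qed.

(** The moment inequality is used twice. The increments of the double sum are
    the inner sums over l < k; they are centred given the past by degeneracy in
    the second argument, and their moments are those of a sum with one frozen
    argument, by degeneracy in the first. Hence the double sum is of order n
    instead of the order n^(3/2) of a nondegenerate one. *)
Lemma degenerate_moment :
  \int[P]_w ((\sum_(k < n) \sum_(l < k) ht (X l w, X k w)) ^+ (m.*2).+2) <=
  (momC m * n%:R ^+ m.+1) ^+ 2 * M ^+ (m.*2).+2.
Proof.
have bsum k : bmfun (fun z : pastT X k * S => \sum_(l < k) ht (X l z.1, z.2)).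
  apply: (@bm_sum_ord _ _ _ k (fun l (z : pastT X k * S) => ht (X l z.1, z.2))).
  by move=> l lk; exact: bht_past.
have := @orthogonal_moment _ _ _ P n m
  (fun k w => \sum_(l < k) ht (X l w, X k w))
  (momC m * n%:R ^+ m.+1 * M ^+ (m.*2).+2) n0.
rewrite (_ : (momC m * n%:R ^+ m.+1) ^+ 2 * _ = momC m * n%:R ^+ m.+1 *
  (momC m * n%:R ^+ m.+1 * M ^+ (m.*2).+2)); last by rewrite expr2 !mulrA.
apply => //.
- move=> k kn; apply: (@bm_past k.+1).
  apply: (@bm_sum_ord _ _ _ k (fun l (w : pastT X k.+1) => ht (X l w, X k w))) => l lk.
  by apply: bht_past2 => //; exact: ltnW.
- move=> k kn.
  rewrite (@iid_Ex _ _ _ _ _ P nu X n mX hX k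
    (fun z => (\sum_(i < k) \sum_(l < i) ht (X l z.1, X i z.1)) ^+ (m.*2).+1 *
       \sum_(l < k) ht (X l z.1, z.2)))//.
    rewrite -[RHS](Ex_cst P); apply: eq_Ex => w /=.
    rewrite ExZ; last first.
      by apply: (@bm_sum_ord _ _ _ k (fun l y => ht (X l w, y))) => l _; exact: bm_sec1.
    rewrite (@Ex_sum _ _ _ _ k (fun l y => ht (X l w, y))); last first.
      by move=> l _; exact: bm_sec1.
    by rewrite [X in _ * X]big1 ?mulr0// => i _; exact: deg2.
  apply: bm_mul; last exact: bsum.
  apply: bm_exp; apply: (@bm_fst k (fun w => \sum_(i < k) \sum_(l < i) ht (X l w, X i w))).
  apply: (@bm_sum_ord _ _ _ k (fun i (w : pastT X k) => \sum_(l < i) ht (X l w, X i w))) => i ik.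
  apply: (@bm_sum_ord _ _ _ i (fun l (w : pastT X k) => ht (X l w, X i w))) => l li.
  by apply: bht_past2 => //; exact: ltn_trans li ik.
- move=> k kn.
  rewrite (@iid_Ex _ _ _ _ _ P nu X n mX hX k
    (fun z => (\sum_(l < k) ht (X l z.1, z.2)) ^+ (m.*2).+2))//; last first.
    by apply: bm_exp; exact: bsum.
  rewrite (@Ex_swap _ _ _ _ _ P nu
    (fun z => (\sum_(l < k) ht (X l z.1, z.2)) ^+ (m.*2).+2))//; last first.
    by apply: (@bm_past2 k); apply: bm_exp; exact: bsum.
  apply: Ex_le_cst => [|y]; last by apply: section_moment; exact: ltnW.
  have := @bm_Ex1 _ _ _ _ _ P nu (fun z : T * S => (\sum_(l < k) ht (X l z.1, z.2)) ^+ (m.*2).+2).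
  apply.
  by apply: (@bm_past2 k); apply: bm_exp; exact: bsum.
- apply: mulr_ge0; last by rewrite exprn_ge0.
  by apply: mulr_ge0; [exact: momC_ge0|rewrite exprn_ge0].
Qed.

End degenerate_moments.

(** * Orthogonal invariance of the Gaussian plane *)

(** The measure normal_prob 0 1 with its structure of probability measure. *)
Definition gauss {R : realType} : probability (measurableTypeR R) R :=
  normal_prob (0 : R) 1.

Section gaussian_plane.
Context {R : realType}.
Local Notation mu := (@lebesgue_measure R).
Local Notation N := (normal_prob (0 : R) 1).
Local Notation N2 := (N \x N)%E.
Local Open Scope ereal_scope.

Lemma integral_normal (f : R -> \bar R) : measurable_fun setT f ->
  (forall x, 0 <= f x) -> \int[N]_x f x = \int[mu]_x (f x * (phi x)%:E).
Proof.
move=> mf f0; have dom := @normal_prob_dominates R 0 1.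
have ipdf := @integrable_normal_pdf R 0 1.
rewrite -(Radon_Nikodym_SigmaFinite.change_of_variables dom)//.
have int_rn := Radon_Nikodym_SigmaFinite.f_integrable dom.
have mrn := measurable_int _ int_rn.
have mpdf := measurable_int _ ipdf.
apply: ae_eq_integral => //.
- exact: emeasurable_funM.
- exact: emeasurable_funM.
apply: ae_eqe_mul2l.
apply: integral_ae_eq => // E _ mE.
by rewrite -Radon_Nikodym_SigmaFinite.f_integral.
Qed.

Lemma lebesgue_shift (c : R) (f : R -> \bar R) : measurable_fun setT f ->
  (forall x, 0 <= f x) -> \int[mu]_x f (x + c)%R = \int[mu]_x f x.
Proof.
move=> mf f0.
pose s : R -> measurableTypeR R := fun x => (x + c)%R.
have ms : measurable_fun [set: measurableTypeR R] s by exact: measurable_funD.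
rewrite [LHS](_ : _ = \int[pushforward mu s]_x f x); last first.
  by rewrite ge0_integral_pushforward.
apply: eq_measure_integral => A mA _.
apply/esym; apply: lebesgue_measure_unique => //= _ [[a b]] _ <-.
rewrite /pushforward.
have -> : s @^-1` `]a, b] = `](a - c)%R, (b - c)%R]%classic.
  by apply/seteqP; split => x /=; rewrite /s !in_itv/= ltrBlDr lerBrDr.
rewrite !lebesgue_measure_itv/= !lte_fin ltrD2r.
by case: ifPn => // _; congr EFin; ring.
Qed.

Lemma lebesgue_reflect (f : R -> \bar R) : measurable_fun setT f ->
  (forall x, 0 <= f x) -> \int[mu]_x f (- x)%R = \int[mu]_x f x.
Proof.
move=> mf f0.
have ms : measurable_fun [set: measurableTypeR R] (-%R : R -> measurableTypeR R).
  by [].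
rewrite [LHS](_ : _ = \int[pushforward mu
    (-%R : R -> measurableTypeR R)]_x f x); last first.
  by rewrite ge0_integral_pushforward.
by apply: eq_measure_integral => A mA _; rewrite /= lebesgue_measureN.
Qed.

Local Notation area G := (\int[mu]_x \int[mu]_y G (x, y)).

(** Iterated integrals are used for the area, since shears and reflections act
    on one variable at a time: each reduces to the translation or reflection
    invariance of the Lebesgue measure of the line. *)
Definition preserves_area (S : R * R -> R * R) :=
  measurable_fun setT S /\ forall G : R * R -> \bar R, measurable_fun setT G ->
    (forall z, 0 <= G z) -> area (G \o S) = area G.

Lemma preserves_area_comp S1 S2 :
  preserves_area S1 -> preserves_area S2 -> preserves_area (S1 \o S2).
Proof.
move=> [m1 p1] [m2 p2]; split; first exact: measurableT_comp.
move=> G mG G0; have mGS : measurable_fun setT (G \o S1) by exact: measurableT_comp.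
by rewrite -(p1 G mG G0) -(p2 _ mGS (fun z => G0 (S1 z))).
Qed.

Lemma area_swap (G : R * R -> \bar R) : measurable_fun setT G ->
  (forall z, 0 <= G z) -> area G = \int[mu]_y \int[mu]_x G (x, y).
Proof. by move=> mG G0; exact: (@fubini_tonelli _ _ _ _ R mu mu G). Qed.

Let mpair (f g : R * R -> R) : measurable_fun setT f -> measurable_fun setT g ->
  measurable_fun setT (fun z => (f z, g z)).
Proof. by move=> mf mg; exact/measurable_fun_pair. Qed.

Lemma preserves_shear_v (a : R) :
  preserves_area (fun z => (z.1, z.2 + a * z.1)%R).
Proof.
split.
  apply: mpair => //; apply: measurable_funD => //.
  exact: measurable_funM.
move=> G mG G0; apply: eq_integral => x _ /=.
apply: (@lebesgue_shift (a * x)%R (fun y => G (x, y))) => //.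
exact: (measurableT_comp mG (measurable_pair1 x)).
Qed.

Lemma preserves_shear_h (a : R) :
  preserves_area (fun z => (z.1 + a * z.2, z.2)%R).
Proof.
have ms : measurable_fun setT (fun z : R * R => (z.1 + a * z.2, z.2)%R).
  apply: mpair => //; apply: measurable_funD => //.
  exact: measurable_funM.
split => // G mG G0.
have mGS := measurableT_comp mG ms.
rewrite (area_swap mGS (fun z => G0 _)) (area_swap mG G0); apply: eq_integral => y _ /=.
apply: (@lebesgue_shift (a * y)%R (fun x => G (x, y))) => //.
exact: (measurableT_comp mG (measurable_pair2 y)).
Qed.

Lemma preserves_flip_v : preserves_area (fun z => (z.1, - z.2)%R).
Proof.
split; first by apply: mpair => //; exact: measurableT_comp.
move=> G mG G0; apply: eq_integral => x _ /=.
apply: (@lebesgue_reflect (fun y => G (x, y))) => //.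
exact: (measurableT_comp mG (measurable_pair1 x)).
Qed.

Lemma preserves_flip_h : preserves_area (fun z => (- z.1, z.2)%R).
Proof.
have ms : measurable_fun setT (fun z : R * R => (- z.1, z.2)%R).
  by apply: mpair => //; exact: measurableT_comp.
split => // G mG G0.
have mGS := measurableT_comp mG ms.
rewrite (area_swap mGS (fun z => G0 _)) (area_swap mG G0); apply: eq_integral => y _ /=.
apply: (@lebesgue_reflect (fun x => G (x, y))) => //.
exact: (measurableT_comp mG (measurable_pair2 y)).
Qed.

(** A rotation is a product of three shears, apart from the half-turn, which
    is a product of two reflections. *)
Lemma preserves_rotation (a b : R) : (a ^+ 2 + b ^+ 2 = 1)%R ->
  preserves_area (fun z => (a * z.1 + b * z.2, - b * z.1 + a * z.2)%R).
Proof.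
move=> ab1; have [a1|a1] := eqVneq (1 + a)%R 0%R.
  have aE : a = (- 1)%R by lra.
  have b0 : b = 0%R.
    by apply/eqP; rewrite -sqrf_eq0; apply/eqP; move: ab1; rewrite aE; lra.
  have -> : (fun z : R * R => (a * z.1 + b * z.2, - b * z.1 + a * z.2)%R) =
     (fun z => (z.1, - z.2)%R) \o (fun z => (- z.1, z.2)%R).
    by apply/funext => -[x y] /=; rewrite aE b0; congr pair; ring.
  apply: preserves_area_comp; [exact: preserves_flip_v|exact: preserves_flip_h].
set k := (b / (1 + a))%R.
have e1 : (1 - k * b = a)%R.
  apply/eqP; rewrite -subr_eq0; apply/eqP.
  have -> : (1 - k * b - a = (1 - (a ^+ 2 + b ^+ 2)) / (1 + a))%R by rewrite /k; field.
  by rewrite ab1 subrr mul0r.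
have e2 : (k * (1 + a) = b)%R by rewrite /k divfK.
have -> : (fun z : R * R => (a * z.1 + b * z.2, - b * z.1 + a * z.2)%R) =
   (fun z => (z.1 + k * z.2, z.2)%R) \o ((fun z => (z.1, z.2 + (- b) * z.1)%R)
     \o (fun z => (z.1 + k * z.2, z.2)%R)).
  apply/funext => -[x y] /=; congr pair.
    have -> : (x + k * y + k * (y + - b * (x + k * y)) =
      (1 - k * b) * x + k * (1 + (1 - k * b)) * y)%R by ring.
    by rewrite e1 e2.
  have -> : (y + - b * (x + k * y) = - b * x + (1 - k * b) * y)%R by ring.
  by rewrite e1.
by do 2?apply: preserves_area_comp;
  [exact: preserves_shear_h|exact: preserves_shear_v|exact: preserves_shear_h].
Qed.

Lemma gauss2E (A : set (R * R)) : measurable A ->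
  N2 A = area (fun z => (\1_A z * (phi z.1 * phi z.2))%:E).
Proof.
move=> mA; rewrite -[LHS](_ : \int[N2]_z (\1_A z)%:E = _); last first.
  by rewrite integral_indic// setIT.
have m1 : measurable_fun setT (fun z : R * R => (\1_A z)%:E : \bar R).
  by apply/measurable_EFinP; exact: measurable_indic.
rewrite (@fubini_tonelli1 _ _ _ _ R N N)//.
rewrite integral_normal; last 2 first.
- by apply: (@measurable_fun_fubini_tonelli_F _ _ _ _ R N (fun z => (\1_A z)%:E)).
- by move=> x; apply: integral_ge0 => y _; rewrite lee_fin.
apply: eq_integral => x _; rewrite /fubini_F integral_normal//; last first.
  exact: (measurableT_comp m1 (measurable_pair1 x)).
rewrite -ge0_integralZr//; last first.
- by rewrite lee_fin phi_ge0.
- by move=> y _; rewrite mule_ge0// lee_fin ?phi_ge0.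
- apply: emeasurable_funM; first exact: (measurableT_comp m1 (measurable_pair1 x)).
  by apply/measurable_EFinP; exact: measurable_normal_pdf.
by apply: eq_integral => y _; rewrite -!EFinM/=; congr EFin; ring.
Qed.

(** The product density depends on z through its Euclidean norm only, and an
    orthogonal matrix is a rotation, up to a reflection. *)
Lemma gauss2_orthogonal (a b c d : R) (A : set (R * R)) :
  (a ^+ 2 + b ^+ 2 = 1)%R -> (c ^+ 2 + d ^+ 2 = 1)%R -> (a * c + b * d = 0)%R ->
  measurable A ->
  N2 ((fun z => (a * z.1 + b * z.2, c * z.1 + d * z.2)%R) @^-1` A) = N2 A.
Proof.
move=> ab cd ac mA; set S := (fun z : R * R => _).
have e2 : ((c + b) * (c - b) = 0)%R.
  have -> : ((c + b) * (c - b) = c ^+ 2 * (1 - (a ^+ 2 + b ^+ 2)) -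
     b ^+ 2 * (1 - (c ^+ 2 + d ^+ 2)) + (a * c + b * d) * (a * c - b * d))%R by ring.
  by rewrite ab cd ac !subrr !mulr0 mul0r subrr addr0.
have e3 : ((d - a) * (d + a) = 0)%R by lra.
have e4 : (c = - b /\ d = a \/ c = b /\ d = - a)%R.
  move/eqP: e2; rewrite mulf_eq0 => /orP[|] /eqP e2;
  move/eqP: e3; rewrite mulf_eq0 => /orP[|] /eqP e3; [by left; lra| | |by right; lra].
  - have cE : c = (- b)%R by lra.
    have dE : d = (- a)%R by lra.
    have : (a * b = 0)%R by move: ac; rewrite cE dE; lra.
    by move/eqP; rewrite mulf_eq0 => /orP[|] /eqP e0; [left|right]; lra.
  - have cE : c = b by lra.
    have dE : d = a by lra.
    have : (a * b = 0)%R by move: ac; rewrite cE dE; lra.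
    by move/eqP; rewrite mulf_eq0 => /orP[|] /eqP e0; [right|left]; lra.
have [[mS pS] rad] : preserves_area S /\
    forall z, ((S z).1 ^+ 2 + (S z).2 ^+ 2 = z.1 ^+ 2 + z.2 ^+ 2)%R.
  split; last first.
    move=> z; have -> : (z.1 ^+ 2 + z.2 ^+ 2 = (a ^+ 2 + b ^+ 2) * (z.1 ^+ 2 + z.2 ^+ 2))%R.
      by rewrite ab mul1r.
    by case: e4 => -[cE dE]; rewrite /S cE dE/=; ring.
  case: e4 => -[cE dE].
    have -> : S = (fun z => (a * z.1 + b * z.2, - b * z.1 + a * z.2)%R).
      by apply/funext => z; rewrite /S cE dE.
    exact: preserves_rotation.
  have -> : S = (fun z => (z.1, - z.2)%R) \o
     (fun z => (a * z.1 + b * z.2, - b * z.1 + a * z.2)%R).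
    apply/funext => z; rewrite /S/= cE dE; congr pair; ring.
  by apply: preserves_area_comp; [exact: preserves_flip_v|exact: preserves_rotation].
have mpre : measurable (S @^-1` A) by rewrite -[X in measurable X]setTI; exact: mS.
rewrite !gauss2E//.
rewrite -(pS (fun z => (\1_A z * (phi z.1 * phi z.2))%:E)); last 2 first.
- apply/measurable_EFinP; apply: measurable_funM; first exact: measurable_indic.
  by apply: measurable_funM; apply: measurableT_comp => //; exact: measurable_normal_pdf.
- by move=> z; rewrite lee_fin !mulr_ge0// ?phi_ge0.
apply: eq_integral => x _; apply: eq_integral => y _; congr EFin => /=.
congr (_ * _)%R.
rewrite !phiE mulrACA [RHS]mulrACA -!expRD; congr (_ * expR _)%R.
by have := rad (x, y) => /=; lra.
Qed.

End gaussian_plane.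

(** * The bivariate normal law and Kendall's kernel *)

Section bivariate_law.
Context {R : realType}.
Local Notation N := (normal_prob (0 : R) 1).
Local Notation N2 := (N \x N)%E.

(** The pair with means m1, m2, standard deviations s1, s2 and correlation r,
    as a function of a standard Gaussian pair (Cholesky factor). *)
Definition stdpair (m1 m2 s1 s2 r : R) (g : R * R) : R * R :=
  (m1 + s1 * g.1, m2 + s2 * (r * g.1 + Num.sqrt (1 - r ^+ 2) * g.2)).

Lemma measurable_stdpair m1 m2 s1 s2 r :
  measurable_fun setT (stdpair m1 m2 s1 s2 r).
Proof.
apply/measurable_fun_pair.
  by apply: measurable_funD => //; exact: measurable_funM.
apply: measurable_funD => //; apply: measurable_funM => //.
by apply: measurable_funD; exact: measurable_funM.
Qed.

(** Any square root A of Sigma is the Cholesky factor times an orthogonal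
    matrix, under which the Gaussian plane is invariant. The bound 3/4 keeps
    the factor sqrt(1 - r^2) away from zero. *)
Lemma has_normal2_law_std d (T : measurableType d) (P : probability T R)
    (X : T -> R * R) (mu : 'cV[R]_2) (Sigma : 'M[R]_2) (B : set (R * R)) :
  has_normal2_law P X mu Sigma -> 0 < Sigma 0 0 -> 0 < Sigma 1 1 ->
  `|Sigma 0 1 / Num.sqrt (Sigma 0 0 * Sigma 1 1)| <= 3 / 4 -> measurable B ->
  P (X @^-1` B) = N2 (stdpair (mu 0 0) (mu 1 0) (Num.sqrt (Sigma 0 0))
    (Num.sqrt (Sigma 1 1)) (Sigma 0 1 / Num.sqrt (Sigma 0 0 * Sigma 1 1)) @^-1` B).
Proof.
move=> [A AE hX] S00 S11 hr mB; rewrite (hX B mB).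
have l01 : lift ord0 ord0 = 1 :> 'I_2 by exact/val_inj.
set a := A 0 0; set b := A 0 1; set c := A 1 0; set e := A 1 1.
have E00 : Sigma 0 0 = a ^+ 2 + b ^+ 2.
  by rewrite -AE !mxE !big_ord_recl big_ord0 !mxE l01 addr0 !expr2.
have E11 : Sigma 1 1 = c ^+ 2 + e ^+ 2.
  by rewrite -AE !mxE !big_ord_recl big_ord0 !mxE l01 addr0 !expr2.
have E01 : Sigma 0 1 = a * c + b * e.
  by rewrite -AE !mxE !big_ord_recl big_ord0 !mxE l01 addr0.
have ss : Num.sqrt (Sigma 0 0 * Sigma 1 1) = Num.sqrt (Sigma 0 0) * Num.sqrt (Sigma 1 1).
  by rewrite sqrtrM// ltW.
set s1 := Num.sqrt (Sigma 0 0); set s2 := Num.sqrt (Sigma 1 1).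
rewrite -/s1 -/s2 in ss.
have s10 : 0 < s1 by rewrite sqrtr_gt0.
have s20 : 0 < s2 by rewrite sqrtr_gt0.
have s1E : s1 ^+ 2 = a ^+ 2 + b ^+ 2 by rewrite -E00 sqr_sqrtr// ltW.
have s2E : s2 ^+ 2 = c ^+ 2 + e ^+ 2 by rewrite -E11 sqr_sqrtr// ltW.
set r := Sigma 0 1 / _ in hr *.
have rE : r * (s1 * s2) = a * c + b * e.
  by rewrite /r ss divfK ?E01// mulf_neq0// gt_eqF.
have r2 : r ^+ 2 <= 9 / 16.
  have -> : 9 / 16 = (3 / 4) ^+ 2 :> R by field.
  by rewrite -(real_normK (num_real r)) lerXn2r ?nnegrE.
set w := Num.sqrt (1 - r ^+ 2).
have w0 : 0 < w by rewrite sqrtr_gt0; lra.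
have wE : w ^+ 2 = 1 - r ^+ 2 by rewrite sqr_sqrtr//; lra.
have n1 : s1 != 0 by rewrite gt_eqF.
have n2 : s2 != 0 by rewrite gt_eqF.
have nw : w != 0 by rewrite gt_eqF.
pose a' := a / s1; pose b' := b / s1.
pose c' := (c / s2 - r * a') / w; pose e' := (e / s2 - r * b') / w.
have o1 : a' ^+ 2 + b' ^+ 2 = 1.
  by rewrite /a' /b' !expr_div_n -mulrDl -s1E divff// expf_neq0.
have o3 : a' * c' + b' * e' = 0.
  have -> : a' * c' + b' * e' = ((a * c + b * e) / (s1 * s2) - r * (a' ^+ 2 + b' ^+ 2)) / w.
    by rewrite /c' /e' /a' /b'; field; rewrite n1 n2 nw.
  by rewrite o1 -rE mulfK ?mulf_neq0// mulr1 subrr mul0r.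
have o2 : c' ^+ 2 + e' ^+ 2 = 1.
  have -> : c' ^+ 2 + e' ^+ 2 = ((c ^+ 2 + e ^+ 2) / s2 ^+ 2 -
     2 * r * ((a * c + b * e) / (s1 * s2)) + r ^+ 2 * (a' ^+ 2 + b' ^+ 2)) / w ^+ 2.
    by rewrite /c' /e' /a' /b'; field; rewrite n1 n2 nw.
  rewrite o1 -rE mulfK ?mulf_neq0// -s2E divff ?expf_neq0// wE.
  rewrite (_ : 1 - 2 * r * r + r ^+ 2 * 1 = 1 - r ^+ 2); last by ring.
  by rewrite divff// -wE expf_neq0.
set Sp := stdpair _ _ _ _ _.
have mS : measurable (Sp @^-1` B).
  by rewrite -[X in measurable X]setTI; apply: measurable_stdpair.
have -> : affine2 mu A = Sp \o
    (fun z => (a' * z.1 + b' * z.2, c' * z.1 + e' * z.2)); last first.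
  exact: (gauss2_orthogonal o1 o2 o3 mS).
apply/funext => z.
rewrite /affine2 /Sp /stdpair/= !mxE !big_ord_recl !big_ord0 !mxE l01/= !addr0.
congr pair; congr (_ + _).
  by rewrite -/a -/b /a' /b'; field.
by rewrite -/c -/e -/w /c' /e' /a' /b'; field; rewrite n1 n2 nw.
Qed.

End bivariate_law.

Section kendall_kernel.
Context {R : realType}.
Local Notation N := (@gauss R).
Local Notation N2 := (N \x N)%E.
Implicit Types x y z : R.

Definition kendall_kernel (u v : R * R) : R :=
  Num.sg (u.1 - v.1) * Num.sg (u.2 - v.2).

Lemma measurable_sgr : measurable_fun setT (Num.sg : R -> R).
Proof.
have -> : (Num.sg : R -> R) = (fun x => \1_(`]0, +oo[ : set R) x - \1_(`]-oo, 0[ : set R) x).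
  apply/funext => x; rewrite !indicE !mem_setE !in_itv/= andbT.
  by case: (sgrP x) => _; rewrite ?subrr ?subr0 ?sub0r.
by apply: measurable_funB; exact: measurable_indic.
Qed.

Lemma norm_sgr_le1 x : `|Num.sg x| <= 1.
Proof. by rewrite normr_sg; case: eqP. Qed.

Lemma bm_sgr d (T : measurableType d) (f : T -> R) :
  measurable_fun setT f -> bmfun (fun w => Num.sg (f w)).
Proof.
move=> mf; split; first exact: (measurableT_comp measurable_sgr).
by exists 1 => w; exact: norm_sgr_le1.
Qed.

Lemma bm_kendall d (T : measurableType d) (f g : T -> R * R) :
  measurable_fun setT f -> measurable_fun setT g ->
  bmfun (fun w => kendall_kernel (f w) (g w)).
Proof.
move=> mf mg; apply: bm_mul; apply: bm_sgr; apply: measurable_funB.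
- exact: (measurableT_comp measurable_fst mf).
- exact: (measurableT_comp measurable_fst mg).
- exact: (measurableT_comp measurable_snd mf).
- exact: (measurableT_comp measurable_snd mg).
Qed.

Lemma kendall_kernelC u v : kendall_kernel u v = kendall_kernel v u.
Proof.
rewrite /kendall_kernel -(opprB v.1) -(opprB v.2) !sgrN.
by rewrite mulrNN.
Qed.

Lemma kendall_kernel_le1 u v : `|kendall_kernel u v| <= 1.
Proof. by rewrite normrM mulr_ile1// norm_sgr_le1. Qed.

(** Of the three products, the one centred at the median is -1 and the two
    others are 1; a tie between y and one of the other points makes two of the
    products vanish. *)
Lemma sgr_median x y z : z != x ->
  Num.sg (x - y) * Num.sg (x - z) + Num.sg (y - x) * Num.sg (y - z) +
  Num.sg (z - x) * Num.sg (z - y) = 1.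
Proof.
have sE (a b : R) : Num.sg (a - b) = (if b < a then 1 else if a < b then -1 else 0).
  case: (ltgtP b a) => [h|h|->].
  - by rewrite gtr0_sg// subr_gt0.
  - by rewrite ltr0_sg// subr_lt0.
  - by rewrite subrr sgr0.
rewrite !sE => zx.
case: (ltgtP x y) => xy; case: (ltgtP x z) zx => xz // _; case: (ltgtP y z) => yz;
  by [exfalso; lra | lra].
Qed.

Lemma Ex_normal_off1 (f g : R -> R) (c : R) : bmfun f -> bmfun g ->
  (forall x, x != c -> f x = g x) -> \int[N]_x f x = \int[N]_x g x.
Proof.
move=> hf hg fg; apply/eqP; rewrite -subr_eq0 -ExB// -normr_le0.
have [M fM] := (bm_sub hf hg).2.
have h1 : bmfun (\1_[set c] : R -> R) by exact: bm_indic.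
apply: (@le_trans _ _ (\int[N]_x (M * \1_[set c] x))).
  apply: Ex_norm_le; [exact: bm_sub|by apply: bm_mul => //; exact: bm_cst|].
  move=> x; rewrite indicE; case: (eqVneq x c) => [->|xc].
    by rewrite mem_set// mulr1.
  by rewrite fg// subrr normr0 memNset ?mulr0//; exact/eqP.
rewrite ExZ//.
have : N [set c] = (\int[N]_x \1_[set c] x)%:E by exact: Ex_indic.
have -> : N [set c] = 0%E by exact: normal_prob_set1.
by move=> -[<-]; rewrite mulr0.
Qed.

(** Equal to 2 Phi x - 1, hence uniform on [-1, 1] under the normal law. *)
Definition sgmean x : R := \int[N]_y Num.sg (x - y).

Let bm_sgB : bmfun (fun z : R * R => Num.sg (z.1 - z.2)).
Proof. by apply: bm_sgr; exact: measurable_funB. Qed.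

Lemma bm_sgmean : bmfun sgmean.
Proof. exact: (bm_Ex2 N N bm_sgB). Qed.

Lemma Ex_sgmean : \int[N]_x sgmean x = 0.
Proof.
have := Ex_swap N N bm_sgB; rewrite /= -/sgmean.
have -> : \int[N]_y \int[N]_x Num.sg (x - y) = - \int[N]_y sgmean y.
  rewrite -ExN; last exact: bm_sgmean.
  apply: eq_Ex => y; rewrite /sgmean -ExN; last exact: (bm_sec1 y bm_sgB).
  by apply: eq_Ex => x; rewrite -sgrN opprB.
rewrite /sgmean; lra.
Qed.

(** The three products of signs of the median identity have the same mean, by
    exchangeability, and this mean is that of sgmean^2. *)
Lemma Ex_sgmean2 : \int[N]_x (sgmean x ^+ 2) = 1 / 3.
Proof.
have mB (d : measure_display) (T : measurableType d) (f g : T -> R) :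
    measurable_fun setT f -> measurable_fun setT g ->
    bmfun (fun w => Num.sg (f w - g w)).
  by move=> mf mg; apply: bm_sgr; exact: measurable_funB.
have bs := bm_sgmean; have b2 := bm_exp 2 bs.
pose F1 (z : R * R) := Num.sg (z.1 - z.2) * sgmean z.1.
pose F2 (z : R * R) := Num.sg (z.2 - z.1) * sgmean z.2.
pose H (q : R * R * R) := Num.sg (q.2 - q.1.1) * Num.sg (q.2 - q.1.2).
have mf1 : measurable_fun setT (fun q : R * R * R => q.1.1).
  exact: (measurableT_comp measurable_fst measurable_fst).
have mf2 : measurable_fun setT (fun q : R * R * R => q.1.2).
  exact: (measurableT_comp measurable_snd measurable_fst).
have bF1 : bmfun F1 by apply: bm_mul => //; exact: (bm_comp bs).
have bF2 : bmfun F2 by apply: bm_mul; [exact: mB|exact: (bm_comp bs)].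
have bH : bmfun H by apply: bm_mul; apply: mB.
pose F3 (z : R * R) := \int[N]_t H (z, t).
have bF3 : bmfun F3 by exact: (bm_Ex2 N2 N bH).
have e1 x y : F1 (x, y) + F2 (x, y) + F3 (x, y) = 1.
  rewrite /F1 /F2 /F3 /H /sgmean/=.
  have bx : bmfun (fun z => Num.sg (x - z)) by exact: (bm_sec1 x bm_sgB).
  have by' : bmfun (fun z => Num.sg (y - z)) by exact: (bm_sec1 y bm_sgB).
  have cx : bmfun (fun z => Num.sg (z - x)) by exact: (bm_sec2 x bm_sgB).
  have cy : bmfun (fun z => Num.sg (z - y)) by exact: (bm_sec2 y bm_sgB).
  rewrite -ExZ// -ExZ// -ExD; [|by apply: bm_mul => //; exact: bm_cst..].
  rewrite -ExD; [|by apply: bm_add; apply: bm_mul => //; exact: bm_cst|exact: bm_mul].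
  rewrite -[RHS](Ex_cst N); apply: (@Ex_normal_off1 _ _ x).
  - by do 2?apply: bm_add; apply: bm_mul => //; exact: bm_cst.
  - exact: bm_cst.
  - by move=> z zx; exact: sgr_median.
pose V := \int[N]_x (sgmean x ^+ 2).
pose G1 x := \int[N]_y F1 (x, y).
pose G2 x := \int[N]_y F2 (x, y).
pose G3 x := \int[N]_y F3 (x, y).
have bG1 : bmfun G1 := bm_Ex2 N N bF1.
have bG2 : bmfun G2 := bm_Ex2 N N bF2.
have bG3 : bmfun G3 := bm_Ex2 N N bF3.
have I1 : \int[N]_x G1 x = V.
  apply: eq_Ex => x; rewrite /G1 /F1/= expr2 -[RHS]/(sgmean x * _).
  rewrite (_ : (fun y => _) = (fun y => sgmean x * Num.sg (x - y))); last first.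
    by apply/funext => y; rewrite mulrC.
  by rewrite ExZ//; exact: (bm_sec1 x bm_sgB).
have I2 : \int[N]_x G2 x = V.
  by rewrite -I1; exact: (Ex_swap N N bF2).
have I3 : \int[N]_x G3 x = V.
  rewrite -[LHS](Ex_prod N N bF3) (Ex_swap N2 N bH).
  apply: eq_Ex => t; rewrite (Ex_prod N N (bm_sec2 t bH)) /H/=.
  have ct : bmfun (fun x => Num.sg (t - x)) by exact: (bm_sec1 t bm_sgB).
  transitivity (\int[N]_x (sgmean t * Num.sg (t - x))).
    by apply: eq_Ex => x; rewrite ExZ// mulrC.
  by rewrite ExZ// expr2.
have lin (f1 f2 f3 : R -> R) : bmfun f1 -> bmfun f2 -> bmfun f3 ->
    \int[N]_x (f1 x + f2 x + f3 x) =
    \int[N]_x f1 x + \int[N]_x f2 x + \int[N]_x f3 x.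
  by move=> h1 h2 h3; rewrite ExD ?ExD//; exact: bm_add.
have tot : \int[N]_x (G1 x + G2 x + G3 x) = 1.
  rewrite -[RHS](Ex_cst N); apply: eq_Ex => x.
  have := lin (fun y => F1 (x, y)) (fun y => F2 (x, y)) (fun y => F3 (x, y))
    (bm_sec1 x bF1) (bm_sec1 x bF2) (bm_sec1 x bF3).
  rewrite -/(G1 x) -/(G2 x) -/(G3 x) => <-.
  by rewrite -[RHS](Ex_cst N); apply: eq_Ex => y; exact: e1.
have conclude (p q s v o : R) : o = p + q + s -> o = 1 -> p = v -> q = v -> s = v ->
    v = 1 / 3.
  by clear; move=> op o1 pv qv sv; lra.
exact (conclude _ _ _ _ _ (lin G1 G2 G3 bG1 bG2 bG3) tot I1 I2 I3).
Qed.

End kendall_kernel.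

(** * Variance of the projection under small correlation *)

Lemma variance_arith {R : realType} (i q a b : R) :
  0 <= q -> q <= 16 * a * b -> `|i - 1 / 9| <= 32 * a * b ->
  `|9 * (i - q) - 1| <= 432 * a * b.
Proof.
rewrite !ler_norml => q0 qb /andP[a1 a2].
by apply/andP; split; lra.
Qed.

Section kendall_variance.
Context {R : realType}.
Local Notation N := (@gauss R).
Local Notation N2 := (N \x N)%E.
Implicit Types x y c m r : R.

(** Bounded version of the function c |x|; it dominates the probability that a
    Gaussian falls in an interval of length proportional to |x|. *)
Definition cap1 c x : R := Num.min 1 (c * `|x|).

Lemma bm_cap1 c : 0 <= c -> bmfun (cap1 c).
Proof.
move=> c0; split.
  by apply: measurable_minr => //; apply: measurable_funM => //; exact: measurableT_comp.
exists 1 => x; rewrite ger0_norm ?ge_min ?lexx// le_min ler01/=.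
by rewrite mulr_ge0.
Qed.

(** A bound for E |G| with G standard normal, read off from the inequality
    |x| exp(-x^2/2) <= exp(-x^2/4): the ratio of the peaks of the densities
    N(0, 1) and N(0, 2). *)
Definition absK : R := normal_peak 1 / normal_peak (Num.sqrt 2).

Lemma absK_ge0 : 0 <= absK.
Proof. by rewrite divr_ge0// normal_peak_ge0. Qed.

Lemma Ex_cap1 c : 0 <= c -> \int[N]_x cap1 c x <= absK * c.
Proof.
move=> c0; have bM := bm_cap1 c0.
have s2 : Num.sqrt 2 != 0 :> R by rewrite gt_eqF// sqrtr_gt0.
have p2 := normal_peak_gt0 s2.
have M0 x : 0 <= cap1 c x by rewrite le_min ler01/= mulr_ge0.
rewrite -lee_fin -(Ex_EFin N bM) integral_normal//; last first.
  by apply/measurable_EFinP; case: bM.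
have mpdf s : measurable_fun setT (fun x => (normal_pdf 0 s x)%:E : \bar R).
  by apply/measurable_EFinP; exact: measurable_normal_pdf.
apply: (@le_trans _ _ (\int[lebesgue_measure]_x ((absK * c)%:E * (normal_pdf 0 (Num.sqrt 2) x)%:E))%E).
  apply: ge0_le_integral => //=.
  - by move=> x _; rewrite mule_ge0// lee_fin ?phi_ge0.
  - by apply: emeasurable_funM; [apply/measurable_EFinP; case: bM|exact: mpdf].
  - by apply: emeasurable_funM => //; exact: mpdf.
  move=> x _; rewrite -!EFinM lee_fin phiE normal_pdfE// /normal_fun subr0.
  rewrite sqr_sqrtr// /absK.
  rewrite [leRHS](_ : _ = c * (normal_peak 1 * expR (- x ^+ 2 / (2 *+ 2)))); last first.
    by field; rewrite gt_eqF.
  have hx : `|x| * expR (- (x ^+ 2 / 2)) <= expR (- x ^+ 2 / (2 *+ 2)).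
    have -> : - (x ^+ 2 / 2) = - (x ^+ 2 / 4) + - x ^+ 2 / (2 *+ 2).
      by rewrite -mulr_natr; field.
    rewrite expRD mulrA ler_piMl ?expR_ge0// expRN ler_pdivrMr ?expR_gt0// mul1r.
    apply: (le_trans _ (expR_ge1Dx _)).
    have := sqr_ge0 (`|x| / 2 - 1); rewrite sqrrB exprMn real_normK ?num_real//.
    by lra.
  apply: (@le_trans _ _ (c * `|x| * (normal_peak 1 * expR (- (x ^+ 2 / 2))))).
    rewrite ler_wpM2r ?mulr_ge0 ?normal_peak_ge0 ?expR_ge0//.
    by rewrite /cap1 ge_min lexx orbT.
  rewrite -mulrA ler_wpM2l// mulrCA ler_wpM2l// normal_peak_ge0//.
rewrite ge0_integralZl//=.
- by rewrite integral_normal_pdf mule1.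
- exact: mpdf.
- by move=> x _; rewrite lee_fin normal_pdf_ge0.
- by rewrite lee_fin mulr_ge0 ?absK_ge0.
Qed.

Lemma Ex_normal_interval y m : 0 <= m ->
  \int[N]_x \1_(`[y - m, y + m] : set R) x <= Num.min 1 (2 * m).
Proof.
move=> m0; have mI : measurable (`[y - m, y + m] : set R) by [].
rewrite le_min; apply/andP; split.
  apply: Ex_le_cst; first exact: bm_indic.
  by move=> x; rewrite indicE; case: (_ \in _).
rewrite -lee_fin -(Ex_indic N mI) /normal_prob.
apply: (@le_trans _ _ (\int[lebesgue_measure]_(x in `[(y - m)%R, (y + m)%R]) (1%:E : \bar R))%E).
  apply: ge0_le_integral => //=.
  - by move=> x _; rewrite lee_fin normal_pdf_ge0.
  - by apply/measurable_EFinP/measurable_funTS; exact: measurable_normal_pdf.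
  - by move=> x _; rewrite lee_fin phi_le1.
rewrite integral_cst//= lebesgue_measure_itv/= lte_fin mul1e.
by case: ifPn => _; rewrite -?EFinB lee_fin; lra.
Qed.

Section perturbation.
Variables (m1 m2 s1 s2 r : R).
Hypotheses (s10 : 0 < s1) (s20 : 0 < s2) (hr : `|r| <= 3 / 4).
Local Notation std := (stdpair m1 m2 s1 s2 r).
Local Notation kr u v := (kendall_kernel (std u) (std v)).
Local Notation k0 u v := (kendall_kernel u v).

(** Correlating the coordinates changes the sign of the second difference only
    if this difference is at most of the order of |r| times the first one. *)
Lemma kernel_perturbation (u v : R * R) :
  `|kr u v - k0 u v| <=
  2 * \1_(`[u.2 - 2 * `|r| * `|u.1 - v.1|, u.2 + 2 * `|r| * `|u.1 - v.1|]
          : set R) v.2.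
Proof.
rewrite indicE mem_setE in_itv/=.
case: (boolP (_ <= v.2 <= _)) => [_|far].
  rewrite mulr1 (le_trans (ler_normB _ _))// [leRHS](_ : 2 = 1 + 1)//.
  by rewrite lerD// kendall_kernel_le1.
rewrite mulr0.
have r2 : r ^+ 2 <= 9 / 16.
  have -> : 9 / 16 = (3 / 4) ^+ 2 :> R by field.
  by rewrite -(real_normK (num_real r)) lerXn2r ?nnegrE.
set w := Num.sqrt (1 - r ^+ 2).
have w0 : 0 <= w by exact: sqrtr_ge0.
have wE : w ^+ 2 = 1 - r ^+ 2 by rewrite sqr_sqrtr//; lra.
have w12 : 1 / 2 <= w.
  rewrite -(ler_sqr (_ : 1 / 2 \in Num.nneg)) ?nnegrE ?divr_ge0// wE.
  by rewrite (_ : (1 / 2) ^+ 2 = 1 / 4 :> R); [lra|field].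
rewrite /kendall_kernel /stdpair/= -/w.
set d1 := u.1 - v.1 in far *; set d2 := u.2 - v.2.
have -> : m1 + s1 * u.1 - (m1 + s1 * v.1) = s1 * d1 by rewrite /d1; ring.
have -> : m2 + s2 * (r * u.1 + w * u.2) - (m2 + s2 * (r * v.1 + w * v.2)) =
  s2 * (r * d1 + w * d2) by rewrite /d1 /d2; ring.
rewrite !sgrM (gtr0_sg s10) (gtr0_sg s20) !mul1r.
suff -> : Num.sg (r * d1 + w * d2) = Num.sg d2 by rewrite subrr normr0.
have : - (`|r| * `|d1|) <= r * d1 <= `|r| * `|d1| by rewrite -ler_norml normrM.
move=> /andP[rl ru].
move: far; rewrite negb_and -!ltNge => /orP[far|far].
  have d20 : 2 * `|r| * `|d1| < d2 by rewrite /d2; lra.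
  have d2p : 0 < d2 by apply: le_lt_trans d20; rewrite !mulr_ge0.
  have := ler_wpM2r (ltW d2p) w12.
  by rewrite (gtr0_sg d2p) => ?; rewrite gtr0_sg//; lra.
have d20 : d2 < - (2 * `|r| * `|d1|) by rewrite /d2; lra.
have d2n : 0 < - d2.
  by rewrite oppr_gt0; apply: (lt_le_trans d20); rewrite oppr_le0 !mulr_ge0.
have := ler_wpM2r (ltW d2n) w12.
have d2m : d2 < 0 by rewrite -oppr_gt0.
by rewrite (ltr0_sg d2m) => ?; rewrite ltr0_sg//; lra.
Qed.

Let mstd := measurable_stdpair m1 m2 s1 s2 r.

Let bkr : bmfun (fun q : (R * R) * (R * R) => kr q.1 q.2).
Proof.
apply: bm_kendall; exact: (measurableT_comp mstd).
Qed.

Let bk0 : bmfun (fun q : (R * R) * (R * R) => k0 q.1 q.2).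
Proof. exact: bm_kendall. Qed.

Let bkd : bmfun (fun q : (R * R) * (R * R) => `|kr q.1 q.2 - k0 q.1 q.2|).
Proof. by apply: bm_norm; exact: bm_sub. Qed.

Let c := 4 * `|r|.
Let c0 : 0 <= c. Proof. by rewrite mulr_ge0. Qed.

Lemma cap1_sub x y : cap1 c (x - y) <= cap1 c x + cap1 c y.
Proof.
rewrite /cap1; have n0 := normr_ge0 x; have m0 := normr_ge0 y.
have := ler_wpM2l c0 (ler_normB x y); rewrite mulrDr => h.
have cx := mulr_ge0 c0 n0; have cy := mulr_ge0 c0 m0.
rewrite /Order.min; case: ifPn => ?; case: ifPn => ?; case: ifPn => ?; lra.
Qed.

Lemma section_perturbation (u : R * R) :
  \int[N2]_v `|kr u v - k0 u v| <= 2 * (cap1 c u.1 + \int[N]_x cap1 c x).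
Proof.
have bu := bm_sec1 u bkd.
have bc := bm_cap1 c0.
rewrite (Ex_prod N N bu)/=.
apply: (@le_trans _ _ (\int[N]_x (2 * (cap1 c u.1 + cap1 c x)))).
  apply: Ex_le.
  - exact: (bm_Ex2 N N bu).
  - by apply: bm_mul; [exact: bm_cst|apply: bm_add => //; exact: bm_cst].
  move=> x.
  set m := 2 * `|r| * `|u.1 - x|.
  have m0 : 0 <= m by rewrite !mulr_ge0.
  have bI : bmfun (\1_(`[u.2 - m, u.2 + m] : set R) : R -> R) by exact: bm_indic.
  apply: (@le_trans _ _ (\int[N]_y (2 * \1_(`[u.2 - m, u.2 + m] : set R) y))).
    apply: Ex_le.
    - exact: (bm_sec1 x bu).
    - by apply: bm_mul => //; exact: bm_cst.
    by move=> y; exact: (kernel_perturbation u (x, y)).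
  rewrite ExZ// ler_wpM2l//.
  apply: (le_trans (Ex_normal_interval u.2 m0)).
  apply: le_trans (cap1_sub u.1 x).
  by rewrite /cap1 /m (_ : 2 * (2 * `|r| * _) = c * `|u.1 - x|)// /c; ring.
rewrite ExZ; last by apply: bm_add => //; exact: bm_cst.
by rewrite ExD//; [rewrite Ex_cst|exact: bm_cst].
Qed.

Lemma total_perturbation :
  \int[N2]_u \int[N2]_v `|kr u v - k0 u v| <= 16 * absK * `|r|.
Proof.
have bc := bm_cap1 c0.
have bc1 : bmfun (fun u : R * R => cap1 c u.1) by exact: (bm_comp bc measurable_fst).
apply: (@le_trans _ _ (\int[N2]_u (2 * (cap1 c u.1 + \int[N]_x cap1 c x)))).
  apply: Ex_le.
  - exact: (bm_Ex2 N2 N2 bkd).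
  - by apply: bm_mul; [exact: bm_cst|apply: bm_add => //; exact: bm_cst].
  exact: section_perturbation.
rewrite ExZ; last by apply: bm_add => //; exact: bm_cst.
rewrite ExD//; last exact: bm_cst.
rewrite Ex_cst (Ex_prod N N bc1)/=.
under eq_Ex do rewrite Ex_cst.
have := Ex_cap1 c0; rewrite /c; lra.
Qed.

Local Notation Q u := (\int[N2]_v kr u v).
Local Notation Q0 u := (\int[N2]_v k0 u v).

Let bQ : bmfun (fun u => Q u). Proof. exact: (bm_Ex2 N2 N2 bkr). Qed.
Let bQ0 : bmfun (fun u => Q0 u). Proof. exact: (bm_Ex2 N2 N2 bk0). Qed.

Let Q0E u : Q0 u = sgmean u.1 * sgmean u.2.
Proof.
have bu := bm_sec1 u bk0; rewrite (Ex_prod N N bu)/=.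
have bs x : bmfun (fun y : R => Num.sg (x - y)).
  by apply: bm_sgr; exact: measurable_funB.
transitivity (\int[N]_x (sgmean u.2 * Num.sg (u.1 - x))).
  by apply: eq_Ex => x; rewrite /kendall_kernel/= ExZ; [rewrite mulrC|exact: bs].
by rewrite ExZ; [rewrite mulrC|exact: bs].
Qed.

Let QD u : `|Q u - Q0 u| <= \int[N2]_v `|kr u v - k0 u v|.
Proof.
rewrite -ExB; [|exact: (bm_sec1 u bkr)|exact: (bm_sec1 u bk0)].
by apply: Ex_norm; apply: bm_sub; [exact: (bm_sec1 u bkr)|exact: (bm_sec1 u bk0)].
Qed.

Let Q1 u : `|Q u| <= 1.
Proof.
rewrite -(Ex_cst N2 (1 : R)); apply: Ex_norm_le; [exact: (bm_sec1 u bkr)|exact: bm_cst|].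
by move=> v; exact: kendall_kernel_le1.
Qed.

Let Q01 u : `|Q0 u| <= 1.
Proof.
rewrite -(Ex_cst N2 (1 : R)); apply: Ex_norm_le; [exact: (bm_sec1 u bk0)|exact: bm_cst|].
by move=> v; exact: kendall_kernel_le1.
Qed.

Lemma gauss_kendall_mean : `|\int[N2]_u Q u| <= 16 * absK * `|r|.
Proof.
have Z0 : \int[N2]_u Q0 u = 0.
  under eq_Ex do rewrite Q0E.
  have bp : bmfun (fun u : R * R => sgmean u.1 * sgmean u.2).
    by apply: bm_mul; apply: (bm_comp bm_sgmean).
  rewrite (Ex_prod N N bp)/=.
  rewrite -[RHS](Ex_cst N); apply: eq_Ex => x.
  by rewrite ExZ ?Ex_sgmean ?mulr0//; exact: bm_sgmean.
rewrite -[X in `|X|]subr0 -Z0 -ExB//.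
apply: le_trans total_perturbation.
apply: Ex_norm_le; [exact: bm_sub|exact: (bm_Ex2 N2 N2 bkd)|exact: QD].
Qed.

Lemma gauss_kendall_second : `|\int[N2]_u (Q u ^+ 2) - 1 / 9| <= 32 * absK * `|r|.
Proof.
have bs2 := bm_exp 2 (@bm_sgmean R).
have Z0 : \int[N2]_u (Q0 u ^+ 2) = 1 / 9.
  under eq_Ex do rewrite Q0E exprMn.
  have bp : bmfun (fun u : R * R => sgmean u.1 ^+ 2 * sgmean u.2 ^+ 2).
    by apply: bm_mul; apply: (bm_comp bs2).
  rewrite (Ex_prod N N bp)/=.
  transitivity (\int[N]_x (1 / 3 * sgmean x ^+ 2)).
    by apply: eq_Ex => x; rewrite ExZ// Ex_sgmean2 mulrC.
  by rewrite ExZ// Ex_sgmean2; field.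
rewrite -Z0 -ExB; [|exact: bm_exp..].
apply: (@le_trans _ _ (\int[N2]_u (2 * \int[N2]_v `|kr u v - k0 u v|))).
  apply: Ex_norm_le.
  - by apply: bm_sub; exact: bm_exp.
  - by apply: bm_mul; [exact: bm_cst|exact: (bm_Ex2 N2 N2 bkd)].
  move=> u; rewrite subr_sqr normrM mulrC; apply: ler_pM => //.
  by rewrite (le_trans (ler_normD _ _))// (_ : 2 = 1 + 1)// lerD.
rewrite ExZ; last exact: (bm_Ex2 N2 N2 bkd).
have := total_perturbation; lra.
Qed.

Definition pair_law : probability (R * R)%type R := law N2 mstd.

Local Notation kp := (kproj pair_law kendall_kernel).
Local Notation tau := (kmean pair_law kendall_kernel).

Let pushE f : bmfun f -> \int[pair_law]_z f z = \int[N2]_u f (std u).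
Proof. by move=> bf; apply: Ex_push => //. Qed.

(** For r = 0 the projection is a product of two independent variables with
    mean zero and second moment 1/3, so its variance is 1/9; the projection
    and its square move by O(|r|) in mean. This explains the factor 3/2 in the
    normal approximation: the projection enters the statistic with weight 2,
    and 3/2 * 2 * 1/3 = 1. *)
Lemma kendall_variance :
  `|9 * \int[pair_law]_z ((kp z - tau) ^+ 2) - 1| <= 432 * absK * `|r|.
Proof.
have bK : bmfun (fun z : (R * R) * (R * R) => kendall_kernel z.1 z.2).
  exact: bm_kendall.
have bkp := bm_kproj pair_law bK.
have qE u : kp (std u) = Q u.
  rewrite /kproj pushE//.
  by apply: (@bm_sec1 _ _ _ _ _ (fun q => kendall_kernel q.1 q.2)); exact: bm_kendall.
have tE : tau = \int[N2]_u Q u.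
  by rewrite /kmean pushE//; apply: eq_Ex => u; exact: qE.
have vE : \int[pair_law]_z ((kp z - tau) ^+ 2) =
    \int[N2]_u (Q u ^+ 2) - tau ^+ 2.
  have bc (a : R) (f : R * R -> R) : bmfun f -> bmfun (fun w => a * f w).
    by move=> hf; apply: bm_mul => //; exact: bm_cst.
  rewrite pushE; last by apply: bm_exp; apply: bm_sub => //; exact: bm_cst.
  transitivity (\int[N2]_u (Q u ^+ 2 - (2 * tau) * Q u + tau ^+ 2)).
    by apply: eq_Ex => u; rewrite qE; ring.
  rewrite ExD; [|by apply: bm_sub; [exact: bm_exp|exact: bc]|exact: bm_cst].
  rewrite ExB; [|exact: bm_exp|exact: bc].
  by rewrite ExZ// Ex_cst -tE; ring.
rewrite vE.
have := gauss_kendall_second; have := gauss_kendall_mean; rewrite -tE => tb.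
have t1 : `|tau| <= 1.
  rewrite tE -(Ex_cst N2 (1 : R)); apply: Ex_norm_le => //; exact: bm_cst.
have t2 : tau ^+ 2 <= 16 * absK * `|r|.
  apply: (le_trans _ tb); rewrite -(real_normK (num_real tau)) expr2.
  by rewrite ler_piMl.
exact: (variance_arith (sqr_ge0 tau) t2).
Qed.

End perturbation.

End kendall_variance.

(** * Hoeffding decomposition and unsmoothing *)

Section hoeffding.
Context {R : realType}.
Implicit Types (h : nat -> nat -> R) (q : nat -> R) (tau : R).

Lemma sum_offdiag h n : (forall k l, h k l = h l k) ->
  \sum_(k < n) \sum_(l < n | l != k) h k l =
  2 * \sum_(k < n) \sum_(l < k) h l k.
Proof.
move=> hC; elim: n => [|n IH]; first by rewrite !big_ord0 mulr0.
rewrite [in RHS]big_ord_recr/= mulrDr -IH big_ord_recr/=.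
have -> : \sum_(l < n.+1 | l != ord_max) h n l = \sum_(l < n) h l n.
  rewrite big_mkcond big_ord_recr/= eqxx/= addr0; apply: eq_bigr => l _.
  by rewrite -val_eqE/= ltn_eqF// hC.
have -> : \sum_(k < n) \sum_(l < n.+1 | l != widen_ord (leqnSn n) k) h k l =
    \sum_(k < n) (\sum_(l < n | l != k) h k l + h k n).
  apply: eq_bigr => k _; rewrite big_mkcond big_ord_recr/=.
  rewrite -val_eqE/= gtn_eqF//=; congr (_ + _).
  by rewrite [RHS]big_mkcond; apply: eq_bigr => l _; rewrite -!val_eqE.
by rewrite big_split/=; ring.
Qed.

(* Each index occurs in n - 1 of the n (n - 1) / 2 pairs. *)
Lemma sum_degenerate h q tau n :
  \sum_(k < n) \sum_(l < k) (h l k - q l - q k + tau) =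
  \sum_(k < n) \sum_(l < k) h l k - (n%:R - 1) * \sum_(k < n) q k
  + n%:R * (n%:R - 1) / 2 * tau.
Proof.
elim: n => [|n IH]; first by rewrite !big_ord0 !mul0r mulr0 subr0 addr0.
rewrite !big_ord_recr/= IH.
have -> : \sum_(l < n) (h l n - q l - q n + tau) =
   \sum_(l < n) h l n - \sum_(l < n) q l - n%:R * q n + n%:R * tau.
  by rewrite !big_split/= !sumrN !sumr_const card_ord !mulr_natl.
by rewrite -natr1; field.
Qed.

Lemma hoeffding_decomposition h q tau n : (forall k l, h k l = h l k) ->
  (1 < n)%N ->
  (n%:R * (n%:R - 1))^-1 * \sum_(k < n) \sum_(l < n | l != k) h k l - tau =
  2 / n%:R * \sum_(k < n) (q k - tau) +
  2 / (n%:R * (n%:R - 1)) *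
    \sum_(k < n) \sum_(l < k) (h l k - q l - q k + tau).
Proof.
move=> hC n1; rewrite sum_degenerate sum_offdiag//.
rewrite big_split/= sumrN sumr_const card_ord -[tau *+ n]mulr_natl.
have n0 : n%:R != 0 :> R by rewrite pnatr_eq0 -lt0n ltnW.
have n10 : n%:R - 1 != 0 :> R by rewrite gt_eqF// subr_gt0 ltr1n.
by field; rewrite n0 n10.
Qed.

End hoeffding.

Section sandwich.
Context d (T : measurableType d) (R : realType) (P : probability T R).
Variables (W D : T -> R).
Hypotheses (bW : bmfun W) (bD : bmfun D).

Definition pr (A : set T) : R := \int[P]_w \1_A w.

Lemma pr_EFin A : measurable A -> P A = (pr A)%:E.
Proof. by move=> mA; exact: Ex_indic. Qed.

Lemma pr_ge0 A : 0 <= pr A.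
Proof. by apply: Ex_ge0 => w; rewrite indicE. Qed.

Lemma measurable_ge (f : T -> R) (c : R) : measurable_fun setT f ->
  measurable [set w | c <= f w].
Proof.
move=> mf.
have -> : [set w | c <= f w] = f @^-1` `[c, +oo[.
  by apply/seteqP; split => w /=; rewrite in_itv/= andbT.
by rewrite -[X in measurable X]setTI; exact: mf.
Qed.

Lemma indic_geE (f : T -> R) (c : R) w :
  \1_[set w | c <= f w] w = (c <= f w)%R%:R :> R.
Proof. by rewrite indicE; congr (nat_of_bool _)%:R; apply/idP/idP; rewrite inE. Qed.

(** The heat flow of variance del^2 majorises the indicator of x >= t, up to
    Phi (-K), after the threshold is moved by K del; the next lemma is the
    reverse comparison. *)
Lemma heat_ge (t del K x : R) : 0 < del -> t <= x ->
  1 <= heat (t - K * del) (del ^+ 2) x + Phi (- K).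
Proof.
move=> d0 tx; rewrite PhiN addrCA -lerBlDl subrr subr_ge0.
rewrite /heat sqrtr_sqr (gtr0_norm d0); apply: Phi_mono.
by rewrite ler_pdivlMr//; lra.
Qed.

Lemma heat_le (t del K x : R) : 0 < del -> x <= t ->
  heat (t + K * del) (del ^+ 2) x <= Phi (- K).
Proof.
move=> d0 tx; rewrite /heat sqrtr_sqr (gtr0_norm d0); apply: Phi_mono.
by rewrite ler_pdivrMr//; lra.
Qed.

Let mWD (t : R) : measurable [set w | t <= W w + D w].
Proof. by apply: measurable_ge; apply: measurable_funD; [case: bW|case: bD]. Qed.

Let mD (t : R) : measurable [set w | t <= `|D w|].
Proof. by apply: measurable_ge; apply: measurableT_comp => //; case: bD. Qed.

Let bH (t v : R) : bmfun (fun w => heat t v (W w)).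
Proof. exact: (bm_cont bW (@continuous_heat _ t v)). Qed.

(** One further shift by del absorbs the remainder D on the event |D| < del. *)
Lemma sandwich_upper (t del K : R) : 0 < del ->
  pr [set w | t <= W w + D w] <=
  \int[P]_w heat (t - (K + 1) * del) (del ^+ 2) (W w) + Phi (- K)
  + pr [set w | del <= `|D w|].
Proof.
move=> d0; have b1 := bm_indic R (mWD t); have b2 := bm_indic R (mD del).
rewrite -[Phi (- K)](Ex_cst P) -ExD//; last exact: bm_cst.
rewrite -ExD//; last by apply: bm_add => //; exact: bm_cst.
apply: Ex_le => //.
  by apply: bm_add => //; apply: bm_add => //; exact: bm_cst.
move=> w; rewrite !indic_geE.
have h0 := heat_ge0 (t - (K + 1) * del) (del ^+ 2) (W w).
have p0 := Phi_ge0 (- K : R).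
case: (boolP (t <= W w + D w)) => [tw|_]; last first.
  by apply: addr_ge0; [exact: addr_ge0|exact: ler0n].
have [Dd|_] := ltP `|D w| del; last by rewrite lerDr; exact: addr_ge0.
rewrite addr0 (_ : t - (K + 1) * del = (t - del) - K * del); last by ring.
by apply: heat_ge => //; move: Dd; rewrite ltr_norml => /andP[? ?]; lra.
Qed.

Lemma sandwich_lower (t del K : R) : 0 < del ->
  \int[P]_w heat (t + (K + 1) * del) (del ^+ 2) (W w) <=
  pr [set w | t <= W w + D w] + Phi (- K) + pr [set w | del <= `|D w|].
Proof.
move=> d0; have b1 := bm_indic R (mWD t); have b2 := bm_indic R (mD del).
rewrite -[Phi (- K)](Ex_cst P) -ExD//; last exact: bm_cst.
rewrite -ExD//; last by apply: bm_add => //; exact: bm_cst.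
apply: Ex_le => //.
  by apply: bm_add => //; apply: bm_add => //; exact: bm_cst.
move=> w; rewrite !indic_geE.
have h1 := heat_le1 (t + (K + 1) * del) (del ^+ 2) (W w).
have p0 := Phi_ge0 (- K : R).
case: (boolP (t <= W w + D w)) => [_|tw].
  by rewrite (le_trans h1)// -addrA lerDl addr_ge0.
case: (leP del `|D w|) => [_|Dd]; first by rewrite (le_trans h1)// lerDr addr_ge0.
rewrite addr0 add0r (_ : t + (K + 1) * del = (t + del) + K * del); last by ring.
move: tw; rewrite -ltNge => tw.
by apply: heat_le => //; move: Dd; rewrite ltr_norml => /andP[? ?]; lra.
Qed.

Lemma markov_even (del : R) (m : nat) : 0 < del ->
  pr [set w | del <= `|D w|] <=
  \int[P]_w (D w ^+ (m.*2).+2) / del ^+ (m.*2).+2.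
Proof.
move=> d0.
have bN := bm_exp (m.*2).+2 bD.
have dN : 0 < del ^+ (m.*2).+2 by rewrite exprn_gt0.
rewrite mulrC -ExZ//; apply: Ex_le; first exact: bm_indic.
  by apply: bm_mul => //; exact: bm_cst.
move=> w; rewrite indic_geE.
have e : D w ^+ (m.*2).+2 = `|D w| ^+ (m.*2).+2.
  rewrite -normrX ger0_norm// -doubleS -mul2n exprM exprn_ge0// sqr_ge0//.
case: (leP del `|D w|) => [dD|_].
  by rewrite e mulrC ler_pdivlMr// mul1r lerXn2r// nnegrE// ltW.
by rewrite e mulr_ge0 ?invr_ge0 ?(ltW dN)// exprn_ge0.
Qed.

End sandwich.

(** Moving the threshold by eps and inflating the variance to 1 + del^2 changes
    the argument of Phi by at most kap; as t kap <= 1, the density between the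
    two arguments stays below e exp(-t^2/2). *)
Lemma gauss_shift {R : realType} (t s del eps kap : R) :
  0 <= del -> del <= 1 -> 0 <= eps -> eps <= t -> `|s - t| <= eps ->
  kap = eps + (t + eps) * del ^+ 2 -> t * kap <= 1 ->
  expR (- (s ^+ 2 / 2)) <= expR 1 * expR (- (t ^+ 2 / 2)) /\
  `|Phi (- s / Num.sqrt (1 + del ^+ 2)) - Phi (- t)| <=
    expR 1 * expR (- (t ^+ 2 / 2)) * kap.
Proof.
move=> d0 d1 e0 et st kE tk.
have t0 : 0 <= t by exact: le_trans et.
have te0 : 0 <= t + eps by rewrite addr_ge0.
have d20 : 0 <= del ^+ 2 by rewrite exprn_ge0.
have k0 : 0 <= kap by rewrite kE addr_ge0// mulr_ge0.
have ek : eps <= kap by rewrite kE lerDl mulr_ge0.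
have expo y : t - kap <= y -> expR (- (y ^+ 2 / 2)) <= expR 1 * expR (- (t ^+ 2 / 2)) \/ y < 0.
  move=> yt; have [y0|y0] := leP 0 y; last by right.
  left; rewrite -expRD ler_expR.
  have := sqr_ge0 (t - y).
  have [ty|ty] := leP t y; first by have := ler_pM t0 t0 ty ty; nra.
  have : (t - y) * t <= kap * t by rewrite ler_wpM2r//; lra.
  nra.
have [s1 s2] : t - eps <= s /\ s <= t + eps.
  by move: st; rewrite ler_norml => /andP[]; split; lra.
have s0 : 0 <= s by lra.
split.
  have ts : t - kap <= s by lra.
  by case: (expo s ts) => // /(le_lt_trans s0); rewrite ltxx.
set w := Num.sqrt (1 + del ^+ 2).
have w1 : 1 <= w by rewrite -[leLHS]sqrtr1 ler_wsqrtr// lerDl.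
have w0 : 0 < w by exact: lt_le_trans w1.
have ww : w <= 1 + del ^+ 2.
  rewrite -[leRHS]ger0_norm ?addr_ge0// -sqrtr_sqr ler_wsqrtr//.
  by rewrite expr2 ler_peMl ?addr_ge0// lerDl.
set y := s / w.
have y0 : 0 <= y by rewrite divr_ge0// ltW.
have ys : y <= s by rewrite ler_pdivrMr// ler_peMr.
have sy : s - s * del ^+ 2 <= y.
  rewrite ler_pdivlMr//.
  have : s * w <= s * (1 + del ^+ 2) by rewrite ler_wpM2l.
  have : 0 <= s * del ^+ 2 * (w - 1) by rewrite !mulr_ge0// subr_ge0.
  nra.
have yk : `|y - t| <= kap.
  have : s * del ^+ 2 <= (t + eps) * del ^+ 2 by rewrite ler_wpM2r.
  by rewrite ler_norml kE => ?; apply/andP; split; lra.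
rewrite mulNr -/y !PhiN opprB addrCA [X in `|X|](_ : _ = Phi t - Phi y); last by ring.
have bound z : Num.min y t <= z -> phi z <= expR 1 * expR (- (t ^+ 2 / 2)).
  move=> mz; apply: (le_trans (phi_le_exp z)).
  have mk : t - kap <= Num.min y t.
    by rewrite le_min; move: yk; rewrite ler_norml => /andP[? ?]; apply/andP; split; lra.
  have z0 : 0 <= z by rewrite (le_trans _ mz)// le_min y0 t0.
  by case: (expo z (le_trans mk mz)) => // /(le_lt_trans z0); rewrite ltxx.
have mvt a c : a <= c -> Num.min y t <= a ->
    `|Phi c - Phi a| <= expR 1 * expR (- (t ^+ 2 / 2)) * (c - a).
  move=> ac ma.
  have [||z zac ->] := @MVT_segment R (@Phi R) (@phi R) a c ac.
  - by move=> z _; exact: is_derive_Phi.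
  - by apply: continuous_subspaceT; exact: continuous_Phi.
  rewrite normrM (ger0_norm (phi_ge0 z)) ger0_norm ?subr_ge0// ler_wpM2r ?subr_ge0//.
  by apply: bound; rewrite (le_trans ma)//; move: zac; rewrite in_itv/= => /andP[].
have E0 : 0 <= expR 1 * expR (- (t ^+ 2 / 2)) by rewrite mulr_ge0 ?expR_ge0.
move: yk; rewrite ler_norml => /andP[yk1 yk2].
have [yt|/ltW ty] := leP y t.
  apply: (le_trans (mvt y t yt _)); first by rewrite ge_min lexx.
  by rewrite ler_wpM2l//; lra.
rewrite distrC; apply: (le_trans (mvt t y ty _)); first by rewrite ge_min lexx orbT.
by rewrite ler_wpM2l//; lra.
Qed.

Lemma sandwich_arith {R : realType} (E p1 p2 i1 i2 f1 f2 : R) :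
  p1 <= i1 + f1 + p2 -> i2 <= p1 + f1 + p2 ->
  `|i2 - f2| <= E -> `|i1 - f2| <= E -> `|p1 - f2| <= E + f1 + p2.
Proof. by rewrite !ler_norml => ? ? /andP[? ?] /andP[? ?]; apply/andP; split; lra. Qed.

Lemma scale_dist {R : realType} (c a e : R) :
  0 <= c -> `|a - 1| <= e -> `|c * a - c| <= e * c.
Proof.
move=> c0 ae; rewrite -[X in _ - X]mulr1 -mulrBr normrM (ger0_norm c0) mulrC.
exact: ler_wpM2r.
Qed.

Lemma ler_pM3 {R : realType} (l e e' a b : R) :
  0 <= l -> 0 <= e -> e <= e' -> 0 <= a -> a <= b -> l * e * a <= e' * (l * b).
Proof.
move=> l0 e0 ee a0 ab; rewrite [l * e]mulrC -mulrA.
by apply: ler_pM => //; [rewrite mulr_ge0|rewrite ler_wpM2l].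
Qed.

Section one_sided.
Context d (T : measurableType d) dS (S : measurableType dS) (R : realType).
Variables (P : probability T R) (nu : probability S R) (X : nat -> T -> S).
Variables (n : nat) (g : S -> R) (D : T -> R) (del eta t K : R).
Hypotheses (mX : forall k, measurable_fun setT (X k)) (hX : iid P nu X n).
Hypotheses (bg : bmfun g) (g2 : forall x, `|g x| <= 2) (g0 : \int[nu]_x g x = 0).
Hypotheses (gvar : `|9 * \int[nu]_x (g x ^+ 2) - 1| <= eta).
Hypotheses (bD : bmfun D) (n0 : (0 < n)%N) (del0 : 0 < del).
Hypothesis del4 : del ^+ 4 = n%:R^-1.
Hypotheses (t0 : 0 <= t) (K0 : 0 <= K) (eta0 : 0 <= eta).
Let eps := (K + 1) * del.
Let kap := eps + (t + eps) * del ^+ 2.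
Hypotheses (epst : (K + 1) * del <= t)
  (tkap : t * ((K + 1) * del + (t + (K + 1) * del) * del ^+ 2) <= 1).
Hypotheses (te3 : (t + (K + 1) * del) ^+ 3 * del ^+ 2 <= 1)
  (teta : (t + (K + 1) * del) ^+ 2 * eta <= 1)
  (teB : (t + (K + 1) * del) * (6 * del ^+ 2) <= 1).

Let xi k w := 3 * del ^+ 2 * g (X k w).

Let bxi k : bmfun (xi k).
Proof. by apply: bm_mul; [exact: bm_cst|exact: (bm_comp bg (mX k))]. Qed.

Let bc (c : R) (f : S -> R) : bmfun f -> bmfun (fun x => c * f x).
Proof. by move=> hf; apply: bm_mul => //; exact: bm_cst. Qed.

Lemma psum_indep k (f f' : R -> R) : (k < n)%N -> continuous f -> continuous f' ->
  \int[P]_w (f (psum xi k w) * f' (xi k w)) =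
  (\int[P]_w f (psum xi k w)) * (\int[P]_w f' (xi k w)).
Proof.
move=> kn cf cf'.
have bf' : bmfun (fun x => f' (3 * del ^+ 2 * g x)).
  by apply: (bm_cont _ cf'); exact: bc.
have bS : bmfun (fun w : pastT X k => \sum_(i < k) (3 * del ^+ 2 * g (X i w))).
  apply: (@bm_sum_ord _ _ _ k (fun i (w : pastT X k) => 3 * del ^+ 2 * g (X i w))).
  move=> i ik; apply: bm_mul; first exact: bm_cst.
  by apply: (bm_comp bg); exact: measurable_X_past.
have bfS := bm_cont bS cf.
rewrite (@iid_Ex _ _ _ _ _ P nu X n mX hX k
  (fun z => f (\sum_(i < k) (3 * del ^+ 2 * g (X i z.1))) *
     f' (3 * del ^+ 2 * g z.2)))//; last first.
  apply: bm_mul; first exact: (bm_comp bfS measurable_fst).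
  exact: (bm_comp bf' measurable_snd).
rewrite (@iid_Ex1 _ _ _ _ _ P nu X n mX hX k _ kn bf').
have bP : bmfun (fun w => psum xi k w) by apply: bm_sum_ord => i _; exact: bxi.
set J := \int[nu]_x f' _.
transitivity (\int[P]_w (J * f (psum xi k w))).
  by apply: eq_Ex => w /=; rewrite ExZ// mulrC.
by rewrite ExZ ?[J * _]mulrC//; exact: (bm_cont bP cf).
Qed.

Let W w := psum xi n w.

(** Tail of a normalised sum of n bounded i.i.d. terms plus a remainder, from
    the smoothed estimate at the two thresholds t + (K + 1) del and
    t - (K + 1) del. *)
Lemma one_sided_bound :
  `|pr P [set w | t <= W w + D w] - Phi (- t)| <=
  expR 1 * expR (- (t ^+ 2 / 2)) * (kap + lindC 6 *
     (4 * (eta + del ^+ 2) / del + (eta + del) * (t + eps) ^+ 2))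
  + Phi (- K) + pr P [set w | del <= `|D w|].
Proof.
have bW : bmfun W by apply: bm_sum_ord => i _; exact: bxi.
have d1 : del <= 1.
  rewrite leNgt; apply/negP => d1.
  have : 1 < del ^+ 4 by rewrite exprn_egt1.
  by rewrite del4 ltNge invf_le1 ?ltr0n// ler1n n0.
have e0 : 0 <= eps by rewrite mulr_ge0 ?(ltW del0)// addr_ge0.
have smd s : `|s - t| <= eps ->
  `|\int[P]_w heat s (del ^+ 2) (W w) - Phi (- t)| <=
  expR 1 * expR (- (t ^+ 2 / 2)) * (kap + lindC 6 *
     (4 * (eta + del ^+ 2) / del + (eta + del) * (t + eps) ^+ 2)).
  move=> st.
  have [E1 E2] := gauss_shift (ltW del0) d1 e0 epst st erefl tkap.
  have [s0 s1] : 0 <= s /\ s <= t + eps.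
    by move: st epst; rewrite -/eps ler_norml => /andP[? ?] ?; split; lra.
  have s2 : s ^+ 2 <= (t + eps) ^+ 2 by rewrite lerXn2r ?nnegrE// addr_ge0.
  have d20 : 0 <= del ^+ 2 by rewrite exprn_ge0// ltW.
  have xib k w : (k < n)%N -> `|xi k w| <= 6 * del ^+ 2.
    have c0 : 0 <= 3 * del ^+ 2 by rewrite (mulr_ge0 (ler0n R 3) d20).
    move=> _; rewrite /xi normrM (ger0_norm c0).
    have := ler_wpM2l c0 (g2 (X k w)).
    by move=> /le_trans; apply; rewrite le_eqVlt; apply/orP; left; apply/eqP; ring.
  have Exi1 : forall k, (k < n)%N -> \int[P]_w (xi k w) = 0.
    move=> k kn; rewrite /xi (@iid_Ex1 _ _ _ _ _ P nu X n mX hX k _ kn (bc _ bg)).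
    by rewrite ExZ// g0 mulr0.
  have Exi2 : forall k, (k < n)%N ->
      `|\int[P]_w (xi k w ^+ 2) - n%:R^-1| <= eta * n%:R^-1.
    move=> k kn.
    rewrite (@iid_Ex1 _ _ _ _ _ P nu X n mX hX k (fun x => (3 * del ^+ 2 * g x) ^+ 2) kn); last first.
      by apply: bm_exp; exact: bc.
    rewrite (_ : \int[nu]_x _ = del ^+ 4 * (9 * \int[nu]_x (g x ^+ 2))); last first.
      transitivity (\int[nu]_x ((del ^+ 4 * 9) * g x ^+ 2)).
        by apply: eq_Ex => x; ring.
      by rewrite ExZ; [rewrite -mulrA|exact: bm_exp].
    by rewrite del4; apply: scale_dist => //; rewrite invr_ge0.
  have s3 : s ^+ 3 * del ^+ 2 <= 1.
    by rewrite (le_trans _ te3)// ler_wpM2r// lerXn2r ?nnegrE// addr_ge0.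
  have se : s ^+ 2 * eta <= 1 by rewrite (le_trans _ teta)// ler_wpM2r.
  have sB : s * (6 * del ^+ 2) <= 1.
    by rewrite (le_trans _ teB)// ler_wpM2r// mulr_ge0.
  have := @smooth_moderate_deviation _ _ _ P n xi del eta s 6 (fun k _ => bxi k)
     xib psum_indep Exi1 Exi2 n0 del0 del4 (ler0n _ _) s0 s3 eta0 se sB.
  rewrite -/(W) => SM.
  set A := 4 * (eta + del ^+ 2) / del in SM *.
  have lc0 : 0 <= lindC 6 :> R by rewrite lindC_ge0.
  have A0 : 0 <= A by rewrite divr_ge0 ?(ltW del0)// mulr_ge0// addr_ge0.
  have sums : eta * s ^+ 2 + del * s ^+ 2 <= (eta + del) * (t + eps) ^+ 2.
    by rewrite -mulrDl ler_wpM2l// addr_ge0// ltW.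
  have sum0 : 0 <= eta * s ^+ 2 + del * s ^+ 2.
    by rewrite -mulrDl mulr_ge0 ?addr_ge0 ?exprn_ge0// ltW.
  apply: (le_trans (ler_distD (Phi (- s / Num.sqrt (1 + del ^+ 2))) _ _)).
  rewrite [kap + _]addrC mulrDr; apply: lerD; last exact: E2.
  apply: (le_trans SM).
  apply: (ler_pM3 lc0 (expR_ge0 _) E1); first exact: addr_ge0.
  by rewrite lerD2l.
have U := sandwich_upper P bW bD t K del0.
have Lo := sandwich_lower P bW bD t K del0.
have S1 : `|(t - eps) - t| <= eps by rewrite addrAC subrr add0r normrN ger0_norm.
have S2 : `|(t + eps) - t| <= eps by rewrite addrAC subrr add0r ger0_norm.
exact: (sandwich_arith U Lo (smd _ S2) (smd _ S1)).
Qed.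

End one_sided.

(** * Moderate deviations of a U-statistic *)

Lemma remainder_scale {R : realType} (v del T : R) : 0 < del ->
  v * del ^+ 4 = 1 -> 2 <= v ->
  `|3 * del ^+ 2 / (v - 1) * T| <= 6 * del ^+ 6 * `|T|.
Proof.
move=> d0 vd v2; rewrite normrM; apply: ler_wpM2r => //.
have v1 : 0 < v - 1 by lra.
have p2 : 0 < del ^+ 2 by rewrite exprn_gt0.
have p6 : 0 < del ^+ 6 by rewrite exprn_gt0.
rewrite ger0_norm; last by rewrite divr_ge0 ?(ltW v1)// mulr_ge0// ltW.
rewrite ler_pdivrMr//.
have -> : 3 * del ^+ 2 = 3 * del ^+ 6 * v.
  by rewrite -[LHS]mulr1 -vd; ring.
have : 0 <= del ^+ 6 * (v - 2) by rewrite mulr_ge0 ?(ltW p6)// subr_ge0.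
lra.
Qed.

Lemma statistic_split {R : realType} (v del A B : R) : del != 0 ->
  v * del ^+ 4 = 1 -> v - 1 != 0 ->
  3 / 2 / del ^+ 2 * (2 / v * A + 2 / (v * (v - 1)) * B) =
  3 * del ^+ 2 * A + 3 * del ^+ 2 / (v - 1) * B.
Proof.
move=> d0 vd v1.
have v0 : v != 0 by apply: contra_eq_neq vd => ->; rewrite mul0r eq_sym oner_eq0.
have d2 : del ^+ 2 != 0 by rewrite expf_neq0.
have dE : (del ^+ 2)^-1 = v * del ^+ 2.
  by apply: (mulIf d2); rewrite mulVf// -mulrA -exprD vd.
by rewrite dE; field; rewrite v0 v1.
Qed.

Lemma tail_scale {R : realType} (v del c M : R) (m : nat) : 0 < del ->
  v * del ^+ 4 = 1 -> 0 <= c ->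
  (6 * del ^+ 6) ^+ (m.*2).+2 *
    ((c * v ^+ m.+1) ^+ 2 * M ^+ (m.*2).+2) / del ^+ (m.*2).+2 =
  c ^+ 2 * (6 * M) ^+ (m.*2).+2 * del ^+ (m.*2).+2.
Proof.
move=> d0 vd c0.
set N := (m.*2).+2.
have NE : (m.+1 * 2 = N)%N by rewrite /N muln2 doubleS.
have dN : del ^+ N != 0 by rewrite expf_neq0// gt_eqF.
have -> : (c * v ^+ m.+1) ^+ 2 = c ^+ 2 * v ^+ N.
  by rewrite exprMn -exprM NE.
apply: (mulIf dN); rewrite mulfVK//.
have -> : (6 * del ^+ 6) ^+ N = 6 ^+ N * del ^+ N * del ^+ N * (del ^+ 4) ^+ N.
  by rewrite -!exprMn; congr (_ ^+ _); ring.
rewrite [(6 * M) ^+ N]exprMn.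
transitivity (c ^+ 2 * (6 ^+ N * M ^+ N) * del ^+ N * del ^+ N *
   (v ^+ N * (del ^+ 4) ^+ N)); first by ring.
by rewrite -[v ^+ N * _]exprMn vd expr1n mulr1.
Qed.

Lemma two_sided_arith {R : realType} (p pp pn F B : R) :
  p = pp + pn -> `|pp - F| <= B -> `|pn - F| <= B -> `|p - 2 * F| <= 2 * B.
Proof.
by move=> ->; rewrite !ler_norml => /andP[? ?] /andP[? ?]; apply/andP; split; lra.
Qed.

Lemma four_terms {R : realType} (a b c e : R) :
  `|a| <= 1 -> `|b| <= 1 -> `|c| <= 1 -> `|e| <= 1 -> `|a - b - c + e| <= 4.
Proof.
rewrite !ler_norml => /andP[? ?] /andP[? ?] /andP[? ?] /andP[? ?].
by apply/andP; split; lra.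
Qed.

Section ustatistic.
Context d (T : measurableType d) dS (S : measurableType dS) (R : realType).
Variables (P : probability T R) (nu : probability S R) (X : nat -> T -> S).
Variables (n m : nat) (h : S -> S -> R) (del eta t K : R).
Hypotheses (mX : forall k, measurable_fun setT (X k)) (hX : iid P nu X n).
Hypotheses (bh : bmfun (fun z : S * S => h z.1 z.2)).
Hypotheses (hC : forall x y, h x y = h y x) (h1 : forall x y, `|h x y| <= 1).

Local Notation q := (kproj nu h).
Local Notation tau := (kmean nu h).

Definition ustat w : R := (n%:R * (n%:R - 1))^-1 *
  \sum_(k < n) \sum_(l < n | l != k) h (X k w) (X l w).

Let g x := q x - tau.
(* Completely degenerate part of the kernel. *)
Let ht (z : S * S) := h z.1 z.2 - q z.1 - q z.2 + tau.

Lemma bm_h2 x : bmfun (h x).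
Proof. exact: (bm_sec1 x bh). Qed.

Let bm_q : bmfun q. Proof. exact: bm_kproj. Qed.

Let bg : bmfun g.
Proof. by apply: bm_sub; [exact: bm_q|exact: bm_cst]. Qed.

Let g2 x : `|g x| <= 2.
Proof.
rewrite (le_trans (ler_normB _ _))// (_ : 2 = 1 + 1)// lerD//.
  exact: (kproj_le1 nu bh h1).
exact: (kmean_le1 nu bh h1).
Qed.

Let g0 : \int[nu]_x g x = 0.
Proof. by rewrite ExB ?Ex_cst ?subrr//; exact: bm_cst. Qed.

Let bht : bmfun ht.
Proof.
apply: bm_add; last exact: bm_cst.
apply: bm_sub; last exact: (bm_comp bm_q measurable_snd).
apply: bm_sub; first exact: bh.
exact: (bm_comp bm_q measurable_fst).
Qed.

Let ht4 z : `|ht z| <= 4.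
Proof.
by apply: four_terms; [exact: h1|exact: (kproj_le1 nu bh h1)..|exact: (kmean_le1 nu bh h1)].
Qed.

Let deg2 x : \int[nu]_y ht (x, y) = 0.
Proof.
have b1 := bm_h2 x; have b2 := bm_q.
have b3 := bm_sub b1 (bm_cst S (q x)).
rewrite /ht/= ExD; [|exact: bm_sub|exact: bm_cst].
rewrite ExB// ExB//; last exact: bm_cst.
by rewrite !Ex_cst subrr add0r addNr.
Qed.

Let deg1 y : \int[nu]_x ht (x, y) = 0.
Proof.
rewrite -[RHS](deg2 y); apply: eq_Ex => x.
by rewrite /ht/= hC; congr (_ + _); rewrite addrAC.
Qed.

Hypotheses (gvar : `|9 * \int[nu]_x ((q x - tau) ^+ 2) - 1| <= eta).
Hypotheses (n2 : (1 < n)%N) (del0 : 0 < del).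
Hypothesis del4 : del ^+ 4 = n%:R^-1.
Hypotheses (t0 : 0 < t) (K0 : 0 <= K) (eta0 : 0 <= eta).
Hypotheses (epst : (K + 1) * del <= t)
  (tkap : t * ((K + 1) * del + (t + (K + 1) * del) * del ^+ 2) <= 1).
Hypotheses (te3 : (t + (K + 1) * del) ^+ 3 * del ^+ 2 <= 1)
  (teta : (t + (K + 1) * del) ^+ 2 * eta <= 1)
  (teB : (t + (K + 1) * del) * (6 * del ^+ 2) <= 1).

Let n0 : (0 < n)%N. Proof. exact: ltnW. Qed.

Let ndel : n%:R * del ^+ 4 = 1.
Proof. by rewrite del4 mulfV// pnatr_eq0 -lt0n. Qed.

Let Tsum w := \sum_(k < n) \sum_(l < k) ht (X l w, X k w).
Let D w := 3 * del ^+ 2 / (n%:R - 1) * Tsum w.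

Let bT : bmfun Tsum.
Proof.
apply: (@bm_sum_ord _ _ _ n (fun k w => \sum_(l < k) ht (X l w, X k w))) => k _.
apply: (@bm_sum_ord _ _ _ k (fun l w => ht (X l w, X k w))) => l _.
by apply: (bm_comp bht); exact/measurable_fun_pair.
Qed.

Let bD : bmfun D.
Proof. by apply: bm_mul => //; exact: bm_cst. Qed.

(** Here del = n^(-1/4), so that 1/del^2 = sqrt n. *)
Lemma ustat_split w :
  3 / 2 / del ^+ 2 * (ustat w - tau) =
  psum (fun k w => 3 * del ^+ 2 * g (X k w)) n w + D w.
Proof.
have n10 : n%:R - 1 != 0 :> R by rewrite gt_eqF// subr_gt0 ltr1n.
rewrite /ustat (@hoeffding_decomposition _ (fun k l => h (X k w) (X l w))
  (fun k => q (X k w)))//.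
rewrite statistic_split//; last by rewrite gt_eqF.
by congr (_ + _); rewrite mulr_sumr.
Qed.

(** Markov's inequality for the moment of order N = 2m + 2: the remainder is
    of order n^(-1/2) = del^2, so its probability to exceed del is of order
    del^N, smaller than any fixed power of 1/n for m large. *)
Lemma ustat_remainder_tail : pr P [set w | del <= `|D w|] <=
  momC m ^+ 2 * 24 ^+ (m.*2).+2 * del ^+ (m.*2).+2.
Proof.
apply: (le_trans (markov_even P bD m del0)).
have -> : 24 = 6 * 4 :> R by rewrite -natrM.
rewrite -(tail_scale 4 m del0 ndel (momC_ge0 m)).
have dN : 0 <= (del ^+ (m.*2).+2)^-1 by rewrite invr_ge0 exprn_ge0// ltW.
apply: ler_wpM2r => //.
have M0 : 0 <= 4 :> R by [].
apply: le_trans (ler_wpM2l _ (degenerate_moment m n0 mX hX bht M0 ht4 deg1 deg2)); last first.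
  by rewrite exprn_ge0// mulr_ge0// exprn_ge0// ltW.
rewrite -ExZ; last exact: bm_exp.
apply: Ex_le; first exact: bm_exp.
  by apply: bm_mul; [exact: bm_cst|exact: bm_exp].
move=> w.
have ev (x : R) : x ^+ (m.*2).+2 = `|x| ^+ (m.*2).+2.
  by rewrite -normrX ger0_norm// -doubleS -mul2n exprM exprn_ge0// sqr_ge0.
rewrite (ev (D w)) (ev (\sum_(k < n) _)) -exprMn.
have v2 : 2 <= n%:R :> R by rewrite ler_nat.
have c0 : 0 <= 6 * del ^+ 6 by rewrite mulr_ge0// exprn_ge0// ltW.
apply: lerXn2r.
- by rewrite nnegrE.
- by rewrite nnegrE mulr_ge0.
- exact: (remainder_scale _ del0 ndel v2).
Qed.

Definition ustat_error : R :=
  expR 1 * expR (- (t ^+ 2 / 2)) *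
    ((K + 1) * del + (t + (K + 1) * del) * del ^+ 2 + lindC 6 *
     (4 * (eta + del ^+ 2) / del + (eta + del) * (t + (K + 1) * del) ^+ 2))
  + Phi (- K) + momC m ^+ 2 * 24 ^+ (m.*2).+2 * del ^+ (m.*2).+2.

(** As t > 0, the two-sided event is the disjoint union of two one-sided ones;
    the lower tail is the upper tail for the opposite kernel. *)
Lemma ustat_moderate_deviation :
  `|pr P [set w | t <= `|3 / 2 / del ^+ 2 * (ustat w - tau)|]
    - 2 * Phi (- t)| <= 2 * ustat_error.
Proof.
pose W := psum (fun k w => 3 * del ^+ 2 * g (X k w)) n.
pose W' := psum (fun k w => 3 * del ^+ 2 * (- g (X k w))) n.
pose D' w := - D w.
have bg' : bmfun (fun x => - g x) by exact: bm_opp.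
have g2' x : `|- g x| <= 2 by rewrite normrN.
have g0' : \int[nu]_x (- g x) = 0 by rewrite ExN// g0 oppr0.
have gvar' : `|9 * \int[nu]_x ((- g x) ^+ 2) - 1| <= eta.
  rewrite (_ : \int[nu]_x _ = \int[nu]_x ((q x - tau) ^+ 2))//.
  by apply: eq_Ex => x; rewrite sqrrN.
have bD' : bmfun D' by exact: bm_opp.
have tail := ustat_remainder_tail.
have up := one_sided_bound mX hX bg g2 g0 gvar bD n0 del0 del4 (ltW t0) K0 eta0
  epst tkap te3 teta teB.
have dn := one_sided_bound mX hX bg' g2' g0' gvar' bD' n0 del0 del4 (ltW t0) K0 eta0
  epst tkap te3 teta teB.
have [mW _] : bmfun W.
  by apply: bm_sum_ord => i _; apply: bm_mul; [exact: bm_cst|exact: (bm_comp bg (mX i))].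
have [mW' _] : bmfun W'.
  by apply: bm_sum_ord => i _; apply: bm_mul; [exact: bm_cst|exact: (bm_comp bg' (mX i))].
have [mD _] := bD; have [mD' _] := bD'.
have W'E w : W' w = - W w.
  by rewrite /W' /W /psum -sumrN; apply: eq_bigr => i _; rewrite mulrN.
apply: (@two_sided_arith _ _ (pr P [set w | t <= W w + D w])
  (pr P [set w | t <= W' w + D' w])).
- rewrite /pr -ExD; [|exact/bm_indic/measurable_ge/measurable_funD..].
  apply: eq_Ex => w; rewrite !indic_geE ustat_split -/(W w) W'E /D' -opprD.
  case: (leP t (W w + D w)) => tw.
    have wd0 : 0 < W w + D w by exact: lt_le_trans tw.
    rewrite gtr0_norm// tw.
    by rewrite [t <= - _]lt_geF ?addr0// (lt_trans _ t0)// oppr_lt0.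
  rewrite add0r; congr (nat_of_bool _)%:R.
  by rewrite ler_normr [t <= W w + _]lt_geF.
- apply: (le_trans up); rewrite /ustat_error -!addrA; apply: lerD => //.
  by apply: lerD.
- apply: (le_trans dn); rewrite /ustat_error -!addrA; apply: lerD => //.
  apply: lerD => //; apply: le_trans tail.
  by rewrite /D'; under eq_set do rewrite normrN.
Qed.

End ustatistic.

(** * The regime of large samples *)

Section regime.
Context {R : realType}.
Implicit Types (a A lam s del eta K Q : R).

(** With s = sqrt (log p), t = a s and K <= (a + 1) s, all the conditions of the
    tail estimate have the form c s^j del <= 1 with j <= 4. As 2 s >= 1, they
    follow from the smallness of s^4 del once it is compared with the sum of
    the constants c. *)
Definition regime_const a A : R :=
  (a + 3) / a + a * (3 * a + 6) + (2 * a + 3) ^+ 3 + (2 * a + 3) ^+ 2 * A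
  + 6 * (2 * a + 3) + 1.

(** Bound for the relative error of the tail estimate in the unit s^2 del,
    that is, log p / n^(1/4). *)
Definition regime_error a A lam : R :=
  2 * (3 * a + 6) + lam * (8 * A + 16 + (A + 1) * (2 * a + 3) ^+ 2).

Lemma regime_const_ge1 a A : 0 < a -> 0 <= A -> 1 <= regime_const a A.
Proof.
move=> a0 A0; have c1 : 0 <= a + 3 by lra.
have c2 : 0 <= 2 * a + 3 by lra.
have c3 : 0 <= 3 * a + 6 by lra.
rewrite /regime_const lerDr; apply: addr_ge0; last by rewrite mulr_ge0.
apply: addr_ge0; last by rewrite mulr_ge0// exprn_ge0.
apply: addr_ge0; last by rewrite exprn_ge0.
by apply: addr_ge0; [rewrite divr_ge0// ltW|rewrite mulr_ge0// ltW].
Qed.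

Lemma regime_error_ge0 a A lam : 0 < a -> 0 <= A -> 0 <= lam ->
  0 <= regime_error a A lam.
Proof.
move=> a0 A0 l0; have c3 : 0 <= 3 * a + 6 by lra.
apply: addr_ge0; first by rewrite mulr_ge0.
apply: mulr_ge0 => //; apply: addr_ge0; last first.
  by rewrite mulr_ge0 ?exprn_ge0//; lra.
by lra.
Qed.

Lemma regime a A lam s del eta K :
  0 < a -> 0 <= A -> 0 <= lam -> 1 / 2 <= s -> 0 < del -> del <= 1 ->
  0 <= K -> K <= (a + 1) * s -> 0 <= eta -> eta <= A * s * del ^+ 2 ->
  regime_const a A * (16 * (s ^+ 4 * del)) <= 1 ->
  let t := a * s in let eps := (K + 1) * del in
  [/\ eps <= t, t * (eps + (t + eps) * del ^+ 2) <= 1,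
      (t + eps) ^+ 3 * del ^+ 2 <= 1, (t + eps) ^+ 2 * eta <= 1 &
      (t + eps) * (6 * del ^+ 2) <= 1] /\
  eps + (t + eps) * del ^+ 2 + lam *
     (4 * (eta + del ^+ 2) / del + (eta + del) * (t + eps) ^+ 2)
  <= regime_error a A lam * (s ^+ 2 * del).
Proof.
move=> a0 A0 lam0 s12 d0 d1 K0 Ks e0 es small t eps.
have s0 : 0 < s by lra.
have s2 : 1 <= 2 * s by lra.
pose u := 16 * (s ^+ 4 * del).
have mono j : (j <= 4)%N -> s ^+ j * del <= u.
  move=> j4; rewrite /u.
  have -> : 16 * (s ^+ 4 * del) = (16 * s ^+ (4 - j)) * (s ^+ j * del).
    by rewrite mulrA mulrA -[in RHS](mulrA 16) -exprD subnK.
  apply: ler_peMl; first by rewrite mulr_ge0 ?(ltW d0)// exprn_ge0// ltW.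
  have -> : 16 = 2 ^+ j * 2 ^+ (4 - j) :> R.
    by rewrite -exprD subnKC// -natrX.
  rewrite -mulrA -exprMn -[leLHS]mulr1 ler_pM//.
    by rewrite exprn_ege1// ler1n.
  by rewrite exprn_ege1.
have del2 : del ^+ 2 <= del by rewrite expr2 ler_piMl// ltW.
have c1 : 0 < a + 3 by lra.
have c2 : 0 < 2 * a + 3 by lra.
have Q_ge0 : [/\ 0 <= (a + 3) / a, 0 <= a * (3 * a + 6),
    0 <= (2 * a + 3) ^+ 3, 0 <= (2 * a + 3) ^+ 2 * A & 0 <= 6 * (2 * a + 3)].
  split.
  - by rewrite divr_ge0// ltW.
  - by rewrite mulr_ge0//; lra.
  - by rewrite exprn_ge0// ltW.
  - by rewrite mulr_ge0// exprn_ge0// ltW.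
  - by rewrite mulr_ge0// ltW.
have u0 : 0 <= u by rewrite /u mulr_ge0// mulr_ge0 ?(ltW d0)// exprn_ge0// ltW.
have usmall c : 0 <= c -> c <= regime_const a A -> c * u <= 1.
  by move=> ? cQ; apply: le_trans small; apply: ler_wpM2r.
have [q1 q2 q3 q4 q5] := Q_ge0.
have [[Q1 Q2 Q3 Q4 Q5] Q6] : [/\ (a + 3) / a <= regime_const a A,
   a * (3 * a + 6) <= regime_const a A, (2 * a + 3) ^+ 3 <= regime_const a A,
   (2 * a + 3) ^+ 2 * A <= regime_const a A & 6 * (2 * a + 3) <= regime_const a A]
   /\ 1 <= regime_const a A.
  move: q1 q2 q3 q4 q5; rewrite /regime_const.
  move: ((a + 3) / a) (a * _) (_ ^+ 3) (_ * A) (6 * _) => v1 v2 v3 v4 v5.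
  by clear; split; [split|]; lra.
have eps1 : eps <= (a + 3) * (s * del).
  rewrite /eps mulrA ler_wpM2r ?(ltW d0)//; lra.
have eps0 : 0 <= eps by rewrite /eps mulr_ge0 ?(ltW d0)// addr_ge0.
have eps2 : eps <= (a + 3) * s.
  apply: (le_trans eps1); rewrite ler_wpM2l ?(ltW c1)//.
  by rewrite ler_piMr// ltW.
have te : t + eps <= (2 * a + 3) * s by rewrite /t; lra.
have te0 : 0 <= t + eps by rewrite addr_ge0// mulr_ge0// ltW.
have sd1 : s * del <= 1.
  by apply: (le_trans (mono 1%N _)) => //; rewrite -[u]mul1r usmall.
have s2d : s * del <= 2 * (s ^+ 2 * del).
  rewrite [2 * _]mulrA ler_wpM2r ?(ltW d0)// expr2 mulrA.
  by rewrite ler_peMl// ltW.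
have d2d : del <= 4 * (s ^+ 2 * del).
  rewrite mulrA ler_peMl ?(ltW d0)//.
  have -> : 4 * s ^+ 2 = (2 * s) ^+ 2 by ring.
  exact: exprn_ege1.
have kap1 : eps + (t + eps) * del ^+ 2 <= (3 * a + 6) * (s * del).
  have h : (t + eps) * del ^+ 2 <= (2 * a + 3) * s * del.
    by apply: ler_pM => //; rewrite exprn_ge0// ltW.
  have -> : (3 * a + 6) * (s * del) = (a + 3) * (s * del) + (2 * a + 3) * s * del.
    by ring.
  exact: lerD.
have sdel2 j : s ^+ j * del ^+ 2 <= s ^+ j * del.
  by rewrite ler_wpM2l// exprn_ge0// ltW.
have p2 : 0 <= del ^+ 2 by rewrite exprn_ge0// ltW.
have te2 : (t + eps) ^+ 2 <= (2 * a + 3) ^+ 2 * s ^+ 2.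
  by rewrite -exprMn; apply: lerXn2r; rewrite ?nnegrE// mulr_ge0// ltW.
have te20 : 0 <= (t + eps) ^+ 2 by rewrite exprn_ge0.
split; first split.
- apply: (le_trans eps1); rewrite /t.
  have h : (a + 3) / a * del <= 1.
    apply: le_trans (usmall _ q1 Q1); rewrite ler_wpM2l//.
    by have := mono 0%N isT; rewrite expr0 mul1r.
  have -> : (a + 3) * (s * del) = a * s * ((a + 3) / a * del).
    by field; rewrite gt_eqF.
  by rewrite ler_piMr// mulr_ge0// ltW.
- apply: (@le_trans _ _ (a * s * ((3 * a + 6) * (s * del)))).
    by rewrite ler_wpM2l// mulr_ge0// ltW.
  have -> : a * s * ((3 * a + 6) * (s * del)) = a * (3 * a + 6) * (s ^+ 2 * del).
    by ring.
  by apply: le_trans (usmall _ q2 Q2); rewrite ler_wpM2l// mono.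
- apply: (@le_trans _ _ ((2 * a + 3) ^+ 3 * (s ^+ 3 * del))).
    rewrite mulrA -exprMn; apply: ler_pM => //; first by rewrite exprn_ge0.
    by apply: lerXn2r; rewrite ?nnegrE// mulr_ge0// ltW.
  by apply: le_trans (usmall _ q3 Q3); rewrite ler_wpM2l// mono.
- apply: (@le_trans _ _ ((2 * a + 3) ^+ 2 * A * (s ^+ 3 * del))).
    have -> : (2 * a + 3) ^+ 2 * A * (s ^+ 3 * del) =
       (2 * a + 3) ^+ 2 * s ^+ 2 * (A * s * del) by ring.
    apply: ler_pM => //; apply: (le_trans es).
    by rewrite ler_wpM2l// mulr_ge0// ltW.
  by apply: le_trans (usmall _ q4 Q4); rewrite ler_wpM2l// mono.
- apply: (@le_trans _ _ (6 * (2 * a + 3) * (s * del))).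
    have -> : 6 * (2 * a + 3) * (s * del) = (2 * a + 3) * s * (6 * del) by ring.
    by apply: ler_pM => //; [rewrite mulr_ge0|rewrite ler_wpM2l].
  by apply: le_trans (usmall _ q5 Q5); rewrite ler_wpM2l// (mono 1%N).
rewrite /regime_error [leRHS]mulrDl; apply: lerD.
  apply: (le_trans kap1).
  have -> : 2 * (3 * a + 6) * (s ^+ 2 * del) = (3 * a + 6) * (2 * (s ^+ 2 * del)).
    by ring.
  by rewrite ler_wpM2l//; lra.
rewrite -[leRHS]mulrA ler_wpM2l// [leRHS]mulrDl; apply: lerD.
  rewrite ler_pdivrMr//.
  apply: (@le_trans _ _ (4 * (A * s * del ^+ 2 + del ^+ 2))).
    by rewrite ler_wpM2l// lerD2r.
  have -> : 4 * (A * s * del ^+ 2 + del ^+ 2) =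
     (4 * A * (s * del) + 4 * del) * del by ring.
  rewrite ler_wpM2r ?(ltW d0)// [leRHS]mulrDl; apply: lerD; last by lra.
  have -> : 8 * A * (s ^+ 2 * del) = 4 * A * (2 * (s ^+ 2 * del)) by ring.
  by rewrite ler_wpM2l// mulr_ge0.
have -> : (A + 1) * (2 * a + 3) ^+ 2 * (s ^+ 2 * del) =
  (A * del + del) * ((2 * a + 3) ^+ 2 * s ^+ 2) by ring.
apply: ler_pM => //; first by rewrite addr_ge0// ltW.
rewrite lerD2r; apply: (le_trans es).
have -> : A * s * del ^+ 2 = A * del * (s * del) by ring.
by rewrite ler_piMr// mulr_ge0// ltW.
Qed.

End regime.

(** * The Gaussian sample and the two regimes *)

Section sample.
Context d (T : measurableType d) (R : realType) (P : probability T R).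
Variables (n : nat) (Y Z : 'I_n -> {RV P >-> R}).
Variables (nu : probability (R * R)%type R).

(** Sequences are indexed by all the natural numbers, with an arbitrary value
    beyond the sample size. *)
Definition sample (k : nat) (w : T) : R * R :=
  if insub k is Some i then (Y i w, Z i w) else (0, 0).

Lemma sampleE (i : 'I_n) : sample i = fun w => (Y i w, Z i w).
Proof. by rewrite /sample valK. Qed.

Lemma measurable_sample k : measurable_fun setT (sample k).
Proof.
rewrite /sample; case: insubP => [i _ _|_]; last exact: measurable_cst.
by apply/measurable_fun_pair.
Qed.

Hypothesis hindep : mutually_independent P (fun k w => (Y k w, Z k w)).
Hypothesis hlaw : forall (k : 'I_n) (B : set (R * R)), measurable B ->
  P ((fun w => (Y k w, Z k w)) @^-1` B) = nu B.

Lemma sample_initial k (B : nat -> set (R * R)) : (k <= n)%N ->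
  (forall i, measurable (B i)) ->
  P (\bigcap_(i < k) sample i @^-1` B i) =
  (\prod_(i in [set i : 'I_n | (i < k)%N]%SET) nu (B i))%E.
Proof.
move=> kn mB.
rewrite (_ : \bigcap_(i < k) _ =
  \bigcap_(i in [set` [set i : 'I_n | (i < k)%N]%SET])
     ((fun w => (Y i w, Z i w)) @^-1` B i)); last first.
  apply/seteqP; split => w Aw.
    by move=> i; rewrite /= inE => ik; have := Aw i ik; rewrite sampleE.
  move=> i /= ik; have := Aw (Ordinal (leq_trans ik kn)).
  rewrite -[i in sample i]/(val (Ordinal (leq_trans ik kn))) sampleE.
  by apply; rewrite /= inE.
rewrite (hindep _ (fun i => mB i)).
by apply: eq_bigr => i _; exact: hlaw.
Qed.

Lemma iid_sample : iid P nu sample n.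
Proof.
move=> k kn B mB; rewrite !sample_initial//; last exact: ltnW.
have -> : [set i : 'I_n | (i < k.+1)%N]%SET =
    (Ordinal kn |: [set i : 'I_n | (i < k)%N])%SET.
  by apply/setP => i; rewrite !inE ltnS leq_eqVlt -val_eqE.
by rewrite big_setU1/= ?inE ?ltnn// muleC.
Qed.

Lemma kendall_tau_hat_ustat w :
  kendall_tau_hat (fun k => Y k w) (fun k => Z k w) =
  ustat sample n kendall_kernel w.
Proof.
rewrite /kendall_tau_hat /ustat; congr (_ * _).
by apply: eq_bigr => k _; apply: eq_bigr => l _; rewrite !sampleE.
Qed.

(** Fubini on the product space turns the mean over two independent copies into
    the mean of the projection. *)
Lemma kendall_tau_mean (k : 'I_n) :
  kendall_tau P (Y k) (Z k) = kmean nu kendall_kernel.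
Proof.
have mX := measurable_sample k.
have nuE B : measurable B -> nu B = P (sample k @^-1` B).
  by move=> mB; rewrite sampleE hlaw.
have bK : bmfun (fun z : (R * R) * (R * R) => kendall_kernel z.1 z.2).
  exact: bm_kendall.
have bF : bmfun (fun z : T * T => kendall_kernel (sample k z.1) (sample k z.2)).
  by apply: bm_kendall; apply: measurableT_comp.
transitivity (\int[(P \x P)%E]_z kendall_kernel (sample k z.1) (sample k z.2)).
  rewrite /kendall_tau -[LHS]/(Rintegral _ _ _); apply: eq_Ex => z.
  by rewrite sampleE /kendall_kernel/= sgrM.
rewrite Ex_prod// /kmean.
rewrite (@Ex_push _ _ _ _ _ P nu (sample k) (kproj nu kendall_kernel))//; last first.
  exact: (bm_kproj nu bK).
apply: eq_Ex => w; rewrite /kproj.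
rewrite (@Ex_push _ _ _ _ _ P nu (sample k) (kendall_kernel (sample k w)))//.
exact: (bm_sec1 _ bK).
Qed.

End sample.

Section rates.
Context {R : realType}.
Implicit Types (v L beta a : R).

(** The power v^(-1/4), in the form suited to comparison with the Gaussian
    exponentials. *)
Definition rate v : R := expR (- (ln v / 4)).

Lemma rate_gt0 v : 0 < rate v. Proof. exact: expR_gt0. Qed.

Lemma rate_le1 v : 1 <= v -> rate v <= 1.
Proof. by move=> v1; rewrite -[leRHS]expR0 ler_expR oppr_le0 divr_ge0// ln_ge0. Qed.

Lemma rate4 v : 0 < v -> rate v ^+ 4 = v^-1.
Proof.
move=> v0; rewrite -expRM_natl (_ : 4%:R * _ = - ln v); last by field.
by rewrite expRN lnK.
Qed.

Lemma powR_quarter v : 0 < v -> v `^ (1 / 4) = (rate v)^-1.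
Proof.
move=> v0; rewrite /powR gt_eqF// /rate expRN invrK; congr expR.
by rewrite mul1r mulrC.
Qed.

Lemma sqrt_ratio L v : 0 <= L -> 0 < v ->
  Num.sqrt (L / v) = Num.sqrt L * rate v ^+ 2.
Proof.
move=> L0 v0; rewrite sqrtrM//; congr (_ * _).
rewrite -(rate4 v0) (_ : rate v ^+ 4 = (rate v ^+ 2) ^+ 2); last by rewrite -exprM.
by rewrite sqrtr_sqr ger0_norm// exprn_ge0// ltW// rate_gt0.
Qed.

Lemma ln_ge_half (p : nat) : (2 < p)%N -> 1 / 2 <= ln p%:R :> R.
Proof.
move=> p2; have p0 : 0 < p%:R :> R by rewrite ltr0n ltnW// ltnW.
have := expR_ge1Dx (- ln p%:R : R); rewrite expRN lnK//.
have : p%:R^-1 <= 2^-1 :> R by rewrite lef_pV2 ?posrE// ler_nat ltnW.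
lra.
Qed.

(** A high power of n^(-1/4) beats exp(-t^2/2), since t^2 is at most a multiple
    of log n: this is where p <= n^beta is used for large samples. *)
Lemma power_rate v L a beta (m : nat) : 1 <= v -> L <= beta * ln v ->
  a ^+ 2 * beta <= m%:R ->
  rate v ^+ (m.*2).+2 <= rate v * expR (- ((a ^+ 2 * L) / 2)).
Proof.
move=> v1 Lv am; rewrite exprS ler_wpM2l ?(ltW (rate_gt0 v))//.
rewrite /rate -expRM_natl ler_expR mulrN lerN2.
have l0 : 0 <= ln v by rewrite ln_ge0.
have h1 : a ^+ 2 * L <= a ^+ 2 * (beta * ln v) by rewrite ler_wpM2l ?sqr_ge0.
have h2 : a ^+ 2 * beta * ln v <= m%:R * ln v by rewrite ler_wpM2r.
have -> : (m.*2).+1%:R = 2 * m%:R + 1 :> R by rewrite -natr1 -mul2n natrM.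
move: h1 h2; rewrite mulrA; move: (a ^+ 2 * beta * ln v) (a ^+ 2 * L) => x y.
nra.
Qed.

(* Bound for n^(1/8) when the conditions for large samples fail. *)
Definition small_const Q beta : R := 4096 * Q * beta ^+ 2.

(** If log^2 p / n^(1/4) is bounded below while log p <= beta log n, then n is
    bounded. Hence so are p and the reciprocal of the announced error, and any
    probability is covered by a large constant. *)
Lemma small_sample v L a beta Q : 1 <= v -> 0 < Q -> 0 < beta -> 1 / 2 <= L ->
  L <= beta * ln v -> 1 < Q * (16 * (L ^+ 2 * rate v)) ->
  2 <= 4 * small_const Q beta ^+ 2 *
       expR (8 * a ^+ 2 * beta * small_const Q beta) *
       (L * rate v) * expR (- ((a ^+ 2 * L) / 2)).
Proof.
move=> v1 Q0 b0 L12 Lv small; set Yb := small_const Q beta.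
(* y = v^(1/16) satisfies ln v <= 16 y, while rate v = y^(-4). *)
pose y : R := expR (ln v / 16).
have y0 : 0 < y by exact: expR_gt0.
have l0 : 0 <= ln v by rewrite ln_ge0.
have y1 : 1 <= y by rewrite -[leLHS]expR0 ler_expR divr_ge0.
have yl : ln v <= 16 * y.
  by have := expR_ge1Dx (ln v / 16); rewrite -/y; lra.
have ry : rate v * y ^+ 4 = 1.
  by rewrite /y -expRM_natl /rate -expRD -[RHS]expR0; congr expR; field.
have Ly : L <= beta * (16 * y) by rewrite (le_trans Lv)// ler_wpM2l// ltW.
have y40 : 0 < y ^+ 4 by rewrite exprn_gt0.
have y20 : 0 < y ^+ 2 by rewrite exprn_gt0.
have r0 := rate_gt0 v.
have L2 : L ^+ 2 <= (beta * (16 * y)) ^+ 2.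
  by rewrite lerXn2r// nnegrE; [lra|rewrite mulr_ge0 ?(ltW b0)// mulr_ge0// ltW].
have yY : y ^+ 2 <= Yb.
  have h : y ^+ 4 <= Yb * y ^+ 2.
    have e : y ^+ 4 * (Q * (16 * (L ^+ 2 * rate v))) = 16 * Q * L ^+ 2.
      by rewrite -[RHS]mulr1 -ry; ring.
    have : y ^+ 4 <= y ^+ 4 * (Q * (16 * (L ^+ 2 * rate v))).
      by rewrite ler_peMr ?(ltW y40)// ltW.
    rewrite e => /le_trans; apply.
    have -> : Yb * y ^+ 2 = 16 * Q * (beta * (16 * y)) ^+ 2.
      by rewrite /Yb /small_const; ring.
    by rewrite ler_wpM2l// mulr_ge0// ltW.
  by rewrite -(ler_pM2r y20) -exprD.
have yY1 : y <= Yb by rewrite (le_trans _ yY)// expr2 ler_peMl// ltW.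
have Yb0 : 0 < Yb by exact: lt_le_trans yY1.
have E1 : 1 <= expR (8 * a ^+ 2 * beta * Yb) * expR (- ((a ^+ 2 * L) / 2)).
  rewrite -expRD -[leLHS]expR0 ler_expR subr_ge0.
  have : a ^+ 2 * L <= a ^+ 2 * (beta * (16 * Yb)).
    rewrite ler_wpM2l ?sqr_ge0// (le_trans Ly)// ler_wpM2l ?(ltW b0)//.
    by rewrite ler_wpM2l.
  have -> : 8 * a ^+ 2 * beta * Yb = a ^+ 2 * (beta * (16 * Yb)) / 2 by field.
  by move=> ?; rewrite ler_wpM2r.
have r1 : 1 <= Yb ^+ 2 * rate v.
  rewrite -ry mulrC ler_wpM2r ?(ltW r0)//.
  rewrite (_ : y ^+ 4 = (y ^+ 2) ^+ 2); last by rewrite -exprM.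
  by rewrite lerXn2r// nnegrE ltW.
have -> : 4 * Yb ^+ 2 * expR (8 * a ^+ 2 * beta * Yb) * (L * rate v) *
   expR (- (a ^+ 2 * L / 2)) = (4 * L) * ((Yb ^+ 2 * rate v) *
   (expR (8 * a ^+ 2 * beta * Yb) * expR (- (a ^+ 2 * L / 2)))) by ring.
rewrite -[leLHS]mulr1; apply: ler_pM => //; first by lra.
by rewrite -[leLHS]mulr1; apply: ler_pM.
Qed.

End rates.

Lemma error_arith {R : realType} (E x RE del F1 C3 dN w : R) :
  0 <= E -> 0 <= C3 -> 0 <= del -> 1 / 2 <= w -> x <= RE * (w * del) ->
  F1 <= E * del -> dN <= del * E ->
  2 * (expR 1 * E * x + F1 + C3 * dN) <=
  2 * (expR 1 * RE + 2 + 2 * C3) * (w * del) * E.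
Proof.
move=> E0 C30 d0 w12 xRE F1E dNE.
have e0 : 0 <= E * expR 1 by rewrite mulr_ge0// expR_ge0.
have h1 : E * expR 1 * x <= E * expR 1 * (RE * (w * del)) by rewrite ler_wpM2l.
have h2 : C3 * dN <= C3 * (del * E) by rewrite ler_wpM2l.
have h3 : del * E <= 2 * w * (del * E).
  by rewrite ler_peMl ?mulr_ge0//; lra.
have h4 : C3 * (del * E) <= C3 * (2 * w * (del * E)) by rewrite ler_wpM2l.
have h5 : 0 <= del * E by rewrite mulr_ge0.
move: h1 h2 h3 h4 F1E; rewrite [E * del]mulrC.
rewrite [expR 1 * E]mulrC.
have -> : 2 * (expR 1 * RE + 2 + 2 * C3) * (w * del) * E =
  2 * (E * expR 1 * (RE * (w * del)) + 2 * w * (del * E)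
      + C3 * (2 * w * (del * E))) by ring.
lra.
Qed.

Section accuracy.
Context {R : realType}.

Definition error_const (a A : R) (m : nat) : R :=
  2 * (expR 1 * regime_error a A (lindC 6) + 2 +
       2 * (momC m ^+ 2 * 24 ^+ (m.*2).+2)).

(** The choice K^2 = t^2 + (log n) / 2 makes the unsmoothing error exp(-K^2/2)
    equal to exp(-t^2/2) n^(-1/4). *)
Lemma ustat_error_rate (v s a beta A eta : R) (m : nat) :
  0 < a -> 0 <= A -> 1 <= v -> 0 <= s -> 1 / 2 <= s ^+ 2 -> ln v <= s ^+ 2 ->
  s ^+ 2 <= beta * ln v -> a ^+ 2 * beta <= m%:R ->
  0 <= eta -> eta <= A * s * rate v ^+ 2 ->
  regime_const a A * (16 * (s ^+ 4 * rate v)) <= 1 ->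
  let del := rate v in let t := a * s in
  let K := Num.sqrt (t ^+ 2 + ln v / 2) in
  [/\ (K + 1) * del <= t,
      t * ((K + 1) * del + (t + (K + 1) * del) * del ^+ 2) <= 1,
      (t + (K + 1) * del) ^+ 3 * del ^+ 2 <= 1,
      (t + (K + 1) * del) ^+ 2 * eta <= 1 &
      (t + (K + 1) * del) * (6 * del ^+ 2) <= 1] /\
  2 * ustat_error m del eta t K <=
  error_const a A m * (s ^+ 2 * del) * expR (- (t ^+ 2 / 2)).
Proof.
move=> a0 A0 v1 s0 s2 vs sv am eta0 etaA small del t K.
have l0 : 0 <= ln v by rewrite ln_ge0.
have s12 : 1 / 2 <= s.
  rewrite leNgt; apply/negP => hs.
  have : s * s < 1 / 2 * (1 / 2) by rewrite ltr_pM.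
  by rewrite -expr2; lra.
have K20 : 0 <= t ^+ 2 + ln v / 2 by rewrite addr_ge0 ?sqr_ge0// divr_ge0.
have Ks : K <= (a + 1) * s.
  have as0 : 0 <= (a + 1) * s by rewrite mulr_ge0// addr_ge0// ltW.
  rewrite -[leRHS]ger0_norm// -sqrtr_sqr; apply: ler_wsqrtr.
  rewrite /t !exprMn sqrrD mulr1 expr1n.
  have : 0 <= a * s ^+ 2 by rewrite mulr_ge0 ?sqr_ge0// ltW.
  by nra.
have [conds err] := regime a0 A0 (lindC_ge0 (ler0n R 6)) s12 (rate_gt0 v) (rate_le1 v1)
  (sqrtr_ge0 _ : 0 <= K) Ks eta0 etaA small.
split; first exact: conds.
have PhiK : Phi (- K) <= expR (- (t ^+ 2 / 2)) * del.
  apply: (le_trans (Phi_tail (sqrtr_ge0 _))).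
  rewrite sqr_sqrtr// /del /rate -expRD ler_expR le_eqVlt; apply/orP; left.
  by apply/eqP; field.
have dN := power_rate v1 sv am; rewrite -exprMn in dN.
have C30 : 0 <= momC m ^+ 2 * 24 ^+ (m.*2).+2 :> R.
  by rewrite mulr_ge0 ?sqr_ge0// exprn_ge0.
exact: (error_arith (expR_ge0 (- (t ^+ 2 / 2))) C30 (ltW (rate_gt0 v)) s2 err PhiK dN).
Qed.

End accuracy.

(** * The normal approximation *)

Theorem proposition5p3 (R : realType) (zeta beta gamma : R)
    (hzeta : 0 < zeta) (hbeta : 1 < beta) (hgamma : 0 < gamma) :
  exists2 C : R, 0 < C &
  forall (n p : nat) (hn : (2 <= n)%N) (hnp : (n < p)%N)
    (hp : p%:R <= n%:R `^ beta)
    (d : measure_display) (T : measurableType d) (P : probability T R)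
    (Y Z : 'I_n -> {RV P >-> R}) (mu : 'cV[R]_2) (Sigma : 'M[R]_2)
    (hindep : mutually_independent P (fun k w => (Y k w, Z k w)))
    (hlaw : forall k, has_normal2_law P (fun w => (Y k w, Z k w)) mu Sigma)
    (hSigma11 : 0 < Sigma 0 0) (hSigma22 : 0 < Sigma 1 1)
    (hcorr : `|Sigma 0 1 / Num.sqrt (Sigma 0 0 * Sigma 1 1)|
             <= Num.min (zeta * Num.sqrt (ln p%:R / n%:R)) (3 / 4)),
  let first : 'I_n := Ordinal (ltnW hn) in
  exists2 Rem : R,
    P [set w | gamma * Num.sqrt (ln p%:R / n%:R) <=
               `|kendall_tau_hat (fun k => Y k w) (fun k => Z k w)
                 - kendall_tau P (Y first) (Z first)| ]
    = (2 * (1 - Phi (3 / 2 * gamma * Num.sqrt (ln p%:R))) + Rem)%:E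
  & `|Rem| <= C * (ln p%:R / n%:R `^ (1 / 4)) * p%:R `^ (- (9 / 8 * gamma ^+ 2)).
Proof.
pose a := 3 / 2 * gamma; pose A := 432 * absK * zeta.
pose m := Num.bound (a ^+ 2 * beta); pose Q := regime_const a A.
(* C1 serves the samples with log^2 p / n^(1/4) small, C2 the others. *)
pose C1 := error_const a A m.
pose C2 := 4 * small_const Q beta ^+ 2 * expR (8 * a ^+ 2 * beta * small_const Q beta).
have a0 : 0 < a by rewrite mulr_gt0.
have absK432 : 0 <= 432 * absK :> R := mulr_ge0 (ler0n R 432) absK_ge0.
have A0 : 0 <= A := mulr_ge0 absK432 (ltW hzeta).
have beta0 : 0 < beta by rewrite (lt_trans _ hbeta).
have Q1 : 1 <= Q by exact: regime_const_ge1.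
have re0 : 0 <= regime_error a A (lindC 6) := regime_error_ge0 a0 A0 (lindC_ge0 (ler0n R 6)).
have C10 : 0 <= C1.
  have C3 : 0 <= momC m ^+ 2 * 24 ^+ (m.*2).+2 :> R.
    by rewrite mulr_ge0 ?sqr_ge0// exprn_ge0.
  apply: mulr_ge0 => //; apply: addr_ge0; last exact: mulr_ge0.
  by apply: addr_ge0 => //; rewrite mulr_ge0// expR_ge0.
have C20 : 0 <= C2.
  by apply: mulr_ge0; [rewrite mulr_ge0// sqr_ge0|exact: expR_ge0].
have C0 : 0 < C1 + C2 + 1 by rewrite ltr_wpDl// addr_ge0.
exists (C1 + C2 + 1) => //.
move=> n p hn hnp hp d T P Y Z mu Sigma hindep hlaw S11 S22 hcorr first.
set v : R := n%:R; set L : R := ln p%:R; pose s := Num.sqrt L.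
have v1 : 1 <= v by rewrite ler1n ltnW.
have v0 : 0 < v by rewrite (lt_le_trans _ v1).
have L12 : 1 / 2 <= L by apply: ln_ge_half; exact: leq_ltn_trans hnp.
have L0 : 0 <= L by lra.
have s2 : s ^+ 2 = L by rewrite sqr_sqrtr.
have s0 : 0 <= s by exact: sqrtr_ge0.
have p0 : 0 < p%:R :> R by rewrite ltr0n (leq_ltn_trans _ hnp).
have vL : ln v <= L by rewrite ler_ln ?posrE// ler_nat ltnW.
have Lv : L <= beta * ln v.
  by rewrite -ln_powR ler_ln ?posrE// powR_gt0.
rewrite (sqrt_ratio L0 v0) powR_quarter// invrK.
have -> : p%:R `^ (- (9 / 8 * gamma ^+ 2)) = expR (- ((a ^+ 2 * L) / 2)) :> R.
  by rewrite /powR gt_eqF// -/L; congr expR; rewrite /a; field.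
rewrite -/s.
set E := expR _; pose del := rate v.
have del0 : 0 < del := rate_gt0 v.
pose t := a * s.
have t0 : 0 < t by rewrite mulr_gt0// sqrtr_gt0; lra.
have EE : expR (- (t ^+ 2 / 2)) = E by rewrite /E /t exprMn s2.
have -> : 1 - Phi (3 / 2 * gamma * s) = Phi (- t) by rewrite PhiN.
set rho := Sigma 0 1 / _ in hcorr.
move: hcorr; rewrite le_min => /andP[hrho1 hrho2].
rewrite (sqrt_ratio L0 v0) -/s in hrho1.
pose nu := pair_law (mu 0 0) (mu 1 0) (Num.sqrt (Sigma 0 0))
    (Num.sqrt (Sigma 1 1)) rho.
have nuE (k : 'I_n) (B : set (R * R)) : measurable B ->
    P ((fun w => (Y k w, Z k w)) @^-1` B) = nu B.
  by move=> mB; rewrite (has_normal2_law_std (hlaw k) S11 S22 hrho2 mB).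
pose X := sample Y Z.
have mX : forall k, measurable_fun setT (X k) := measurable_sample Y Z.
have iX : iid P nu X n := iid_sample hindep nuE.
pose tau := kmean nu kendall_kernel.
have -> : [set w | gamma * (s * del ^+ 2) <=
    `|kendall_tau_hat (fun k => Y k w) (fun k => Z k w)
       - kendall_tau P (Y first) (Z first)| ] =
    [set w | t <= `|3 / 2 / del ^+ 2 * (ustat X n kendall_kernel w - tau)|].
  apply/funext => w /=; rewrite kendall_tau_hat_ustat (kendall_tau_mean nuE).
  rewrite -/X -/tau normrM.
  have d2 : 0 < del ^+ 2 by rewrite exprn_gt0.
  rewrite (ger0_norm (_ : 0 <= 3 / 2 / del ^+ 2)); last by rewrite divr_ge0// ltW.
  rewrite mulrAC ler_pdivlMr// /t /a.
  have -> : 3 / 2 * gamma * s * del ^+ 2 = 3 / 2 * (gamma * (s * del ^+ 2)) by ring.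
  by rewrite ler_pM2l.
set ev := [set w | t <= _].
have bK : bmfun (fun z : (R * R) * (R * R) => kendall_kernel z.1 z.2).
  exact: bm_kendall.
have bU : bmfun (fun w => ustat X n kendall_kernel w).
  apply: bm_mul; first exact: bm_cst.
  rewrite (_ : (fun w => _) = (fun w => \sum_(k < n) \sum_(l < n)
     (if l != k then kendall_kernel (X k w) (X l w) else 0))); last first.
    by apply/funext => w; apply: eq_bigr => k _; rewrite big_mkcond.
  apply: (@bm_sum_ord _ _ _ n (fun k w => \sum_(l < n)
     (if (l : nat) != k then kendall_kernel (X k w) (X l w) else 0))) => k _.
  apply: (@bm_sum_ord _ _ _ n (fun l w =>
     (if (l : nat) != k then kendall_kernel (X k w) (X l w) else 0))) => l _.
  by case: (l != k); [exact: bm_kendall|exact: bm_cst].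
have mev : measurable ev.
  have [mU _] : bmfun (fun w => `|3 / 2 / del ^+ 2 * (ustat X n kendall_kernel w - tau)|).
    apply: bm_norm; apply: bm_mul; first exact: bm_cst.
    by apply: bm_sub => //; exact: bm_cst.
  exact: (measurable_ge t mU).
exists (pr P ev - 2 * Phi (- t)).
  by rewrite (pr_EFin P mev); congr EFin; ring.
have Ldel0 : 0 <= L * del by rewrite mulr_ge0// ltW.
have E0 : 0 <= E by exact: expR_ge0.
suff [h|h] : `|pr P ev - 2 * Phi (- t)| <= C1 * (L * del) * E \/
    `|pr P ev - 2 * Phi (- t)| <= C2 * (L * del) * E.
- apply: (le_trans h); rewrite !ler_wpM2r//.
  by rewrite -addrA lerDl addr_ge0.
- apply: (le_trans h); rewrite !ler_wpM2r//.
  by rewrite addrAC lerDr addr_ge0.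
have [small|large] := leP (Q * (16 * (L ^+ 2 * del))) 1; [left|right].
  pose eta := 432 * absK * `|rho|.
  have eta0 : 0 <= eta := mulr_ge0 absK432 (normr_ge0 rho).
  have etaA : eta <= A * s * del ^+ 2.
    have -> : A * s * del ^+ 2 = 432 * absK * (zeta * (s * del ^+ 2)).
      by rewrite /A; ring.
    exact: (ler_wpM2l absK432 hrho1).
  have am : a ^+ 2 * beta <= m%:R.
    by apply/ltW/archi_boundP; rewrite mulr_ge0 ?sqr_ge0// ltW.
  have L2 : L ^+ 2 = s ^+ 4 by rewrite -s2 -exprM.
  rewrite L2 in small; rewrite -s2 in L12 vL Lv.
  have [[c1 c2 c3 c4 c5] err] := ustat_error_rate a0 A0 v1 s0 L12 vL Lv am eta0 etaA small.
  have gvar := kendall_variance (mu 0 0) (mu 1 0) (_ : 0 < Num.sqrt (Sigma 0 0))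
     (_ : 0 < Num.sqrt (Sigma 1 1)) hrho2.
  rewrite !sqrtr_gt0 in gvar.
  have md := ustat_moderate_deviation m mX iX bK (@kendall_kernelC R)
    (@kendall_kernel_le1 R) (gvar S11 S22) hn del0 (rate4 v0) t0
    (sqrtr_ge0 _) eta0 c1 c2 c3 c4 c5.
  by apply: (le_trans md); rewrite -s2 -EE.
apply: le_trans (small_sample a v1 (lt_le_trans ltr01 Q1) beta0 L12 Lv large).
have pr1 : pr P ev <= 1.
  by rewrite -lee_fin -(pr_EFin P mev) probability_le1.
have pr0 := pr_ge0 P ev.
have F0 := Phi_ge0 (- t); have F1 := Phi_le1 (- t).
move: pr1 pr0 F0 F1; move: (pr P ev) (Phi _) => x y; clear.
by move=> *; rewrite ler_norml; apply/andP; split; lra.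
Qed.
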